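(* Let $d\ge2$ and let $\mathbf C=(C_1,\dots,C_n)$ be a camera arrangement. The multiview varieties $\mathcal C_{\mathbf C,d}$ and $\mathcal C_{\mathbf C}^{\mathrm{tw}}$ are irreducible. If $\mathbf C$ contains at least two cameras with distinct centers, then $$\dim\mathcal C_{\mathbf C,d}=\tfrac12d^2+\tfrac32d+3\qquad\text{and}\qquad\dim\mathcal C_{\mathbf C}^{\mathrm{tw}}=12.$$
   Context: We work over $\mathbb C$. A camera is a full-rank matrix $C\in\mathbb C^{3\times4}$, viewed as a rational map $\mathbb P^3\dashrightarrow\mathbb P^2$; its center is $c=\ker C\in\mathbb P^3$. A camera arrangement is a tuple of cameras. Veronese notation: $\nu_d^N(X)$ is the vector of all degree-$d$ monomials in the coordinates of $X\in\mathbb P^N$; for an $(h+1)\times(N+1)$ matrix $A$, $\nu_d^{h,N}(A)$ is the matrix with $\nu_d^h(AX)=\nu_d^{h,N}(A)\nu_d^N(X)$ for all $X$. A point $\gamma\in\mathbb P^{\binom{d+2}{2}-1}$ is identified with the plane curve $\{x\in\mathbb P^2:\gamma^\top\nu_d^2(x)=0\}$. Lines in $\mathbb P^3$ have Plücker coordinates $L=(L_0:\cdots:L_5)\in\mathbb P^5$ in the order $[12],[13],[14],[23],[24],[34]$. A degree-$d$ curve in $\mathbb P^3$ is represented by its Chow form $\beta\in\mathbb P^{\binom{d+5}{5}-1}$, characterized by: $\beta^\top\nu_d^5(L)=0$ if and only if the line $L$ meets the curve. For $c=(c^{(0)}:c^{(1)}:c^{(2)}:c^{(3)})$ let $$E(c)=\begin{bmatrix}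 c^{(1)} & -c^{(0)} & 0 & 0 \\ c^{(2)} & 0 & -c^{(0)} & 0 \\ c^{(3)} & 0 & 0 & -c^{(0)} \\ 0 & c^{(2)} & -c^{(1)} & 0 \\ 0 & c^{(3)} & 0 & -c^{(1)} \\ 0 & 0 & c^{(3)} & -c^{(2)} \end{bmatrix},$$ and for a camera $C$ with center $c$ let $\hat C=E(c)C^\dagger$, where $C^\dagger$ satisfies $CC^\dagger=I$. (So $\hat Cx$ is the line of points projected onto $x$.) The image under $C$ of a curve with Chow form $\beta$ not meeting $c$ is $\nu_d^{5,2}(\hat C)^\top\beta$. Plane curves: for $h\in(\mathbb P^3)^*$ let $$\hat H(h)=\begin{bmatrix} h_0 & 0 & 0 & -h_2 & -h_3 & 0 \\ 0 & h_0 & 0 & h_1 & 0 & -h_3 \\ 0 & 0 & h_0 & 0 & h_1 & h_2 \end{bmatrix}.$$ The Chow form of the degree-$d$ curve in the plane $h^\top X=0$ that is the image of $\{\alpha^\top\nu_d^2(x)=0\}$ under $\begin{bmatrix} -h_1 & -h_2 & -h_3 \\ h_0 & 0 & 0 \\ 0 & h_0 & 0 \\ 0 & 0 & h_0 \end{bmatrix}$ is $\nu_d^{2,5}(\hat H(h))^\top\alpha$. Define $$\Phi_{\mathbf C,d}:(\mathbb P^3)^*\times\mathbb P^{\binom{d+2}2-1}\dashrightarrow\big(\mathbb P^{\binom{d+2}2-1}\big)^n,\quad(h,\alpha)\mapsto\big(\nu_d^{5,2}(\hat C_i)^\top\nu_d^{2,5}(\hat H(h))^\top\alpha\big)_{i=1}^n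 .$$ The degree-$d$ plane curve multiview variety $\mathcal C_{\mathbf C,d}$ is the Zariski closure of the image of $\Phi_{\mathbf C,d}$. Twisted cubics: a twisted cubic is the image of the standard twisted cubic $\{(s^3:s^2t:st^2:t^3)\}\subseteq\mathbb P^3$ under a full-rank $M\in\mathbb P(\mathbb C^{4\times4})$. $\mathrm{Ch}_{\mathrm{tw}}(\mathbb P^3)\subseteq\mathbb P^{55}$ is the Zariski closure of the set of Chow forms of twisted cubics. Define $$\Psi^{\mathrm{Ch}}_{\mathbf C}:\mathrm{Ch}_{\mathrm{tw}}(\mathbb P^3)\dashrightarrow(\mathbb P^9)^n,\quad\beta\mapsto\big(\nu_3^{5,2}(\hat C_1)^\top\beta,\dots,\nu_3^{5,2}(\hat C_n)^\top\beta\big).$$ The twisted cubic multiview variety $\mathcal C_{\mathbf C}^{\mathrm{tw}}$ is the Zariski closure of the image of $\Psi^{\mathrm{Ch}}_{\mathbf C}$. *)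

(* Defs.v *)
From mathcomp Require Import all_boot all_order all_algebra.
From mathcomp Require Import complex mpoly classical_sets reals.
From mathcomp Require Import ring.

Set Implicit Arguments.
Unset Strict Implicit.
Unset Printing Implicit Defensive.

Import GRing.Theory.
Local Open Scope ring_scope.
Local Open Scope classical_set_scope.

(* Projective points are handled through homogeneous coordinates: a point of
   P^(N-1) is a nonzero vector of size N, and a point of (P^(N-1))^n is an
   n x N matrix with nonzero rows.  The closed sets below are zero loci of
   multihomogeneous polynomials, hence invariant under rescaling of each row;
   their lattice is that of the Zariski closed subsets of (P^(N-1))^n. *)

Definition same_point (F : fieldType) (m : nat) (u v : 'cV[F]_m) : Prop :=
  exists2 a : F, a != 0 & u = a *: v.

Definition mpoints (F : fieldType) (n N : nat) : set 'M[F]_(n, N) :=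
  [set P | forall i, row i P != 0].

(* The variable with index [mxvec_index i j] is the j-th homogeneous coordinate
   of the i-th factor. *)
Definition multihomog (F : fieldType) (n N : nat) (p : {mpoly F[n * N]}) : Prop :=
  exists e : 'I_n -> nat, forall m, m \in msupp p ->
    forall i, (\sum_(j < N) m (mxvec_index i j))%N = e i.

Definition mzeros (F : fieldType) (n N : nat) (S : set {mpoly F[n * N]}) :
    set 'M[F]_(n, N) :=
  [set P | mpoints P /\ forall p, S p -> p.@[fun k => mxvec P 0 k] = 0].

Definition zclosed (F : fieldType) (n N : nat) (Z : set 'M[F]_(n, N)) : Prop :=
  exists2 S : set {mpoly F[n * N]}, S `<=` @multihomog F n N & Z = mzeros S.

Definition zclosure (F : fieldType) (n N : nat) (A : set 'M[F]_(n, N)) :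
    set 'M[F]_(n, N) :=
  smallest (@zclosed F n N) A.

Definition zirreducible (F : fieldType) (n N : nat) (X : set 'M[F]_(n, N)) : Prop :=
  X !=set0 /\
  forall A B, zclosed A -> zclosed B -> X `<=` A `|` B -> X `<=` A \/ X `<=` B.

Definition irred_chain (F : fieldType) (n N : nat) (X : set 'M[F]_(n, N))
    (l : nat) (Z : nat -> set 'M[F]_(n, N)) : Prop :=
  (forall k, (k <= l)%N -> [/\ zclosed (Z k), zirreducible (Z k) & Z k `<=` X]) /\
  (forall k, (k < l)%N -> Z k `<` Z k.+1).

(* Krull dimension of the closed set X. *)
Definition zdim (F : fieldType) (n N : nat) (X : set 'M[F]_(n, N)) (D : nat) : Prop :=
  (exists Z, irred_chain X D Z) /\
  (forall l Z, irred_chain X l Z -> (l <= D)%N).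

(* Image of the rational map given on D by the homogeneous expression f: only
   the points where every component of f is nonzero are used.  A regular
   extension of f to further points does not change the closure of the image. *)
Definition rational_image (T : Type) (F : fieldType) (n N : nat)
    (D : set T) (f : T -> 'M[F]_(n, N)) : set 'M[F]_(n, N) :=
  f @` (D `&` f @^-1` @mpoints F n N).

(* [basis N d] is the set of nondecreasing d-tuples over 'I_N, i.e. of the
   degree-d monomials in N variables; it has 'C(d + N - 1, d) elements. *)
Definition nmon (N d : nat) : nat := #|basis N d|.

Definition monomial (N d : nat) (k : 'I_(nmon N d)) : d.-tuple 'I_N := enum_val k.

Definition veronese (F : fieldType) (d N : nat) (x : 'cV[F]_N) : 'cV[F]_(nmon N d) :=
  \col_k \prod_(i <- monomial k) x i 0.

Definition linform (F : fieldType) (m N : nat) (A : 'M[F]_(m, N)) (i : 'I_m) :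
    {mpoly F[N]} :=
  \sum_(j < N) A i j *: 'X_j.

(* Row k holds the coefficients of the k-th monomial evaluated at the linear
   forms given by the rows of A; see [veronese_mulmx]. *)
Definition veronese_mx (F : fieldType) (d m N : nat) (A : 'M[F]_(m, N)) :
    'M[F]_(nmon m d, nmon N d) :=
  \matrix_(k, l) (\prod_(i <- monomial k) linform A i)@_(s2m (monomial l)).

Lemma meval_s2m (F : fieldType) (N : nat) (s : seq 'I_N) (x : 'cV[F]_N) :
  'X_[s2m s].@[fun j => x j 0] = \prod_(i <- s) x i 0.
Proof.
elim: s => [|i s IH].
  rewrite big_nil mevalX big1 // => i _; by rewrite mnmE expr0.
have -> : s2m (i :: s) = (U_(i) + s2m s)%MM.
  by apply/mnmP=> j; rewrite !mnmE /=.
by rewrite mpolyXD mevalM mevalXU IH big_cons.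
Qed.

Lemma dhomog_monomialE (F : fieldType) (N d : nat) (p : {mpoly F[N]}) :
  p \is d.-homog ->
  p = \sum_(l < nmon N d) p@_(s2m (monomial l)) *: 'X_[s2m (monomial l)].
Proof.
move=> hp; apply/mpolyP => m; rewrite raddf_sum /=.
have injm : injective (fun l : 'I_(nmon N d) => s2m (monomial l)).
  move=> k l e; apply: enum_val_inj.
  by apply: (inj_s2m (enum_valP k) (enum_valP l) e).
case: (mdeg m =P d) => /eqP hm; last first.
  rewrite (dhomog_nemf_coeff hp hm) big1 // => l _.
  rewrite mcoeffZ mcoeffX; case: eqP => [e|_]; rewrite ?mulr0 //.
  move: hm; rewrite basis_cover -e => /negP[].
  by apply/mapP; exists (monomial l); rewrite // mem_enum enum_valP.
move: hm; rewrite basis_cover => /mapP[t]; rewrite mem_enum => ht ->.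
have -> : t = monomial (enum_rank_in ht t) by rewrite /monomial enum_rankK_in.
rewrite (bigD1 (enum_rank_in ht t)) //= mcoeffZ mcoeffX eqxx mulr1.
rewrite big1 ?addr0 // => l ne; rewrite mcoeffZ mcoeffX.
by rewrite (inj_eq injm) (negbTE ne) mulr0.
Qed.

Lemma veronese_mulmx (F : fieldType) (d m N : nat) (A : 'M[F]_(m, N)) (x : 'cV[F]_N) :
  veronese d (A *m x) = veronese_mx d A *m veronese d x.
Proof.
apply/matrixP => k j; rewrite ord1 !mxE.
have lE i : (linform A i).@[fun j => x j 0] = (A *m x) i 0.
  rewrite /linform mxE raddf_sum /=; apply: eq_bigr => j' _.
  by rewrite mevalZ mevalXU.
have hom (s : seq 'I_m) : \prod_(i <- s) linform A i \is (size s).-homog.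
  elim: s => [|i s IH] /=; first by rewrite big_nil dhomog1.
  rewrite big_cons -[(size s).+1]add1n; apply: dhomogM => //.
  by apply: rpred_sum => j' _; apply: rpredZ; rewrite dhomogX /= mdeg1.
under eq_bigr do rewrite -lE.
rewrite -(big_morph _ (mevalM _) (meval1 _)).
have := hom (monomial k); rewrite size_tuple => /dhomog_monomialE {1}->.
rewrite raddf_sum /=; apply: eq_bigr => l _.
by rewrite mevalZ meval_s2m !mxE.
Qed.

Definition mx_of_rows (F : fieldType) (m N : nat) (s : seq (seq F)) : 'M[F]_(m, N) :=
  \matrix_(i, j) nth 0 (nth [::] s i) j.

Definition hcoord (F : fieldType) (N : nat) (x : 'cV[F]_N.+1) (i : nat) : F :=
  x (inord i) 0.

Definition plucker (F : fieldType) (p q : 'cV[F]_4) : 'cV[F]_6 :=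
  let w i j := hcoord p i * hcoord q j - hcoord p j * hcoord q i in
  \col_k nth 0 [:: w 0%N 1%N; w 0%N 2%N; w 0%N 3%N;
                  w 1%N 2%N; w 1%N 3%N; w 2%N 3%N] k.

Definition is_camera (F : fieldType) (C : 'M[F]_(3, 4)) : Prop := \rank C = 3%N.

Definition center (F : fieldType) (C : 'M[F]_(3, 4)) : 'cV[F]_4 :=
  (nz_row (kermx C^T))^T.

Lemma center_neq0 (F : fieldType) (C : 'M[F]_(3, 4)) : center C != 0.
Proof.
rewrite /center -(trmx0 F 1 4) (inj_eq trmx_inj) nz_row_eq0.
rewrite -mxrank_eq0 mxrank_ker -lt0n subn_gt0 mxrank_tr.
exact: leq_ltn_trans (rank_leq_row C) _.
Qed.

Lemma mulmx_center (F : fieldType) (C : 'M[F]_(3, 4)) : C *m center C = 0.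
Proof.
by apply: trmx_inj; rewrite trmx_mul trmxK trmx0; apply/sub_kermxP/nz_row_sub.
Qed.

Lemma camera_pinvmx (F : fieldType) (C : 'M[F]_(3, 4)) :
  is_camera C -> C *m pinvmx C = 1%:M.
Proof. by move=> hC; apply: mulmxVp; rewrite /row_free hC. Qed.

Definition Emx (F : fieldType) (c : 'cV[F]_4) : 'M[F]_(6, 4) :=
  let c0 := hcoord c 0 in let c1 := hcoord c 1 in
  let c2 := hcoord c 2 in let c3 := hcoord c 3 in
  mx_of_rows 6 4
    [:: [:: c1; - c0; 0;    0];
        [:: c2; 0;    - c0; 0];
        [:: c3; 0;    0;    - c0];
        [:: 0;  c2;   - c1; 0];
        [:: 0;  c3;   0;    - c1];
        [:: 0;  0;    c3;   - c2]].

Lemma Emx_mulmx (F : fieldType) (c x : 'cV[F]_4) : Emx c *m x = plucker x c.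
Proof.
apply/matrixP => k j; rewrite ord1 !mxE !big_ord_recl big_ord0 !mxE.
have e i : x (inord i) 0 = hcoord x i by [].
have -> : (lift ord0 (lift ord0 (lift ord0 ord0)) : 'I_4) = inord 3.
  by apply/val_inj; rewrite /= inordK.
have -> : (lift ord0 (lift ord0 ord0) : 'I_4) = inord 2.
  by apply/val_inj; rewrite /= inordK.
have -> : (lift ord0 ord0 : 'I_4) = inord 1 by apply/val_inj; rewrite /= inordK.
have -> : (ord0 : 'I_4) = inord 0 by apply/val_inj; rewrite /= inordK.
rewrite !e !inordK //.
by case: k; do 6 (case; first by move=> ?; rewrite /=; ring).
Qed.

(* Up to a nonzero scalar this does not depend on the choice of the center
   vector and of the right inverse of C; see [hatC_unique]. *)
Definition hatC (F : fieldType) (C : 'M[F]_(3, 4)) : 'M[F]_(6, 3) :=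
  Emx (center C) *m pinvmx C.

Lemma hatC_unique (F : fieldType) (C : 'M[F]_(3, 4)) (c : 'cV[F]_4) (D : 'M[F]_(4, 3)) :
  is_camera C -> c != 0 -> C *m c = 0 -> C *m D = 1%:M ->
  exists2 a : F, a != 0 & Emx c *m D = a *: hatC C.
Proof.
move=> hC c0 Cc CD.
have ker (x : 'cV[F]_4) : C *m x = 0 -> exists a, x = a *: center C.
  move=> Cx; have hk : \rank (kermx C^T) = 1%N by rewrite mxrank_ker mxrank_tr hC.
  have s1 : (nz_row (kermx C^T) <= kermx C^T)%MS := nz_row_sub _.
  have : (x^T <= kermx C^T)%MS.
    by apply/sub_kermxP; rewrite -trmx_mul Cx trmx0.
  have /eqmxP e : (nz_row (kermx C^T) == kermx C^T)%MS.
    rewrite -(geq_leqif (mxrank_leqif_eq s1)) hk rank_rV nz_row_eq0.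
    by rewrite -mxrank_eq0 hk.
  rewrite -e => /sub_rVP[a ea]; exists a.
  by apply: trmx_inj; rewrite ea linearZ /= trmxK.
have [a ea] := ker _ Cc.
exists a; first by apply: contraNneq c0 => a0; rewrite ea a0 scale0r.
have Ecc : Emx (center C) *m center C = 0.
  rewrite Emx_mulmx; apply/matrixP => k j; rewrite !mxE.
  by case: k; do 6 (case; first by move=> ?; rewrite /=; ring).
have Ea : Emx c = a *: Emx (center C).
  rewrite ea; apply/matrixP=> i j; rewrite !mxE /hcoord !mxE.
  case: i; do 6 (case; first by move=> ? /=;
    case: j; do 4 (case; first by move=> ?; rewrite /=; ring)).
  by [].
rewrite Ea -scalemxAl; congr (_ *: _).
apply/eqP; rewrite /hatC -subr_eq0 -mulmxBr; apply/eqP.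
apply/matrixP => i j; rewrite [RHS]mxE.
have [b eb] : exists b, col j (D - pinvmx C) = b *: center C.
  apply: ker; rewrite colE mulmxA -colE; apply/matrixP => i' j'.
  by rewrite mxE mulmxBr CD camera_pinvmx // subrr !mxE.
have := congr1 (fun v => (Emx (center C) *m v) i 0) eb.
by rewrite -scalemxAr Ecc scaler0 colE mulmxA -colE mxE => ->; rewrite mxE.
Qed.

Definition hatH (F : fieldType) (h : 'cV[F]_4) : 'M[F]_(3, 6) :=
  let h0 := hcoord h 0 in let h1 := hcoord h 1 in
  let h2 := hcoord h 2 in let h3 := hcoord h 3 in
  mx_of_rows 3 6
    [:: [:: h0; 0;  0;  - h2; - h3; 0];
        [:: 0;  h0; 0;  h1;   0;    - h3];
        [:: 0;  0;  h0; 0;    h1;   h2]].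

(* Curves (in the plane) and Chow forms are stored as rows, i.e. transposed:
   a and b below stand for the transposes of alpha and beta. *)

Definition Phi (F : fieldType) (n d : nat) (C : 'I_n -> 'M[F]_(3, 4))
    (ha : 'cV[F]_4 * 'rV[F]_(nmon 3 d)) : 'M[F]_(n, nmon 3 d) :=
  \matrix_(i < n)
    (ha.2 *m veronese_mx d (hatH ha.1) *m veronese_mx d (hatC (C i))).

Definition plane_curve_mv (F : fieldType) (n d : nat) (C : 'I_n -> 'M[F]_(3, 4)) :
    set 'M[F]_(n, nmon 3 d) :=
  zclosure (rational_image [set ha | ha.1 != 0 /\ ha.2 != 0] (@Phi F n d C)).

Arguments plane_curve_mv {F n} d C.

Definition std_twisted_cubic (F : fieldType) (s t : F) : 'cV[F]_4 :=
  \col_(i < 4) (s ^+ (3 - i) * t ^+ i).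

Definition twisted_cubic (F : fieldType) (M : 'M[F]_4) : set 'cV[F]_4 :=
  [set x | exists s t : F, (s, t) != (0, 0) /\ x = M *m std_twisted_cubic s t].

(* For linearly independent p and q, [plucker p q] runs over the Pluecker
   coordinates of all lines, and the points of the line are the combinations
   u *: p + v *: q.  The form b is only determined modulo the Pluecker
   relation, and every representative counts as a Chow form; the product with
   [veronese_mx d (hatC C)] below does not depend on the representative.  When
   d is the degree of an irreducible curve X, the zero set condition determines
   b up to this and up to scaling. *)
Definition is_chow_form (F : fieldType) (d : nat) (X : set 'cV[F]_4)
    (b : 'rV[F]_(nmon 6 d)) : Prop :=
  b != 0 /\
  forall p q : 'cV[F]_4, \rank (row_mx p q) = 2%N ->
    (b *m veronese d (plucker p q) = 0 <->
     exists2 x, X x & exists u v : F, x = u *: p + v *: q).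

Definition Ch_tw (F : fieldType) : set 'rV[F]_(nmon 6 3) :=
  zclosure [set b | exists2 M : 'M[F]_4, M \in unitmx &
                      is_chow_form (twisted_cubic M) b].

Definition Psi (F : fieldType) (n : nat) (C : 'I_n -> 'M[F]_(3, 4))
    (b : 'rV[F]_(nmon 6 3)) : 'M[F]_(n, nmon 3 3) :=
  \matrix_(i < n) (b *m veronese_mx 3 (hatC (C i))).

Definition twisted_cubic_mv (F : fieldType) (n : nat) (C : 'I_n -> 'M[F]_(3, 4)) :
    set 'M[F]_(n, nmon 3 3) :=
  zclosure (rational_image (@Ch_tw F) (Psi C)).

(* Main.v *)
(* Both varieties are closures of images of polynomial maps from an affine
   space, hence irreducible. If the closure of such an image contained a chain
   of D + 1 proper inclusions of irreducible closed sets, with D the number of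
   parameters, then adding equations of the smaller sets one by one would
   contradict the fact that D + 1 polynomials in D variables are algebraically
   dependent. For plane curves the slice h_0 = alpha_0 = 1 has the right number
   of parameters. For twisted cubics the Chow form of the curve parametrized by
   the rows of M is, up to scaling, the Bezout resultant of the two binary
   cubics cut out by the line, and substitutions of the parameters s, t reduce
   the 16 entries of M to 12.

   The lower bounds are chains of images of coordinate subspaces of such a
   family: each further coordinate is detected by an equation that vanishes on
   the preceding image. For plane curves, the image curve in the first view is
   fixed such that the second image is linear in h; these 3 coordinates come
   first, the coefficients of the first image follow. For twisted cubics the
   family starts from cubics that have the line through the two centers as a
   secant: their images have double points at the epipoles and the equations
   y2 Q(y0, y1) = f2(y0, y1) and y2 Q(y0, y1) = f3(y0, y1). *)

Require Import Defs.
From mathcomp Require Import all_boot all_order all_algebra.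
From mathcomp Require Import complex mpoly boolp classical_sets reals.
From mathcomp Require Import ring.

Set Implicit Arguments.
Unset Strict Implicit.
Unset Printing Implicit Defensive.

Import Order.TTheory GRing.Theory Num.Theory.

Local Notation widen := (widen_ord (leqnSn _)).

(** * Polynomial functions *)

Section PolynomialFunctions.
Local Open Scope ring_scope.
Variable F : numFieldType.

(** Closedness, irreducibility and strict inclusion are all tested by single multihomogeneous
    polynomials, and every argument in general position rests on the fact that a product of nonzero
    polynomials has a nonzero value. The equations live on a product of projective spaces, while
    algebraic dependence is an affine statement. The upper bound is therefore carried out in a chart
    P i (J i) = 1, with J chosen at a point of the smallest member of the chain, and equations pass
    to and fro by homogenization.

    Two obstacles come from the definition of the twisted cubic variety. A Chow form is given by its
    zero set only, so it must be shown to agree with the Bezout resultant, up to a factor, on all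
    lines. And [Ch_tw] also contains limits of Chow forms, where an equation of the image has to be
    multiplied by coordinates that are nonzero at the limit.

    In the lower bounds the parameters are read off two views, but all n images of the starting
    curve must be nonzero. Hence the base plane, and for cubics the coordinate frame and [tau], are
    chosen generically. *)

Lemma lift_max_widen (k : nat) (i : 'I_k) : lift ord_max i = widen i.
Proof. by apply: val_inj; rewrite /= /bump leqNgt ltn_ord. Qed.

Definition mrestr (k : nat) (m : 'X_{1..k.+1}) : 'X_{1..k} :=
  [multinom m (widen i) | i < k].

Lemma mrestr_inj (k : nat) (m m' : 'X_{1..k.+1}) :
  mrestr m = mrestr m' -> m ord_max = m' ord_max -> m = m'.
Proof.
move=> er el; apply/mnmP => i; have [j ->|->] := unliftP ord_max i; last by [].
have := congr1 (fun m' : 'X_{1..k} => m' j) er; rewrite !mnmE.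
by rewrite lift_max_widen.
Qed.

(** The coefficient of the j-th power of the last variable, as a polynomial in the other
    variables. *)
Definition mslice (k : nat) (p : {mpoly F[k.+1]}) (j : nat) : {mpoly F[k]} :=
  \sum_(m <- msupp p | m ord_max == j) p@_m *: 'X_[mrestr m].

Lemma meval_mslice (k : nat) (p : {mpoly F[k.+1]}) (v : 'I_k.+1 -> F) :
  p.@[v] = \sum_(j < msize p) (mslice p j).@[v \o widen] * v ord_max ^+ j.
Proof.
transitivity (\sum_(j < msize p) \sum_(m <- msupp p | m ord_max == j :> nat)
    p@_m * 'X_[mrestr m].@[v \o widen] * v ord_max ^+ j); last first.
  apply: eq_bigr => j _; rewrite /mslice raddf_sum mulr_suml.
  by apply: eq_bigr => m _; rewrite /= mevalZ.
rewrite (exchange_big_dep xpredT) //= mevalE big_seq [RHS]big_seq.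
apply: eq_bigr => m mp.
have lt : (m ord_max < msize p)%N.
  apply: leq_ltn_trans (msize_mdeg_lt mp); rewrite mdegE.
  by rewrite (bigD1 ord_max) //= leq_addr.
rewrite (bigD1 (Ordinal lt)) //= [X in _ + X]big1 ?addr0 => [|j /andP[/eqP e]].
  rewrite -mulrA big_ord_recr mevalX /=; congr (_ * (_ * _)).
  by apply: eq_bigr => i _; rewrite mnmE.
by case/eqP; apply/val_inj.
Qed.

Lemma mslice_neq0 (k : nat) (p : {mpoly F[k.+1]}) (m : 'X_{1..k.+1}) :
  m \in msupp p -> mslice p (m ord_max) != 0.
Proof.
move=> mp; have := mp; rewrite mcoeff_msupp; apply: contraNneq => s0.
have <- : (mslice p (m ord_max))@_(mrestr m) = p@_m; last by rewrite s0 mcoeff0.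
rewrite raddf_sum /= big_mkcond (bigD1_seq m) ?msupp_uniq //= eqxx.
rewrite mcoeffZ mcoeffX eqxx mulr1 big1 ?addr0 // => m' ne; case: ifP => // /eqP el.
rewrite mcoeffZ mcoeffX; case: eqP => er; last by rewrite mulr0.
by rewrite (mrestr_inj er el) eqxx in ne.
Qed.

Lemma poly_nonzero_point (q : {poly F}) : q != 0 -> exists x, q.[x] != 0.
Proof.
move=> q0; pose s : seq F := [seq i%:R | i <- iota 0 (size q)].
have us : uniq s.
  by rewrite map_inj_uniq ?iota_uniq // => i j /eqP; rewrite eqr_nat => /eqP.
have [all_s|/allPn[x _ hx]] := boolP (all (root q) s); last by exists x.
by have := max_poly_roots q0 all_s us; rewrite size_map size_iota ltnn.
Qed.

Lemma mpoly0_cst (p : {mpoly F[0]}) : p = (p@_0)%:MP.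
Proof.
apply/mpolyP => m; rewrite mcoeffC (_ : m = 0%MM) ?eqxx ?mulr1 //.
by apply/mnmP => -[].
Qed.

(** Induction on the number of variables: at a point where some slice is nonzero, p becomes a
    nonzero polynomial in the last variable, and the field contains infinitely many integers. *)
Lemma mpoly_nonzero_point (k : nat) (p : {mpoly F[k]}) :
  p != 0 -> exists v, p.@[v] != 0.
Proof.
elim: k p => [|k IH] p p0.
  exists (fun=> 0); rewrite (mpoly0_cst p) mevalC.
  by apply: contraNneq p0 => c0; rewrite (mpoly0_cst p) c0.
have [m mp] : exists m, m \in msupp p.
  case: (msupp p) (msupp_eq0 p) => [|m r _]; last by exists m; rewrite mem_head.
  by rewrite eqxx (negbTE p0).
have [v hv] := IH _ (mslice_neq0 mp).
pose q := \poly_(j < msize p) (mslice p j).@[v].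
have [|x hx] := @poly_nonzero_point q.
  have lt : (m ord_max < msize p)%N.
    apply: leq_ltn_trans (msize_mdeg_lt mp); rewrite mdegE.
    by rewrite (bigD1 ord_max) //= leq_addr.
  apply: contraNneq hv => /polyP/(_ (m ord_max)).
  by rewrite coef0 coef_poly lt => ->.
exists (fun i => if unlift ord_max i is Some j then v j else x).
rewrite meval_mslice unlift_none; move: hx; rewrite horner_poly.
congr (_ != 0); apply: eq_bigr => j _; congr (_ * _); apply: meval_eq => i /=.
by rewrite -lift_max_widen liftK.
Qed.

(** Polynomiality is recorded for functions instead of formal polynomials, so that entries of matrix
    products, Veronese matrices and determinants are handled by closure rules. *)
Definition polyfun (k : nat) (f : 'rV[F]_k -> F) : Prop :=
  exists p : {mpoly F[k]}, forall a, f a = p.@[a 0].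

Lemma polyfun_ext k (f g : 'rV[F]_k -> F) : f =1 g -> polyfun f -> polyfun g.
Proof. by move=> e [p hp]; exists p => a; rewrite -e. Qed.

Lemma polyfun_cst k c : polyfun (fun _ : 'rV[F]_k => c).
Proof. by exists c%:MP => a; rewrite mevalC. Qed.

Lemma polyfun_coord k (j : 'I_k) : polyfun (fun a : 'rV[F]_k => a 0 j).
Proof. by exists 'X_j => a; rewrite mevalXU. Qed.

Lemma polyfunD k (f g : 'rV[F]_k -> F) :
  polyfun f -> polyfun g -> polyfun (fun a => f a + g a).
Proof. by move=> [p hp] [q hq]; exists (p + q) => a; rewrite mevalD hp hq. Qed.

Lemma polyfunM k (f g : 'rV[F]_k -> F) :
  polyfun f -> polyfun g -> polyfun (fun a => f a * g a).
Proof. by move=> [p hp] [q hq]; exists (p * q) => a; rewrite mevalM hp hq. Qed.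

Lemma polyfunN k (f : 'rV[F]_k -> F) : polyfun f -> polyfun (fun a => - f a).
Proof. by move=> [p hp]; exists (- p) => a; rewrite mevalN hp. Qed.

Lemma polyfunB k (f g : 'rV[F]_k -> F) :
  polyfun f -> polyfun g -> polyfun (fun a => f a - g a).
Proof. by move=> hf hg; apply: polyfunD => //; apply: polyfunN. Qed.

Lemma polyfunX k (f : 'rV[F]_k -> F) e : polyfun f -> polyfun (fun a => f a ^+ e).
Proof. by move=> [p hp]; exists (p ^+ e) => a; rewrite rmorphXn hp. Qed.

Lemma polyfun_sum k (I : Type) (r : seq I) (P : pred I) (f : I -> 'rV[F]_k -> F) :
  (forall i, P i -> polyfun (f i)) -> polyfun (fun a => \sum_(i <- r | P i) f i a).
Proof.
move=> hf; elim: r => [|i r IH].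
  by apply: polyfun_ext (polyfun_cst k 0) => a; rewrite big_nil.
case Pi: (P i); last by apply: polyfun_ext IH => a; rewrite big_cons Pi.
by apply: polyfun_ext (polyfunD (hf i Pi) IH) => a; rewrite big_cons Pi.
Qed.

Lemma polyfun_prod k (I : Type) (r : seq I) (P : pred I) (f : I -> 'rV[F]_k -> F) :
  (forall i, P i -> polyfun (f i)) -> polyfun (fun a => \prod_(i <- r | P i) f i a).
Proof.
move=> hf; elim: r => [|i r IH].
  by apply: polyfun_ext (polyfun_cst k 1) => a; rewrite big_nil.
case Pi: (P i); last by apply: polyfun_ext IH => a; rewrite big_cons Pi.
by apply: polyfun_ext (polyfunM (hf i Pi) IH) => a; rewrite big_cons Pi.
Qed.

Lemma polyfun_meval k N (p : {mpoly F[N]}) (f : 'rV[F]_k -> 'I_N -> F) :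
  (forall j, polyfun (fun a => f a j)) -> polyfun (fun a => p.@[f a]).
Proof.
move=> hf; apply: (polyfun_ext (fun a => esym (mevalE (f a) p))).
apply: polyfun_sum => m _; apply: polyfunM; first exact: polyfun_cst.
by apply: polyfun_prod => i _; apply: polyfunX.
Qed.

(** Irreducibility of affine space; the choices in general position below rest on this lemma. *)
Lemma polyfun_generic2 k (f g : 'rV[F]_k -> F) a b :
  polyfun f -> polyfun g -> f a != 0 -> g b != 0 -> exists c, f c * g c != 0.
Proof.
move=> [p hp] [q hq]; rewrite hp hq => pa qb.
have p0 : p != 0 by apply: contraNneq pa => ->; rewrite meval0.
have q0 : q != 0 by apply: contraNneq qb => ->; rewrite meval0.
have [v hv] := mpoly_nonzero_point (mulf_neq0 p0 q0).
exists (\row_i v i); rewrite hp hq -mevalM.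
by rewrite (@meval_eq _ _ _ v) // => i; rewrite mxE.
Qed.

Lemma polyfun_generic k (I : Type) (r : seq I) (f : I -> 'rV[F]_k -> F) :
  (forall i, polyfun (f i)) -> (forall i, exists a, f i a != 0) ->
  exists c, \prod_(i <- r) f i c != 0.
Proof.
move=> hf nz; elim: r => [|i r [c hc]].
  by exists 0; rewrite big_nil oner_neq0.
have [a ha] := nz i.
have hr : polyfun (fun c => \prod_(i <- r) f i c) by exact: polyfun_prod.
have [d hd] := polyfun_generic2 (hf i) hr ha hc.
by exists d; rewrite big_cons.
Qed.

End PolynomialFunctions.

(** * Closures of images of polynomial maps *)

Section Multihomogeneous.
Local Open Scope ring_scope.
Local Open Scope classical_set_scope.
Variables (F : numFieldType) (n N : nat).
Implicit Types (e : 'I_n -> nat) (p q : {mpoly F[n * N]}) (P Q : 'M[F]_(n, N)).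

Definition pval p P : F := p.@[fun k => mxvec P 0 k].

Definition mhdeg e p : Prop := forall m, m \in msupp p ->
  forall i, (\sum_(j < N) m (mxvec_index i j))%N = e i.

(** The counterpart of [polyfun] for equations. The multidegree is tracked because sums stay
    multihomogeneous only when the multidegrees agree. *)
Definition mhfun e (f : 'M[F]_(n, N) -> F) : Prop :=
  exists2 p, mhdeg e p & forall P, f P = pval p P.

Lemma mhfun_ext e f g : f =1 g -> mhfun e f -> mhfun e g.
Proof. by move=> fg [p hp fp]; exists p => // P; rewrite -fg. Qed.

Lemma mhdeg_multihomog e p : mhdeg e p -> multihomog p.
Proof. by move=> hp; exists e. Qed.

Lemma mhfun_cst c : mhfun (fun=> 0%N) (fun=> c).
Proof.
exists c%:MP => [m|P]; last by rewrite /pval mevalC.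
rewrite msuppC; case: ifP => // _; rewrite inE => /eqP-> i.
by rewrite big1 // => j _; rewrite mnm0E.
Qed.

Lemma mhfun_entry i j : mhfun (fun i' => (i' == i) : nat) (fun P => P i j).
Proof.
exists 'X_(mxvec_index i j) => [m|P]; last by rewrite /pval mevalXU mxvecE.
rewrite msuppX inE => /eqP-> i'; have [->|ne] := eqVneq i' i.
  rewrite (bigD1 j) //= mnm1E eqxx big1 ?addn0 // => j' ne.
  rewrite mnm1E; case: eqP => // /(congr1 (fun k => enum_val (cast_ord (esym (mxvec_cast _ _)) k))).
  by rewrite !cast_ordK !enum_rankK => -[ej]; rewrite ej eqxx in ne.
rewrite big1 // => j' _; rewrite mnm1E; case: eqP => //.
move/(congr1 (fun k => enum_val (cast_ord (esym (mxvec_cast _ _)) k))).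
by rewrite !cast_ordK !enum_rankK => -[ei]; rewrite ei eqxx in ne.
Qed.

Lemma mhfunD e f g : mhfun e f -> mhfun e g -> mhfun e (fun P => f P + g P).
Proof.
move=> [p hp fp] [q hq gq]; exists (p + q) => [m|P]; last first.
  by rewrite /pval mevalD fp gq.
by move/msuppD_le; rewrite mem_cat => /orP[/hp|/hq].
Qed.

Lemma mhfunM e e' f g :
  mhfun e f -> mhfun e' g -> mhfun (fun i => (e i + e' i)%N) (fun P => f P * g P).
Proof.
move=> [p hp fp] [q hq gq]; exists (p * q) => [m|P]; last first.
  by rewrite /pval mevalM fp gq.
move/msuppM_le/allpairsP=> [[m1 m2]] /= [m1p m2q ->] i.
by rewrite -(hp _ m1p i) -(hq _ m2q i) -big_split; apply: eq_bigr => j _; rewrite mnmDE.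
Qed.

Lemma mhfunZ e c f : mhfun e f -> mhfun e (fun P => c * f P).
Proof.
move=> [p hp fp]; exists (c *: p) => [m|P]; last by rewrite /pval mevalZ fp.
by move/msuppZ_le; apply: hp.
Qed.

Lemma mhfun0 e : mhfun e (fun=> 0).
Proof. by exists 0 => [m|P]; rewrite ?msupp0 // /pval meval0. Qed.

Lemma mhfun_sum e (I : Type) (r : seq I) (A : pred I) f :
  (forall i, A i -> mhfun e (f i)) -> mhfun e (fun P => \sum_(i <- r | A i) f i P).
Proof.
move=> hf; elim: r => [|i r IH].
  by apply: mhfun_ext (mhfun0 e) => P; rewrite big_nil.
case Ai: (A i); last by apply: mhfun_ext IH => P; rewrite big_cons Ai.
by apply: mhfun_ext (mhfunD (hf i Ai) IH) => P; rewrite big_cons Ai.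
Qed.

Lemma mhfun_prod (I : Type) (r : seq I) (e : I -> 'I_n -> nat) f :
  (forall i, mhfun (e i) (f i)) ->
  mhfun (fun k => \sum_(i <- r) e i k)%N (fun P => \prod_(i <- r) f i P).
Proof.
move=> hf; elim: r => [|i r [p hp fp]].
  have [p hp fp] := mhfun_cst 1; exists p => [m mp k|P]; rewrite big_nil ?fp //.
  exact: hp.
have [q hq gq] := mhfunM (hf i) (ex_intro2 _ _ p hp fp).
by exists q => [m mq k|P]; rewrite big_cons ?(hq _ mq) // -gq.
Qed.

Lemma mhfunX e f k :
  mhfun e f -> mhfun (fun i => (k * e i)%N) (fun P => f P ^+ k).
Proof.
move=> hf; elim: k => [|k [p hp fp]].
  have [p hp fp] := mhfun_cst 1; exists p => [m mp i|P]; last by rewrite expr0 -fp.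
  by rewrite (hp m mp) mul0n.
have [q hq gq] := mhfunM hf (ex_intro2 _ _ p hp fp).
by exists q => [m mq i|P]; rewrite ?(hq _ mq) ?mulSn // exprS gq.
Qed.

Lemma mhdeg_scale e p (c : 'I_n -> F) P : mhdeg e p ->
  pval p (\matrix_(i, j) (c i * P i j)) = (\prod_i c i ^+ e i) * pval p P.
Proof.
move=> hp; rewrite /pval !mevalE mulr_sumr big_seq [RHS]big_seq.
apply: eq_bigr => m mp; rewrite mulrCA; congr (_ * _).
have big_mx (g : 'I_(n * N) -> F) :
    \prod_k g k = \prod_i \prod_j g (mxvec_index i j).
  rewrite (reindex _ (curry_mxvec_bij _ _)) /= pair_bigA /=.
  by apply: eq_bigr => -[].
rewrite !big_mx -big_split; apply: eq_bigr => i _ /=.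
rewrite -(hp _ mp i) -prodrXr -big_split; apply: eq_bigr => j _ /=.
by rewrite !mxvecE !mxE exprMn.
Qed.

Lemma row_neq0 P i : row i P != 0 -> exists j, P i j != 0.
Proof. by move/rV0Pn => [j]; rewrite mxE; exists j. Qed.

Lemma entry_row_neq0 P i j : P i j != 0 -> row i P != 0.
Proof. by move=> h; apply/rV0Pn; exists j; rewrite mxE. Qed.

Lemma mpoints_entries P : mpoints P -> exists J : 'I_n -> 'I_N, forall i, P i (J i) != 0.
Proof. by move=> hP; apply: (fin_all_exists (P := fun i j => P i j != 0)) => i; apply: row_neq0. Qed.

Lemma zclosureE (A : set 'M[F]_(n, N)) : A `<=` @mpoints F n N ->
  zclosure A = [set P | mpoints P /\
    forall p, multihomog p -> (forall Q, A Q -> pval p Q = 0) -> pval p P = 0].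
Proof.
move=> Amp; apply/seteqP; split => P.
  move/(_ (mzeros [set p | multihomog p /\ forall Q, A Q -> pval p Q = 0])).
  case=> [|mP vP]; last by split => // p hp pA; apply: vP.
  split; first by exists [set p | multihomog p /\ forall Q, A Q -> pval p Q = 0] => // p [].
  by move=> Q AQ; split=> [|p [_]]; [exact: Amp | exact].
move=> [mP vP] Z [[S hS ->] AZ]; split => // p Sp; apply: vP; first exact: hS.
by move=> Q /AZ[_]; apply.
Qed.

Lemma zclosed_closure (A : set 'M[F]_(n, N)) :
  A `<=` @mpoints F n N -> zclosed (zclosure A).
Proof.
move=> Amp; rewrite zclosureE //.
exists [set p | multihomog p /\ forall Q, A Q -> pval p Q = 0]; first by move=> p [].
apply/seteqP; split => P [mP vP]; split => //; first by move=> p [hp pA]; apply: vP.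
by move=> p hp pA; apply: vP.
Qed.

Lemma sub_zclosure (A : set 'M[F]_(n, N)) : A `<=` zclosure A.
Proof. by move=> P AP Z [_]; apply. Qed.

Lemma zclosure_sub (A B : set 'M[F]_(n, N)) : B `<=` @mpoints F n N ->
  (forall Q p, A Q -> multihomog p -> (forall P, B P -> pval p P = 0) -> pval p Q = 0) ->
  A `<=` @mpoints F n N -> zclosure A `<=` zclosure B.
Proof.
move=> Bmp h Amp; rewrite !zclosureE // => P [mP vP]; split => // p hp pB.
by apply: vP => // Q AQ; apply: h pB.
Qed.

Lemma zclosed_mpoints (Z : set 'M[F]_(n, N)) P : zclosed Z -> Z P -> mpoints P.
Proof. by move=> [S _ ->] []. Qed.

Lemma zclosed_scale (Z : set 'M[F]_(n, N)) (c : 'I_n -> F) P :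
  zclosed Z -> (forall i, c i != 0) -> Z P -> Z (\matrix_(i, j) (c i * P i j)).
Proof.
move=> [S hS ->] c0 [mP vP]; split=> [i|p Sp].
  have [j hj] := row_neq0 (mP i).
  by apply: (@entry_row_neq0 _ i j); rewrite mxE mulf_neq0.
have [e he] := hS p Sp.
rewrite -/(pval _ _) (mhdeg_scale c P he).
by rewrite (vP p Sp : pval p P = 0) mulr0.
Qed.

Definition polymap (k : nat) (f : 'rV[F]_k -> 'M[F]_(n, N)) : Prop :=
  forall i j, polyfun (fun a => f a i j).

Lemma polymap_pval k (f : 'rV[F]_k -> 'M[F]_(n, N)) p :
  polymap f -> polyfun (fun a => pval p (f a)).
Proof.
move=> hf; apply: (polyfun_meval p (f := fun a l => mxvec (f a) 0 l)) => l.
by case/mxvec_indexP: l => i j; apply: polyfun_ext (hf i j) => a; rewrite mxvecE.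
Qed.

(** In each row an entry that is not identically zero is selected; the product of these entries with
    [g] is a nonzero polynomial. *)
Lemma polymap_generic k (f : 'rV[F]_k -> 'M[F]_(n, N)) (g : 'rV[F]_k -> F) b :
  polymap f -> (forall i, exists a, row i (f a) != 0) -> polyfun g -> g b != 0 ->
  exists2 a, mpoints (f a) & g a != 0.
Proof.
move=> hf nz hg gb.
have [J hJ] : exists J : 'I_n -> 'I_N, forall i, exists a, f a i (J i) != 0.
  apply: (fin_all_exists (P := fun i j => exists a, f a i j != 0)) => i.
  have [a /row_neq0[j hj]] := nz i.
  by exists j, a.
have [c hc] := polyfun_generic (index_enum _) (fun i => hf i (J i)) hJ.
have hp : polyfun (fun a => \prod_i f a i (J i)) by apply: polyfun_prod.
have [d] := polyfun_generic2 hp hg hc gb.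
rewrite mulf_eq0 negb_or => /andP[hd gd]; exists d => // i.
apply: (@entry_row_neq0 _ i (J i)).
by move: hd; rewrite prodf_seq_neq0 => /allP/(_ i); apply; rewrite mem_index_enum.
Qed.

Definition zimage (k : nat) (f : 'rV[F]_k -> 'M[F]_(n, N)) : set 'M[F]_(n, N) :=
  [set P | mpoints P /\ exists a, P = f a].

Lemma zimage_mpoints k (f : 'rV[F]_k -> 'M[F]_(n, N)) : zimage f `<=` @mpoints F n N.
Proof. by move=> P []. Qed.

Lemma zimage_vanish k (f : 'rV[F]_k -> 'M[F]_(n, N)) p :
  polymap f -> (forall i, exists a, row i (f a) != 0) ->
  (forall P, zimage f P -> pval p P = 0) -> forall a, pval p (f a) = 0.
Proof.
move=> hf nz vp a; apply/eqP/negPn/negP => pa.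
have [b mb] := polymap_generic hf nz (polymap_pval p hf) pa.
by rewrite vp ?eqxx //; split => //; exists b.
Qed.

(** If neither closed set contains the closure, each has an equation that is nonzero somewhere on
    the image, and the image of a generic parameter violates both equations at once. *)
Lemma zclosure_image_irreducible k (f : 'rV[F]_k -> 'M[F]_(n, N)) :
  polymap f -> (forall i, exists a, row i (f a) != 0) ->
  zirreducible (zclosure (zimage f)).
Proof.
move=> hf nz; split.
  have [|a ma _] := polymap_generic (b := 0) hf nz (polyfun_cst k 1).
    exact: oner_neq0.
  by exists (f a); apply: sub_zclosure; split => //; exists a.
move=> A B [S hS ->] [T hT ->] cov.
have [AX|/existsNP[P /not_implyP[XP nP]]] := pselect (zclosure (zimage f) `<=` mzeros S).
  by left.
have [BX|/existsNP[Q /not_implyP[XQ nQ]]] := pselect (zclosure (zimage f) `<=` mzeros T).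
  by right.
have sep (U : set {mpoly F[n * N]}) R : U `<=` @multihomog F n N ->
    zclosure (zimage f) R -> ~ mzeros U R ->
    exists2 p, U p & exists a, pval p (f a) != 0.
  move=> hU; rewrite (zclosureE (@zimage_mpoints _ f)) => -[mR vR] nR.
  have /existsNP[p /not_implyP[Up pR]] : ~ forall p, U p -> pval p R = 0.
    by move=> h; apply: nR.
  exists p => //; have /existsNP[Q' /not_implyP[[mQ [a ->]] pQ]] :
      ~ forall Q, zimage f Q -> pval p Q = 0.
    by move=> h; apply: pR; apply: vR => //; apply: hU.
  by exists a; apply/eqP.
have [p Sp [a pa]] := sep S P hS XP nP.
have [q Tq [b qb]] := sep T Q hT XQ nQ.
have [c hc] := polyfun_generic2 (polymap_pval p hf) (polymap_pval q hf) pa qb.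
have hpq : polyfun (fun a => pval p (f a) * pval q (f a)).
  by apply: polyfunM; apply: polymap_pval.
have [d md hd] := polymap_generic hf nz hpq hc.
have /cov[[_ /(_ p Sp) e]|[_ /(_ q Tq) e]] : zclosure (zimage f) (f d).
- by apply: sub_zclosure; split => //; exists d.
- by case/negP: hd; rewrite (e : pval p (f d) = 0) mul0r.
- by case/negP: hd; rewrite (e : pval q (f d) = 0) mulr0.
Qed.

Definition truncrow (D k : nat) (a : 'rV[F]_D) : 'rV[F]_D :=
  \row_j (if (j < k)%N then a 0 j else 0).

(** The hypothesis on [f 0] keeps all rows of every truncated map from vanishing identically, so
    that all members of the chain are irreducible. The witness for [g] may have an image with zero
    rows: genericity replaces it by a parameter of the same coordinate subspace whose image is a
    point. *)
Lemma chain_of_flag (D : nat) (f : 'rV[F]_D -> 'M[F]_(n, N)) (X : set 'M[F]_(n, N)) :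
  polymap f -> zclosed X -> (forall a, mpoints (f a) -> X (f a)) -> mpoints (f 0) ->
  (forall k, (k < D)%N -> exists e g, [/\ mhfun e g,
     forall a : 'rV_D, (forall j : 'I_D, (k <= j)%N -> a 0 j = 0) -> g (f a) = 0 &
     exists2 a : 'rV_D, (forall j : 'I_D, (k < j)%N -> a 0 j = 0) & g (f a) != 0]) ->
  exists Z, irred_chain X D Z.
Proof.
move=> hf [S hS eX] imX m0 sep.
pose ft k a := f (truncrow k a).
have hft k : polymap (ft k).
  move=> i j; have [p hp] := hf i j.
  apply: (polyfun_ext (fun a => esym (hp (truncrow k a)))).
  apply: (polyfun_meval p (f := fun a l => truncrow k a 0 l)) => l.
  case lt : (l < k)%N; last by apply: polyfun_ext (polyfun_cst D 0) => a; rewrite mxE lt.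
  by apply: (polyfun_ext _ (polyfun_coord F l)) => a; rewrite mxE lt.
have nz k i : exists a, row i (ft k a) != 0.
  exists 0; rewrite /ft (_ : truncrow k 0 = 0); first exact: m0.
  by apply/rowP => j; rewrite !mxE; case: ifP.
exists (fun k => zclosure (zimage (ft k))); split=> [k _|k ltk].
  split; first exact/zclosed_closure/zimage_mpoints.
    exact: zclosure_image_irreducible.
  apply: smallest_sub; first by exists S.
  by move=> P [mP [a eP]]; move: mP; rewrite eP; apply: imX.
split.
  apply: zclosure_sub; try exact: zimage_mpoints.
  move=> Q p [mQ [a eQ]] hp vp; apply: vp; split => //.
  exists (truncrow k a); rewrite eQ /ft; congr (f _); apply/rowP => j; rewrite !mxE.
  by case: (ltnP j k) => [lt|_]; [rewrite ltnS ltnW | rewrite if_same].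
have [e [g [[p hp gp] v0 [b vb gb]]]] := sep k ltk.
have [] := polymap_generic (b := b) (hft k.+1) (nz k.+1) (polymap_pval p (hft k.+1)).
  rewrite -gp /ft (_ : truncrow _ b = b) //; apply/rowP => j; rewrite mxE.
  by case: ltnP => // /vb->.
move=> a ma ga sub.
have : zclosure (zimage (ft k)) (ft k.+1 a).
  by apply: sub; apply: sub_zclosure; split => //; exists a.
rewrite zclosureE; last exact: zimage_mpoints.
case=> _ /(_ p) va; case/eqP: ga; apply: va; first by exists e.
move=> _ [_ [c ->]]; rewrite -gp; apply: v0 => j kj.
by rewrite mxE ltnNge kj.
Qed.

End Multihomogeneous.

(** * Upper bound for the dimension of an image *)

Section Counting.
Local Open Scope ring_scope.
Variable F : numFieldType.

Definition degle (D d : nat) (p : {mpoly F[D]}) : Prop :=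
  forall m, m \in msupp p -> (mdeg m <= d)%N.

Lemma degle_msize D (p : {mpoly F[D]}) d : (msize p <= d)%N -> degle d p.
Proof. by move=> le m /msize_mdeg_lt lt; apply: ltnW (leq_trans lt le). Qed.

Lemma degle1 D : degle 0 (1 : {mpoly F[D]}).
Proof. by move=> m; rewrite msupp1 inE => /eqP->; rewrite mdeg0. Qed.

Lemma degleM D (p q : {mpoly F[D]}) d e :
  degle d p -> degle e q -> degle (d + e) (p * q).
Proof.
move=> hp hq m /msuppM_le/allpairsP[[m1 m2]] /= [h1 h2 ->].
by rewrite mdegD leq_add ?hp ?hq.
Qed.

Lemma degleX D (p : {mpoly F[D]}) d k : degle d p -> degle (d * k) (p ^+ k).
Proof.
move=> hp; elim: k => [|k IH]; first by rewrite muln0; apply: degle1.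
by rewrite exprS mulnS; apply: degleM.
Qed.

Lemma degle_prod D (I : Type) (r : seq I) (p : I -> {mpoly F[D]}) (d : I -> nat) :
  (forall i, degle (d i) (p i)) -> degle (\sum_(i <- r) d i) (\prod_(i <- r) p i).
Proof.
move=> hp; elim: r => [|i r IH]; first by rewrite !big_nil; apply: degle1.
by rewrite !big_cons; apply: degleM.
Qed.

(* The number of products of the G i and W of total degree (D + 1) r grows like
   r ^ (D + 1), the dimension of the space containing them only like r ^ D. *)
Lemma homogeneous_relation (D : nat) (G : 'I_D.+1 -> {mpoly F[D]}) (W : {mpoly F[D]}) :
  exists r, exists2 c : {ffun 'I_D.+1 -> 'I_r} -> F, exists s, c s != 0 &
    \sum_s c s *: ((\prod_i G i ^+ s i) * W ^+ (D.+1 * r - \sum_i s i)) = 0.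
Proof.
pose c := (msize W + \sum_i msize (G i))%N.
(* All exponents occurring in the products are below B, and B <= K r. So [T] has at most (K r)^D
   elements, fewer than the r^(D+1) elements of [S], because r > K^D. *)
pose K := (c * D.+1 + 1)%N; pose r := (K ^ D).+1; pose B := (c * (D.+1 * r)).+1.
pose H (s : {ffun 'I_D.+1 -> 'I_r}) :=
  (\prod_i G i ^+ s i) * W ^+ (D.+1 * r - \sum_i s i).
have Hdeg s : degle (c * (D.+1 * r)) (H s).
  have hG i : degle c (G i).
    by apply: degle_msize; rewrite /c (bigD1 i) //= addnCA leq_addr.
  have hW : degle c W by apply: degle_msize; rewrite leq_addr.
  have le : (\sum_i s i <= D.+1 * r)%N.
    rewrite -[D.+1 in leqRHS]card_ord -sum_nat_const; apply: leq_sum => i _.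
    exact: ltnW.
  rewrite -[X in (c * X)%N](subnKC le) mulnDr; apply: degleM; last exact: degleX.
  by rewrite big_distrr; apply: degle_prod => i; apply: degleX.
pose S : finType := {ffun 'I_D.+1 -> 'I_r}; pose T : finType := {ffun 'I_D -> 'I_B}.
pose mon (t : T) : 'X_{1..D} := [multinom (t i : nat) | i < D].
pose M : 'M[F]_(#|S|, #|T|) := \matrix_(i, j) (H (enum_val i))@_(mon (enum_val j)).
have ltTS : (#|T| < #|S|)%N.
  rewrite !card_ffun !card_ord; apply: (@leq_ltn_trans ((K * r) ^ D)%N).
    have monoexp a b k : (a <= b -> a ^ k <= b ^ k)%N.
      by move=> ab; elim: k => // k IHk; rewrite !expnS leq_mul.
    by apply: monoexp; rewrite /B /K mulnDl mul1n -mulnA -addn1 leq_add2l.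
  by rewrite expnMn expnSr mulnC ltn_pmul2l ?ltnSn // expn_gt0.
have ker0 : kermx M != 0.
  rewrite -mxrank_eq0 mxrank_ker -lt0n subn_gt0.
  exact: leq_ltn_trans (rank_leq_col M) ltTS.
pose v := nz_row (kermx M).
have vM : v *m M = 0 by apply/sub_kermxP/nz_row_sub.
exists r, (fun s => v 0 (enum_rank s)).
  have : v != 0 by rewrite nz_row_eq0.
  by case/rV0Pn => j hj; exists (enum_val j); rewrite enum_valK.
apply/mpolyP => m; rewrite mcoeff0 raddf_sum /=.
have [mB|mB] := boolP [forall i, m i < B]%N.
  pose t : T := [ffun i => Ordinal (forallP mB i)].
  have em : m = mon t by apply/mnmP => i; rewrite mnmE ffunE.
  have := congr1 (fun w : 'rV_#|T| => w 0 (enum_rank t)) vM.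
  rewrite !mxE => e0; rewrite -[RHS]e0.
  rewrite (reindex (@enum_rank S)) /=; last first.
    by apply: onW_bij; exists enum_val; [exact: enum_rankK | exact: enum_valK].
  by apply: eq_bigr => s _; rewrite mcoeffZ mxE !enum_rankK em.
rewrite big1 // => s _; rewrite mcoeffZ; case/forallPn: mB => i; rewrite -leqNgt => Bi.
rewrite (memN_msupp_eq0 (m := m)) ?mulr0 //; apply/negP => /Hdeg.
rewrite leqNgt => /negP; apply; apply: leq_trans Bi _.
by rewrite mdegE (bigD1 i) //= leq_addr.
Qed.

End Counting.

(** * Affine charts, homogenization and algebraic dependence *)

Section Dimension.
Local Open Scope ring_scope.
Local Open Scope classical_set_scope.
Variables (F : numFieldType) (n N : nat) (J : 'I_n -> 'I_N).
Implicit Types (p q : {mpoly F[n * N]}) (P Q : 'M[F]_(n, N)) (Z : set 'M[F]_(n, N)).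

Definition chart : set 'M[F]_(n, N) := [set P | forall i, P i (J i) = 1].

Definition normrow P : 'M[F]_(n, N) := \matrix_(i, j) ((P i (J i))^-1 * P i j).

Definition wcoord P : F := \prod_i P i (J i).

Lemma mhfun_deg e e' (f : 'M[F]_(n, N) -> F) : e =1 e' -> mhfun e f -> mhfun e' f.
Proof. by move=> ee [p hp fp]; exists p => // m mp i; rewrite hp. Qed.

Lemma mhfun_wcoord : mhfun (fun=> 1%N) wcoord.
Proof.
apply: mhfun_deg (mhfun_prod (index_enum 'I_n) (fun i => mhfun_entry F i (J i))) => k.
by rewrite (bigD1 k) //= eqxx big1 // => i /negbTE; rewrite eq_sym => ->.
Qed.

Lemma chart_normrow P : (forall i, P i (J i) != 0) -> chart (normrow P).
Proof. by move=> nz i; rewrite mxE mulVf. Qed.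

Lemma normrow_chart P : chart P -> normrow P = P.
Proof. by move=> cP; apply/matrixP => i j; rewrite mxE cP invr1 mul1r. Qed.

Lemma wcoord_chart P : chart P -> wcoord P = 1.
Proof. by move=> cP; apply: big1. Qed.

Lemma wcoord_neq0 P : (wcoord P != 0) <-> (forall i, P i (J i) != 0).
Proof.
rewrite prodf_seq_neq0; split=> [/allP h i|h]; first by apply: h; rewrite mem_index_enum.
by apply/allP => i _; apply: h.
Qed.

Lemma zclosed_normrow Z P : zclosed Z -> (forall i, P i (J i) != 0) -> Z P -> Z (normrow P).
Proof. by move=> cZ nz; apply: zclosed_scale => // i; rewrite invr_neq0. Qed.

(** All large exponents are required, and not just one, so that two such functions can be brought to
    the same denominator before they are added. *)
Definition homogenizable (f : 'M[F]_(n, N) -> F) : Prop :=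
  exists E, forall e, (E <= e)%N -> exists2 g, mhfun (fun=> e) g &
    forall P, (forall i, P i (J i) != 0) -> g P = f P * wcoord P ^+ e.

Lemma homogenizable_ext f g : f =1 g -> homogenizable f -> homogenizable g.
Proof.
move=> fg [E hE]; exists E => e /hE[h hh eh]; exists h => // P nz.
by rewrite eh // fg.
Qed.

Lemma homogenizable_cst c : homogenizable (fun=> c).
Proof.
exists 0%N => e _; exists (fun P => c * wcoord P ^+ e) => //.
by apply: mhfun_deg (mhfunZ c (mhfunX e mhfun_wcoord)) => i; rewrite muln1.
Qed.

Lemma homogenizable_entry i j : homogenizable (fun P => normrow P i j).
Proof.
exists 1%N => -[//|e] _.
exists (fun P => \prod_k (if k == i then P i j else P k (J k)) * wcoord P ^+ e).
  apply: (@mhfun_deg (fun k => (\sum_l ((k == l) : nat) + e * 1)%N)) => [k|].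
    rewrite muln1 (bigD1 k) //= eqxx big1 ?add1n // => l /negbTE.
    by rewrite eq_sym => ->.
  apply: mhfunM (mhfunX e mhfun_wcoord); apply: mhfun_prod => k.
  by case: eqP => [->|_]; apply: mhfun_entry.
move=> P nz; rewrite exprS mulrA; congr (_ * _).
rewrite /wcoord (bigD1 i) //= eqxx [in RHS](bigD1 i) //= mxE mulrACA mulVf // mul1r.
by congr (_ * _); apply: eq_bigr => k /negbTE->.
Qed.

Lemma homogenizableD f g : homogenizable f -> homogenizable g ->
  homogenizable (fun P => f P + g P).
Proof.
move=> [E hE] [E' hE']; exists (maxn E E') => e; rewrite geq_max => /andP[Ee Ee'].
have [f' hf ef] := hE e Ee; have [g' hg eg] := hE' e Ee'.
exists (fun P => f' P + g' P) => [|P nz]; first exact: mhfunD.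
by rewrite mulrDl ef ?eg.
Qed.

Lemma homogenizableM f g : homogenizable f -> homogenizable g ->
  homogenizable (fun P => f P * g P).
Proof.
move=> [E hE] [E' hE']; exists (E + E')%N => e le.
have [f' hf ef] := hE E (leqnn _).
have [|g' hg eg] := hE' (e - E)%N; first by rewrite leq_subRL // (leq_trans _ le) ?leq_addr.
have Ee : (E <= e)%N by rewrite (leq_trans _ le) ?leq_addr.
exists (fun P => f' P * g' P) => [|P nz].
  by apply: mhfun_deg (mhfunM hf hg) => i; rewrite subnKC.
by rewrite ef ?eg // -[in RHS](subnKC Ee) exprD mulrACA.
Qed.

Lemma homogenizableX f k : homogenizable f -> homogenizable (fun P => f P ^+ k).
Proof.
move=> hf; elim: k => [|k IH].
  by apply: homogenizable_ext (homogenizable_cst 1) => P; rewrite expr0.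
by apply: homogenizable_ext (homogenizableM hf IH) => P; rewrite exprS.
Qed.

Lemma homogenizable_pval p : homogenizable (fun P => pval p (normrow P)).
Proof.
elim/mpolyind: p => [|c m p _ _ IH].
  by apply: homogenizable_ext (homogenizable_cst 0) => P; rewrite /pval meval0.
apply: (@homogenizable_ext (fun P => c * \prod_l (mxvec (normrow P) 0 l) ^+ m l
  + pval p (normrow P))) => [P|]; first by rewrite /pval mevalD mevalZ mevalX.
apply: homogenizableD => //; apply: homogenizableM; first exact: homogenizable_cst.
elim: (index_enum _) => [|l r IHr].
  by apply: homogenizable_ext (homogenizable_cst 1) => P; rewrite big_nil.
apply: (@homogenizable_ext (fun P => (mxvec (normrow P) 0 l) ^+ m l *
    \prod_(i <- r) (mxvec (normrow P) 0 i) ^+ m i)) => [P|]; first by rewrite big_cons.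
apply: homogenizableM => //; apply: homogenizableX.
case/mxvec_indexP: l => i j.
by apply: homogenizable_ext (homogenizable_entry i j) => P; rewrite mxvecE.
Qed.

Lemma homogenize p : exists2 g, exists e, mhfun e g &
  forall P, (forall i, P i (J i) != 0) ->
    exists2 c, c != 0 & g P = c * pval p (normrow P).
Proof.
have [E /(_ _ (leqnn E))[g hg eg]] := homogenizable_pval p.
exists g => [|P nz]; first by exists (fun=> E).
by exists (wcoord P ^+ E); rewrite ?eg ?[_ * pval _ _]mulrC ?expf_neq0 //; apply/wcoord_neq0.
Qed.

(* Vanishing of a not necessarily homogeneous p on the affine part of Z is a
   multihomogeneous condition on Z. *)
Lemma homogenize_chart p : exists g : 'M[F]_(n, N) -> F,
  (exists e, mhfun e g) /\
  forall P, (g P != 0) <-> (forall i, P i (J i) != 0) /\ pval p (normrow P) != 0.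
Proof.
have [g [e hg] eg] := homogenize p.
exists (fun P => g P * wcoord P); split.
  by exists (fun i => e i + 1)%N; apply: mhfunM hg mhfun_wcoord.
move=> P; split.
  rewrite mulf_eq0 negb_or => /andP[gP /wcoord_neq0 nz]; split => //.
  by have [c _ ec] := eg P nz; move: gP; rewrite ec mulf_eq0 negb_or => /andP[].
move=> [nz pP]; have [c c0 ->] := eg P nz.
by rewrite !mulf_neq0 //; apply/wcoord_neq0.
Qed.

(** The affine part of an irreducible set has an integral coordinate ring. The homogenizations from
    [homogenize_chart] vanish outside the chart, so their two zero loci cover all of Z. *)
Lemma chart_prime Z p q : zclosed Z -> zirreducible Z ->
  (forall P, Z P -> chart P -> pval p P * pval q P = 0) ->
  (forall P, Z P -> chart P -> pval p P = 0) \/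
  (forall P, Z P -> chart P -> pval q P = 0).
Proof.
move=> cZ [_ iZ] pq.
have [g [[e [g' hg' eg']] hg]] := homogenize_chart p.
have [h [[e' [h' hh' eh']] hh]] := homogenize_chart q.
have sing r (e0 : 'I_n -> nat) : mhdeg e0 r -> zclosed (mzeros [set r]).
  by move=> hr; exists [set r] => // _ ->; exists e0.
have fin r s k : (forall P, k P = pval s P) ->
    (forall P, (k P != 0) <-> (forall i, P i (J i) != 0) /\ pval r (normrow P) != 0) ->
    Z `<=` mzeros [set s] -> forall P, Z P -> chart P -> pval r P = 0.
  move=> ks hk sub P ZP cP; apply/eqP/negPn/negP => rP.
  have [_ /(_ s erefl) s0] := sub P ZP.
  have /negP[] : k P != 0.
    by apply/hk; rewrite normrow_chart //; split => // i; rewrite cP oner_neq0.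
  by rewrite ks; apply/eqP.
have [|||sub|sub] := iZ (mzeros [set g']) (mzeros [set h']).
- exact: sing hg'.
- exact: sing hh'.
- move=> P ZP; have mP := zclosed_mpoints cZ ZP.
  have [gP|gP] := eqVneq (g P) 0.
    by left; split => // _ ->; rewrite -[_.@[_]]/(pval _ _) -eg'.
  right; split => // _ ->; rewrite -[_.@[_]]/(pval _ _) -eh'.
  have [nz pP] := (hg P).1 gP.
  apply/eqP/negPn/negP => /hh[_ qP].
  have := pq _ (zclosed_normrow cZ nz ZP) (chart_normrow nz).
  by apply/eqP; rewrite mulf_neq0.
- by left; apply: fin sub.
- by right; apply: fin sub.
Qed.

(* Any k polynomials are algebraically dependent on the affine part of Z. *)
Definition algdep Z (k : nat) : Prop :=
  forall f : 'I_k -> {mpoly F[n * N]}, exists2 R : {mpoly F[k]}, R != 0 &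
    forall P, Z P -> chart P -> R.@[fun s => pval (f s) P] = 0.

Lemma algdep_sub Z Z' k : Z `<=` Z' -> algdep Z' k -> algdep Z k.
Proof. by move=> sub h f; have [R R0 hR] := h f; exists R => // P /sub; apply: hR. Qed.

(* An equation q of Z that is nonzero on Z' is added to the given k polynomials;
   in a relation on Z' between these k + 1 polynomials, the coefficient of the
   lowest power of q is a relation on Z. *)
Lemma algdep_descent Z Z' k : zclosed Z -> zclosed Z' -> zirreducible Z' ->
  Z `<` Z' -> Z `&` chart !=set0 -> algdep Z' k.+1 -> algdep Z k.
Proof.
move=> [S hS eZ] cZ' iZ' [sub nsub] [P0 [ZP0 cP0]] dep f.
have /existsNP[Q /not_implyP[Z'Q nQ]] : ~ Z' `<=` Z by [].
have mQ := zclosed_mpoints cZ' Z'Q.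
have /existsNP[q /not_implyP[Sq qQ]] : ~ forall q, S q -> pval q Q = 0.
  by move=> h; apply: nQ; rewrite eZ.
have [e he] := hS q Sq.
have q0 P : Z P -> pval q P = 0 by rewrite eZ => -[_]; apply.
(* Otherwise Z' would be covered by the zeros of q and of [wcoord]; irreducibility forbids this, as
   q is nonzero at Q and [wcoord] is nonzero at P0. *)
have nzq : ~ forall P, Z' P -> chart P -> pval q P = 0.
  move=> qz; have [w hw ew] := mhfun_wcoord.
  have [|||s|s] := iZ'.2 (mzeros [set q]) (mzeros [set w]).
  - by exists [set q] => // _ ->; exists e.
  - by exists [set w] => // _ ->; exists (fun=> 1%N).
  - move=> P Z'P; have mP := zclosed_mpoints cZ' Z'P.
    have [wP|/wcoord_neq0 nz] := eqVneq (wcoord P) 0.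
      by right; split => // _ ->; rewrite -[_.@[_]]/(pval _ _) -ew.
    left; split => // _ ->; rewrite -[_.@[_]]/(pval _ _).
    have := qz _ (zclosed_normrow cZ' nz Z'P) (chart_normrow nz).
    rewrite (mhdeg_scale (fun i => (P i (J i))^-1) P he) => /eqP.
    rewrite mulf_eq0 => /orP[|/eqP//]; rewrite prodf_seq_eq0 => /hasP[i _].
    by rewrite expf_eq0 invr_eq0 (negbTE (nz i)) andbF.
  - by apply: qQ; have [_] := s Q Z'Q; apply.
  - have [_ /(_ w erefl)] := s P0 (sub _ ZP0).
    by rewrite -[_.@[_]]/(pval _ _) -ew wcoord_chart // => /eqP; rewrite oner_eq0.
pose f' (s : 'I_k.+1) := if unlift ord_max s is Some j then f j else q.
have [R R0 hR] := dep f'.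
have exR : exists j, mslice R j != 0.
  have [m mR] : exists m, m \in msupp R.
    case: (msupp R) (msupp_eq0 R) => [|m r _]; last by exists m; rewrite mem_head.
    by rewrite eqxx (negbTE R0).
  by exists (m ord_max); apply: mslice_neq0.
case: (ex_minnP exR) => j Rj minj.
have jlt : (j < msize R)%N.
  rewrite ltnNge; apply: contraNN Rj => le; apply/eqP; rewrite /mslice big_seq_cond big1 //.
  move=> m /andP[/msize_mdeg_lt lt /eqP ej]; move: le; rewrite leqNgt; case/negP.
  by apply: leq_ltn_trans lt; rewrite -ej mdegE (bigD1 ord_max) //= leq_addr.
(* What is left of R, with q in the last variable, after division by q^j; the slices below j are
   zero. *)
pose A := \sum_(i < msize R | (j <= i)%N)
  (mslice R i \mPo [tuple f s | s < k]) * q ^+ (i - j).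
have comp i P : pval (mslice R i \mPo [tuple f s | s < k]) P =
    (mslice R i).@[fun s => pval (f s) P].
  rewrite /pval comp_mpoly_meval; apply: meval_eq => s.
  by rewrite tnth_mktuple.
have eA P : pval A P = \sum_(i < msize R | (j <= i)%N)
    (mslice R i).@[fun s => pval (f s) P] * pval q P ^+ (i - j).
  rewrite /pval raddf_sum; apply: eq_bigr => i _.
  by rewrite /= mevalM rmorphXn /= -comp.
have eR P : R.@[fun s => pval (f' s) P] = pval (q ^+ j) P * pval A P.
  rewrite meval_mslice eA mulr_sumr [RHS]big_mkcond; apply: eq_bigr => i _.
  rewrite {2}/f' unlift_none (@meval_eq _ _ _ (fun s => pval (f s) P)); last first.
    by move=> s /=; rewrite /f' -lift_max_widen liftK.
  case: leqP => [le|lt].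
    by rewrite /pval rmorphXn /= mulrCA -exprD subnKC.
  have /eqP -> : mslice R i == 0 by apply: contraLR lt; rewrite -leqNgt; apply: minj.
  by rewrite meval0 mul0r.
have [|||zq|zA] := @chart_prime Z' (q ^+ j) A.
- by [].
- by [].
- by move=> P Z'P cP; rewrite -eR hR.
- case: nzq => P Z'P cP; have := zq P Z'P cP; rewrite /pval rmorphXn /= => /eqP.
  by rewrite expf_eq0 => /andP[_ /eqP].
exists (mslice R j) => // P ZP cP; have := zA P (sub _ ZP) cP; rewrite eA.
rewrite (bigD1 (Ordinal jlt)) //= subnn expr0 mulr1 big1 ?addr0 // => i /andP[le ne].
rewrite q0 // expr0n subn_eq0; case: leqP => [ge|_]; last by rewrite mulr0.
by case/eqP: ne; apply/val_inj/eqP; rewrite eqn_leq ge.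
Qed.

(** Along [f] the normalized values of the [h s] are fractions of polynomials [G s] in D parameters
    with common denominator [W], a power of [wcoord]. Dividing the homogeneous relation between the
    [G s] and [W] by a power of [W] gives a relation between the [h s]; homogenized, it is an
    equation of the image and so holds on the closure. *)
Lemma algdep_image (D : nat) (f : 'rV[F]_D -> 'M[F]_(n, N)) :
  polymap f -> algdep (zclosure (zimage f)) D.+1.
Proof.
move=> hf h.
have [E hE] := fin_all_exists (fun s => homogenizable_pval (h s)).
pose e := (\sum_s E s)%N.
have hEe s : (E s <= e)%N by rewrite /e (bigD1 s) //= leq_addr.
have [g hg] : exists g : 'I_D.+1 -> {mpoly F[n * N]}, forall s P,
    (forall i, P i (J i) != 0) -> pval (g s) P = pval (h s) (normrow P) * wcoord P ^+ e.
  apply: (fin_all_exists (P := fun s (g : {mpoly F[n * N]}) => forall P,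
    (forall i, P i (J i) != 0) -> pval g P = pval (h s) (normrow P) * wcoord P ^+ e)) => s.
  have [g0 [p _ eg] hg] := hE s e (hEe s).
  by exists p => P nz; rewrite -eg hg.
have [G hG] := fin_all_exists (fun s => polymap_pval (g s) hf).
have [w _ ew] := mhfun_wcoord.
have [W hW] := polyfunX e (polymap_pval w hf).
have [r [c [s0 cs0] rel]] := homogeneous_relation G W.
pose mon (s : {ffun 'I_D.+1 -> 'I_r}) : 'X_{1..D.+1} := [multinom (s i : nat) | i < D.+1].
pose R := \sum_s c s *: 'X_[mon s].
exists R => [|P XP cP].
  apply: contraNneq cs0 => /mpolyP/(_ (mon s0)).
  rewrite mcoeff0 raddf_sum (bigD1 s0) //= mcoeffZ mcoeffX eqxx mulr1 big1 ?addr0 => [->//|s ne].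
  rewrite mcoeffZ mcoeffX; case: eqP => [em|_]; last by rewrite mulr0.
  case/eqP: ne; apply/ffunP => i; apply/val_inj.
  by have := congr1 (fun m : 'X_{1..D.+1} => m i) em; rewrite !mnmE.
pose p := R \mPo [tuple h s | s < D.+1].
have ep Q : pval p Q = R.@[fun s => pval (h s) Q].
  by rewrite /pval comp_mpoly_meval; apply: meval_eq => s; rewrite tnth_mktuple.
have [k [[d [k' hk' ek']] hk]] := homogenize_chart p.
rewrite -ep; apply/eqP/negPn/negP => pP.
have /negP[] : k P != 0.
  by apply/hk; rewrite normrow_chart //; split => // i; rewrite cP oner_neq0.
move: XP; rewrite zclosureE; last exact: zimage_mpoints.
case=> _ /(_ k'); rewrite ek' => -> //; first by exists d.
move=> Q [mQ [a eQ]]; rewrite -ek'; apply/eqP/negPn/negP => /hk[nz] /negP; apply.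
have w0 : wcoord Q != 0 by apply/wcoord_neq0.
rewrite ep; apply/eqP/(mulIf (expf_neq0 (e * (D.+1 * r)) w0)).
rewrite mul0r raddf_sum mulr_suml /=.
have := congr1 (fun H : {mpoly F[D]} => H.@[a 0]) rel; rewrite meval0 => e0.
rewrite -[RHS]e0 raddf_sum; apply: eq_bigr => s _ /=.
rewrite !mevalZ mevalM mevalX -mulrA; congr (_ * _).
have le : (\sum_i s i <= D.+1 * r)%N.
  by rewrite -[D.+1 in leqRHS]card_ord -sum_nat_const; apply: leq_sum => i _; apply: ltnW.
rewrite rmorphXn /= -hW -eQ -ew -exprM -{1}(subnKC le) mulnDr exprD mulrA; congr (_ * _).
rewrite exprM -prodrXr -big_split rmorph_prod; apply: eq_bigr => i _ /=.
by rewrite mnmE rmorphXn /= -hG -eQ hg // exprMn.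
Qed.

End Dimension.

Section DimensionBound.
Local Open Scope ring_scope.
Local Open Scope classical_set_scope.

(** The chart is chosen at a point of the smallest set, hence meets every member of the chain. Each
    step down costs one polynomial: D + 1 dependent polynomials on the largest set leave, after D +
    1 steps, a nonzero constant that vanishes at a point. *)
Lemma irred_chain_leq (F : numFieldType) (n N D : nat) (f : 'rV[F]_D -> 'M[F]_(n, N)) l Z :
  polymap f -> irred_chain (zclosure (zimage f)) l Z -> (l <= D)%N.
Proof.
move=> hf [chZ ltZ]; rewrite leqNgt; apply/negP => Dl.
have mono k : (k <= l)%N -> Z 0%N `<=` Z k.
  elim: k => [_ P //|k IH lt P /(IH (ltnW lt))]; apply: (ltZ k lt).1.
have [c0 [[P0 ZP0] _] _] := chZ 0%N (leq0n _).
have [J hJ] := mpoints_entries (zclosed_mpoints c0 ZP0).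
pose P := normrow J P0; have cP : chart J P := chart_normrow hJ.
have ZP : Z 0%N P by apply: zclosed_normrow.
have dep i : (i <= D.+1)%N -> algdep J (Z (l - i)%N) (D.+1 - i).
  elim: i => [_|i IH lt].
    rewrite !subn0; have [_ _ sub] := chZ l (leqnn l).
    exact: algdep_sub sub (algdep_image J hf).
  have lti : (l - i.+1 < l)%N by rewrite ltn_subrL /= (leq_ltn_trans _ Dl).
  have es : ((l - i.+1).+1 = l - i)%N by rewrite subnSK // (leq_trans _ Dl).
  have [cZ _ _] := chZ _ (ltnW lti).
  have [cZ' iZ' _] := chZ (l - i)%N (leq_subr _ _).
  apply: (@algdep_descent _ _ _ J _ (Z (l - i)%N)) => //.
  - by rewrite -es; apply: ltZ.
  - exists P; split; last exact: cP.
    exact: (mono _ (ltnW lti) P ZP).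
  - by rewrite subSS -subSn //; apply: IH (ltnW lt).
have := dep D.+1 (leqnn _); rewrite subnn => /(_ (fun=> 0))[R R0 hR].
have := hR P (mono _ (leq_subr _ _) _ ZP) cP.
rewrite (mpoly0_cst R) mevalC => e0; case/eqP: R0.
by rewrite (mpoly0_cst R) e0.
Qed.

End DimensionBound.

(** * Forms and Veronese coordinates *)

Section Forms.
Local Open Scope ring_scope.
Variable F : numFieldType.

Definition veval (d N : nat) (r : 'rV[F]_(nmon N d)) (x : 'cV[F]_N) : F :=
  (r *m veronese d x) 0 0.

Lemma vevalE d N (r : 'rV[F]_(nmon N d)) x :
  veval r x = \sum_k r 0 k * \prod_(i <- monomial k) x i 0.
Proof. by rewrite /veval mxE; apply: eq_bigr => k _; rewrite mxE. Qed.

Lemma veval_mulmx d m N (r : 'rV[F]_(nmon m d)) (A : 'M[F]_(m, N)) x :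
  veval (r *m veronese_mx d A) x = veval r (A *m x).
Proof. by rewrite /veval veronese_mulmx mulmxA. Qed.

Lemma vevalZ d N c (r : 'rV[F]_(nmon N d)) x : veval (c *: r) x = c * veval r x.
Proof. by rewrite /veval -scalemxAl mxE. Qed.

Lemma veval0 d N x : veval (0 : 'rV[F]_(nmon N d)) x = 0.
Proof. by rewrite /veval mul0mx mxE. Qed.

Lemma veval_scale d N c (r : 'rV[F]_(nmon N d)) x : veval r (c *: x) = c ^+ d * veval r x.
Proof.
rewrite !vevalE mulr_sumr; apply: eq_bigr => k _; rewrite mulrCA; congr (_ * _).
rewrite (eq_bigr (fun i => c * x i 0)) => [|i _]; last by rewrite mxE.
by rewrite big_split /= big_const_seq count_predT size_tuple -Monoid.iteropE.
Qed.

(** Over an infinite field the values of a form determine its coefficients; identities between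
    coefficient rows are thereby reduced to evaluation. *)
Lemma veval_inj d N (r s : 'rV[F]_(nmon N d)) : veval r =1 veval s -> r = s.
Proof.
move=> rs; pose p := \sum_k (r 0 k - s 0 k) *: 'X_[s2m (monomial k)] : {mpoly F[N]}.
have pE (x : 'cV[F]_N) : p.@[fun j => x j 0] = 0.
  transitivity (veval r x - veval s x); last by rewrite rs subrr.
  rewrite !vevalE -sumrB raddf_sum; apply: eq_bigr => k _ /=.
  by rewrite mevalZ meval_s2m mulrBl.
have p0 : p = 0.
  apply/eqP; apply/negPn/negP => /mpoly_nonzero_point[v]; apply/negP/negPn.
  rewrite (@meval_eq _ _ _ (fun j => (\col_i v i) j 0)) ?pE // => i.
  by rewrite mxE.
apply/rowP => k; apply/eqP; rewrite -subr_eq0.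
have := congr1 (mcoeff (s2m (monomial k))) p0.
rewrite mcoeff0 raddf_sum (bigD1 k) //= mcoeffZ mcoeffX eqxx mulr1.
rewrite big1 ?addr0 => [->//|l ne]; rewrite mcoeffZ mcoeffX.
case: eqP => [e|_]; last by rewrite mulr0.
have /enum_val_inj el : monomial l = monomial k.
  by apply: (inj_s2m (enum_valP l) (enum_valP k)).
by rewrite el eqxx in ne.
Qed.

Lemma veval_neq0 d N (r : 'rV[F]_(nmon N d)) : r != 0 -> exists x, veval r x != 0.
Proof.
move=> r0; apply: contrapT => nx; case/eqP: r0; apply: veval_inj => x.
by rewrite veval0; apply/eqP/negPn/negP => h; apply: nx; exists x.
Qed.

Lemma neq0_veval d N (r : 'rV[F]_(nmon N d)) x : veval r x != 0 -> r != 0.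
Proof. by apply: contraNneq => ->; rewrite veval0. Qed.

Definition isform (d N : nat) (g : 'cV[F]_N -> F) : Prop :=
  exists2 p : {mpoly F[N]}, p \is d.-homog & forall x, g x = p.@[fun j => x j 0].

Definition coefrow (d N : nat) (p : {mpoly F[N]}) : 'rV[F]_(nmon N d) :=
  \row_k p@_(s2m (monomial k)).

Lemma veval_coefrow d N (p : {mpoly F[N]}) x : p \is d.-homog ->
  veval (coefrow d p) x = p.@[fun j => x j 0].
Proof.
move=> hp; rewrite vevalE [in RHS](dhomog_monomialE hp) raddf_sum; apply: eq_bigr => k _.
by rewrite /= mevalZ meval_s2m mxE.
Qed.

Lemma isform_row d N (g : 'cV[F]_N -> F) : isform d g ->
  exists r : 'rV[F]_(nmon N d), forall x, veval r x = g x.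
Proof. by move=> [p hp gp]; exists (coefrow d p) => x; rewrite gp veval_coefrow. Qed.

Lemma isform_ext d N (f g : 'cV[F]_N -> F) : f =1 g -> isform d f -> isform d g.
Proof. by move=> fg [p hp fp]; exists p => // x; rewrite -fg. Qed.

Lemma isform_coord N (i : 'I_N) : isform 1 (fun x : 'cV[F]_N => x i 0).
Proof. by exists 'X_i => [|x]; rewrite ?dhomogX /= ?mdeg1 // mevalXU. Qed.

Lemma isformD d N (f g : 'cV[F]_N -> F) :
  isform d f -> isform d g -> isform d (fun x => f x + g x).
Proof.
move=> [p hp fp] [q hq gq]; exists (p + q) => [|x]; first exact: dhomogD.
by rewrite mevalD fp gq.
Qed.

Lemma isformM d e N (f g : 'cV[F]_N -> F) :
  isform d f -> isform e g -> isform (d + e) (fun x => f x * g x).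
Proof.
move=> [p hp fp] [q hq gq]; exists (p * q) => [|x]; first exact: dhomogM.
by rewrite mevalM fp gq.
Qed.

Lemma isformZ d c N (f : 'cV[F]_N -> F) : isform d f -> isform d (fun x => c * f x).
Proof.
move=> [p hp fp]; exists (c *: p) => [|x]; first exact: dhomogZ.
by rewrite mevalZ fp.
Qed.

Lemma isformN d N (f : 'cV[F]_N -> F) : isform d f -> isform d (fun x => - f x).
Proof. by move=> hf; apply: isform_ext (isformZ (-1) hf) => x; rewrite mulN1r. Qed.

Lemma isformB d N (f g : 'cV[F]_N -> F) :
  isform d f -> isform d g -> isform d (fun x => f x - g x).
Proof. by move=> hf hg; apply: isformD => //; apply: isformN. Qed.

Lemma isformX d k N (f : 'cV[F]_N -> F) : isform d f -> isform (d * k) (fun x => f x ^+ k).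
Proof.
move=> [p hp fp]; exists (p ^+ k) => [|x]; first exact: dhomogMn.
by rewrite rmorphXn fp.
Qed.

Lemma isform_lin N (u : 'rV[F]_N) : isform 1 (fun x : 'cV[F]_N => (u *m x) 0 0).
Proof.
exists (\sum_j u 0 j *: 'X_j) => [|x].
  by apply: rpred_sum => j _; apply: dhomogZ; rewrite dhomogX /= mdeg1.
by rewrite mxE raddf_sum; apply: eq_bigr => j _; rewrite /= mevalZ mevalXU.
Qed.

Lemma veval_nonzero_form d N (y : 'cV[F]_N) : y != 0 ->
  exists r : 'rV[F]_(nmon N d), veval r y != 0.
Proof.
move=> y0; have [j yj] : exists j, y j 0 != 0.
  apply: contrapT => ny; case/eqP: y0; apply/colP => j; rewrite mxE.
  by apply/eqP/negPn/negP => h; apply: ny; exists j.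
have [r hr] := isform_row (isformX d (isform_coord j)).
move: r hr; rewrite mul1n => r hr; exists r.
by rewrite hr expf_neq0.
Qed.

Lemma polyfun_mulmx k m n p (A : 'rV[F]_k -> 'M[F]_(m, n)) (B : 'rV[F]_k -> 'M[F]_(n, p)) :
  (forall i j, polyfun (fun a => A a i j)) -> (forall i j, polyfun (fun a => B a i j)) ->
  forall i j, polyfun (fun a => (A a *m B a) i j).
Proof.
move=> hA hB i j; apply: (@polyfun_ext _ _ (fun a => \sum_l A a i l * B a l j)).
  by move=> a; rewrite mxE.
by apply: polyfun_sum => l _; apply: polyfunM.
Qed.

(** Induction on the list of linear factors: splitting off one linear form expresses a coefficient
    of the product by coefficients of the shorter product at monomials divided by one variable. *)
Lemma polyfun_veronese_mx k d m N (A : 'rV[F]_k -> 'M[F]_(m, N)) :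
  (forall i j, polyfun (fun a => A a i j)) ->
  forall i j, polyfun (fun a => veronese_mx d (A a) i j).
Proof.
move=> hA i j; apply: (@polyfun_ext _ _ (fun a =>
  (\prod_(i <- monomial i) linform (A a) i)@_(s2m (monomial j)))).
  by move=> a; rewrite mxE.
elim: {i}(val (monomial i)) (s2m _) => [|i s IH] mm.
  by apply: polyfun_ext (polyfun_cst k 1@_mm) => a; rewrite big_nil.
apply: (@polyfun_ext _ _ (fun a => \sum_l A a i l *
    (if (U_(l) <= mm)%MM then (\prod_(i <- s) linform (A a) i)@_(mm - U_(l)) else 0))).
  move=> a; rewrite big_cons /linform mulr_suml raddf_sum.
  apply: eq_bigr => l _ /=; rewrite -scalerAl mcoeffZ; congr (_ * _).
  case: ifP => [le|nle]; first by rewrite -[in RHS](submK le) addmC ['X_l * _]mulrC mcoeffMX.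
  apply/esym/memN_msupp_eq0/negP => /msuppM_le/allpairsP[[m1 m2]] /= [].
  rewrite msuppX inE => /eqP-> _ em; move: nle; rewrite em.
  by rewrite lem_addr.
apply: polyfun_sum => l _; apply: polyfunM => //.
by case: (U_(l) <= mm)%MM; [exact: IH | exact: polyfun_cst].
Qed.

Lemma mhfun_row_lin n N m (i : 'I_n) (A : 'M[F]_(N, m)) j :
  mhfun (fun i' => (i' == i) : nat) (fun P : 'M[F]_(n, N) => (row i P *m A) 0 j).
Proof.
apply: (@mhfun_ext _ _ _ _ (fun P => \sum_k A k j * P i k)).
  by move=> P; rewrite mxE; apply: eq_bigr => k _; rewrite mxE mulrC.
by apply: mhfun_sum => k _; apply: mhfunZ; apply: mhfun_entry.
Qed.

Lemma mhfun_veval d n N (i : 'I_n) (x : 'cV[F]_N) :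
  mhfun (fun i' => (i' == i) : nat) (fun P : 'M[F]_(n, nmon N d) => veval (row i P) x).
Proof. exact: mhfun_row_lin. Qed.

(** The rank factorization of a nonzero row exhibits it as a multiple of the first row of an
    invertible matrix, which explains the index 0. *)
Lemma complete_basis m (v : 'rV[F]_m) (k0 : 'I_m) : k0 = 0%N :> nat -> v != 0 ->
  exists2 Q, Q \in unitmx & row k0 Q = v.
Proof.
move=> e0 v0; pose c := col_ebase v 0 0.
have rv : \rank v = 1%N by rewrite rank_rV v0.
have c0 : c != 0.
  have := col_ebase_unit v; rewrite unitmxE unitfE.
  by rewrite [col_ebase v]mx11_scalar det_scalar1.
exists (c *: row_ebase v); first by rewrite unitmxZ ?unitfE // row_ebase_unit.
rewrite -[RHS]mulmx_ebase rv [col_ebase v]mx11_scalar mul_scalar_mx -scalemxAl.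
rewrite linearZ /=; congr (_ *: _); rewrite rowE; congr (_ *m _).
by apply/matrixP => i j; rewrite !mxE ord1 eqxx andbT -val_eqE /= e0 eq_sym.
Qed.

(** Coordinates out of range read as 0, so that parameters can be indexed by arithmetic
    expressions. *)
Definition co (D : nat) (a : 'rV[F]_D) (j : nat) : F :=
  if insub j is Some i then a 0 i else 0.

Lemma polyfun_co D j : polyfun (fun a : 'rV[F]_D => co a j).
Proof. by rewrite /co; case: insubP => [i _ _|_]; [exact: polyfun_coord | exact: polyfun_cst]. Qed.

Lemma co_ord D (a : 'rV[F]_D) (i : 'I_D) : co a i = a 0 i.
Proof. by rewrite /co valK. Qed.

Lemma co_row D (g : nat -> F) j : (j < D)%N -> co (\row_(i < D) g i) j = g j.
Proof. by move=> lt; rewrite -[j]/(val (Ordinal lt)) co_ord mxE. Qed.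

Lemma co0 D j : co (0 : 'rV[F]_D) j = 0.
Proof. by rewrite /co; case: insubP => // i _ _; rewrite mxE. Qed.

Lemma co_vanish D (a : 'rV[F]_D) k : (forall j : 'I_D, (k <= j)%N -> a 0 j = 0) ->
  forall j, (k <= j)%N -> co a j = 0.
Proof. by move=> h j kj; rewrite /co; case: insubP => // i _ e; apply: h; rewrite e. Qed.

End Forms.

(** * Plane curves *)

Section PlaneGeometry.
Local Open Scope ring_scope.
Variable F : numFieldType.

Lemma camera_ker (C : 'M[F]_(3, 4)) (x : 'cV[F]_4) :
  is_camera C -> C *m x = 0 -> exists a, x = a *: center C.
Proof.
move=> hC Cx; have hk : \rank (kermx C^T) = 1%N by rewrite mxrank_ker mxrank_tr hC.
have sk : (nz_row (kermx C^T) <= kermx C^T)%MS := nz_row_sub _.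
have : (x^T <= kermx C^T)%MS by apply/sub_kermxP; rewrite -trmx_mul Cx trmx0.
have /eqmxP e : (nz_row (kermx C^T) == kermx C^T)%MS.
  rewrite -(geq_leqif (mxrank_leqif_eq sk)) hk rank_rV nz_row_eq0.
  by rewrite -mxrank_eq0 hk.
rewrite -e => /sub_rVP[a ea]; exists a.
by apply: trmx_inj; rewrite ea linearZ /= trmxK.
Qed.

Lemma camera_decomp (C : 'M[F]_(3, 4)) (q : 'cV[F]_4) :
  is_camera C -> exists a, q = pinvmx C *m (C *m q) + a *: center C.
Proof.
move=> hC; have [|a ea] := @camera_ker C (q - pinvmx C *m (C *m q)) hC.
  by rewrite mulmxBr [C *m (pinvmx C *m _)]mulmxA camera_pinvmx // mul1mx subrr.
by exists a; rewrite -ea addrC subrK.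
Qed.

Definition dot (h p : 'cV[F]_4) : F := (h^T *m p) 0 0.

Lemma dotE h p : h^T *m p = (dot h p)%:M.
Proof. exact: mx11_scalar. Qed.

Lemma dotDr h p q : dot h (p + q) = dot h p + dot h q.
Proof. by rewrite /dot mulmxDr mxE. Qed.

Lemma dotZr h c p : dot h (c *: p) = c * dot h p.
Proof. by rewrite /dot -scalemxAr mxE. Qed.

Lemma dotNr h p : dot h (- p) = - dot h p.
Proof. by rewrite /dot mulmxN mxE. Qed.

Lemma dotDl h k p : dot (h + k) p = dot h p + dot k p.
Proof. by rewrite /dot linearD mulmxDl mxE. Qed.

Lemma dotZl h c p : dot (c *: h) p = c * dot h p.
Proof. by rewrite /dot linearZ -scalemxAl mxE. Qed.

Lemma dot_eq0 h : (forall p, dot h p = 0) -> h = 0.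
Proof.
move=> h0; apply/colP => i; rewrite mxE.
have := h0 (delta_mx i 0); rewrite /dot mxE (bigD1 i) //= !mxE !eqxx mulr1 big1 ?addr0 //.
by move=> j ne; rewrite !mxE (negbTE ne) mulr0.
Qed.

(* The parametrization of the plane with equation h by coordinates in the plane. *)
Definition Ymx (h : 'cV[F]_4) : 'M[F]_(4, 3) :=
  mx_of_rows 4 3
    [:: [:: - hcoord h 1; - hcoord h 2; - hcoord h 3];
        [:: hcoord h 0; 0; 0]; [:: 0; hcoord h 0; 0]; [:: 0; 0; hcoord h 0]].

(** Projection from c onto the plane h: p goes to the point of the line through c and p that lies in
    the plane. *)
Definition plane_proj (h c : 'cV[F]_4) : 'M[F]_4 := c *m h^T - dot h c *: 1%:M.

Lemma plane_projE h c p : plane_proj h c *m p = dot h p *: c - dot h c *: p.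
Proof.
rewrite /plane_proj mulmxBl -mulmxA dotE mul_mx_scalar -scalemxAl mul1mx.
by [].
Qed.

Lemma plane_proj_entry h c i j :
  plane_proj h c i j = c i 0 * h j 0 - (\sum_k h k 0 * c k 0) * (1%:M : 'M[F]_4) i j.
Proof.
have e1 : (c *m h^T) i j = c i 0 * h j 0 by rewrite mxE big_ord1 [h^T _ _]mxE.
have e2 : dot h c = \sum_k h k 0 * c k 0.
  by rewrite /dot mxE; apply: eq_bigr => k _; rewrite mxE.
have e3 : (dot h c *: (1%:M : 'M[F]_4)) i j = dot h c * (1%:M : 'M[F]_4) i j by rewrite mxE.
by rewrite /plane_proj -e1 -e2 -e3 mxE [X in _ + X = _]mxE.
Qed.

Lemma plane_proj_camera (h : 'cV[F]_4) (C : 'M[F]_(3, 4)) : is_camera C ->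
  C *m plane_proj h (center C) *m pinvmx C = (- dot h (center C))%:M.
Proof.
move=> hC; rewrite /plane_proj mulmxBr [C *m (_ *m _)]mulmxA mulmx_center mul0mx sub0r.
by rewrite -scalemxAr mulmx1 mulNmx -scalemxAl camera_pinvmx // scalemx1 raddfN.
Qed.

Lemma ord4 (i : 'I_4) : [\/ i = inord 0, i = inord 1, i = inord 2 | i = inord 3].
Proof.
case: i => -[|[|[|[|//]]]] lt; [constructor 1|constructor 2|constructor 3|constructor 4];
  by apply: val_inj; rewrite /= inordK.
Qed.

Lemma sum4 (f : 'I_4 -> F) :
  \sum_i f i = f (inord 0) + f (inord 1) + f (inord 2) + f (inord 3).
Proof.
rewrite !big_ord_recl big_ord0 addr0 !addrA; congr (f _ + f _ + f _ + f _);
  by apply: val_inj; rewrite /= inordK.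
Qed.

(** [hatH h] sends a line to the plane coordinates of its intersection with the plane h. For the
    lines through c this is the projection from c, up to the factor h_0, so each image of a plane
    curve is its transform by a homography. *)
Lemma Ymx_hatH_Emx h c : Ymx h *m hatH h *m Emx c = hcoord h 0 *: plane_proj h c.
Proof.
apply/matrixP => i j; rewrite /plane_proj !mxE /dot mxE.
under eq_bigr do rewrite mxE !big_ord_recl big_ord0 !mxE.
rewrite !sum4 !big_ord_recl !big_ord0 !mxE /= -!/(hcoord _ _).
case: (ord4 i) => ->; case: (ord4 j) => ->; rewrite !inordK //= -!/(hcoord _ _);
  rewrite -?val_eqE /= ?inordK //=; ring.
Qed.

Lemma Ymx_hatH_hatC h (C : 'M[F]_(3, 4)) :
  Ymx h *m hatH h *m hatC C = hcoord h 0 *: (plane_proj h (center C) *m pinvmx C).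
Proof. by rewrite /hatC mulmxA Ymx_hatH_Emx scalemxAl. Qed.

End PlaneGeometry.

(** * The plane curve variety as the closure of a polynomial image *)

Section PlaneCurves.
Local Open Scope ring_scope.
Local Open Scope classical_set_scope.
Variables (F : numFieldType) (n d : nat) (C : 'I_n -> 'M[F]_(3, 4)).
Hypothesis hC : forall i, is_camera (C i).

Lemma nmon3 : nmon 3 d = ((d ^ 2 + 3 * d)./2).+1.
Proof.
rewrite /nmon cardE -(size_map (fun t : d.-tuple 'I_3 => s2m t)) size_basis.
rewrite -bin_sub ?leq_addr // addKn bin2 addn2 succnK -mulnn.
have -> : ((d.+2 * d.+1) = (d * d + 3 * d) + 2)%N by ring.
by rewrite halfD /= andbF add0n addn1.
Qed.

Local Notation D := ((d ^ 2 + 3 * d)./2 + 3)%N.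

(* The slices h_0 = 1 and alpha_0 = 1 of the two projective spaces. *)
Definition hvec (a : 'rV[F]_D) : 'cV[F]_4 :=
  \col_(i < 4) (if nat_of_ord i is j.+1 then co a j else 1).

Definition avec (a : 'rV[F]_D) : 'rV[F]_(nmon 3 d) :=
  \row_(k < nmon 3 d) (if nat_of_ord k is j.+1 then co a (j + 3) else 1).

Lemma polyfun_hvec i j : polyfun (fun a => hvec a i j).
Proof.
apply: (@polyfun_ext _ _ (fun a => if nat_of_ord i is j.+1 then co a j else 1)).
  by move=> a; rewrite mxE.
by case: (nat_of_ord i) => [|k]; [apply: polyfun_cst | apply: polyfun_co].
Qed.

Lemma polyfun_avec i j : polyfun (fun a => avec a i j).
Proof.
apply: (@polyfun_ext _ _ (fun a => if nat_of_ord j is j.+1 then co a (j + 3) else 1)).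
  by move=> a; rewrite mxE.
by case: (nat_of_ord j) => [|k]; [apply: polyfun_cst | apply: polyfun_co].
Qed.

Lemma slice_surj h (al : 'rV[F]_(nmon 3 d)) (k0 : 'I_(nmon 3 d)) : k0 = 0%N :> nat ->
  hcoord h 0 != 0 -> al 0 k0 != 0 ->
  exists a, h = hcoord h 0 *: hvec a /\ al = al 0 k0 *: avec a.
Proof.
move=> e0 h0 a0.
pose g j := if (j < 3)%N then (hcoord h 0)^-1 * hcoord h j.+1
  else (al 0 k0)^-1 * oapp (al 0) 0 (insub (j - 3).+1).
exists (\row_(j < D) g j); split.
  apply/colP => i; rewrite !mxE; have [->|->|->|->] := ord4 i; rewrite inordK //=.
  - by rewrite mulr1.
  - by rewrite co_row ?addn3 // /g /= mulVKf.
  - by rewrite co_row ?addn3 // /g /= mulVKf.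
  - by rewrite co_row ?addn3 // /g /= mulVKf.
apply/rowP => k; rewrite !mxE; case ek: (nat_of_ord k) => [|j].
  by rewrite mulr1; congr (al 0 _); apply: val_inj; rewrite /= ek e0.
have lt : (j.+1 < nmon 3 d)%N by rewrite -ek.
rewrite co_row; last by rewrite ltn_add2r -ltnS -nmon3.
rewrite /g -[X in (_ < X)%N]add0n ltn_add2r /= addnK mulVKf //.
by rewrite (insubT (fun j => (j < nmon 3 d)%N) lt) /=; congr (al 0 _); apply: val_inj.
Qed.

Definition Phiv (v : 'rV[F]_(4 + nmon 3 d)) : 'M[F]_(n, nmon 3 d) :=
  Phi C ((lsubmx v)^T, rsubmx v).

Lemma row_Phi h (al : 'rV[F]_(nmon 3 d)) i :
  row i (Phi C (h, al)) = al *m veronese_mx d (hatH h) *m veronese_mx d (hatC (C i)).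
Proof. by rewrite /Phi rowK. Qed.

Lemma veval_Phi h (al : 'rV[F]_(nmon 3 d)) i x :
  veval (row i (Phi C (h, al))) x = veval al (hatH h *m hatC (C i) *m x).
Proof. by rewrite row_Phi !veval_mulmx mulmxA. Qed.

Lemma hatHZ c (h : 'cV[F]_4) : hatH (c *: h) = c *: hatH h.
Proof.
apply/matrixP => i j; rewrite !mxE /hcoord !mxE.
case: i => -[|[|[|//]]] ? /=; case: j => -[|[|[|[|[|[|//]]]]]] ? /=; ring.
Qed.

Lemma PhiZ c h e (al : 'rV[F]_(nmon 3 d)) i j :
  Phi C (c *: h, e *: al) i j = (c ^+ d * e) * Phi C (h, al) i j.
Proof.
suff er : row i (Phi C (c *: h, e *: al)) = (c ^+ d * e) *: row i (Phi C (h, al)).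
  by have := congr1 (fun r : 'rV_(nmon 3 d) => r 0 j) er; rewrite !mxE.
apply: veval_inj => x; rewrite vevalZ !veval_Phi vevalZ hatHZ -!scalemxAl.
by rewrite veval_scale mulrA [e * _]mulrC.
Qed.

Lemma polymap_Phi k (h : 'rV[F]_k -> 'cV[F]_4) (al : 'rV[F]_k -> 'rV[F]_(nmon 3 d)) :
  (forall i j, polyfun (fun a => h a i j)) -> (forall i j, polyfun (fun a => al a i j)) ->
  polymap (fun a => Phi C (h a, al a)).
Proof.
move=> hh ha i j; apply: (@polyfun_ext _ _ (fun a =>
  (al a *m veronese_mx d (hatH (h a)) *m veronese_mx d (hatC (C i))) 0 j)).
  by move=> a; rewrite -row_Phi mxE.
apply: polyfun_mulmx => [|i' j']; last exact: polyfun_cst.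
apply: polyfun_mulmx => //; apply: polyfun_veronese_mx => i' j'.
pose w a := [:: hcoord (h a) 0; hcoord (h a) 1; hcoord (h a) 2; hcoord (h a) 3].
apply: (@polyfun_ext _ _ (fun a => mx_of_rows 3 6
    [:: [:: (w a)`_0; 0;  0;  - (w a)`_2; - (w a)`_3; 0];
        [:: 0;  (w a)`_0; 0;  (w a)`_1;   0;    - (w a)`_3];
        [:: 0;  0;  (w a)`_0; 0;    (w a)`_1;   (w a)`_2]] i' j')) => //.
have hw l : polyfun (fun a => (w a)`_l).
  by move: l => [|[|[|[|l]]]]; [exact: hh|exact: hh|exact: hh|exact: hh|rewrite /w /= nth_nil; exact: polyfun_cst].
apply: (@polyfun_ext _ _ _ _ (fun a => esym (mxE _ _ _ _))).
by case: i' => -[|[|[|//]]] ?; case: j' => -[|[|[|[|[|[|//]]]]]] ? /=;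
  rewrite /=; try exact: polyfun_cst; try exact: hh; apply: polyfunN; exact: hh.
Qed.

Lemma polymap_Phiv : polymap Phiv.
Proof.
apply: (polymap_Phi (h := fun v => (lsubmx v)^T) (al := rsubmx)) => i j.
  apply: polyfun_ext (polyfun_coord F (lshift _ i)) => v.
  by rewrite !mxE ord1.
by apply: polyfun_ext (polyfun_coord F (rshift 4 j)) => v; rewrite mxE ord1.
Qed.

Lemma Phi_row_nonzero i : exists v, row i (Phiv v) != 0.
Proof.
have [v /andP[h0 hc]] : exists v : 'rV[F]_4, (v 0 (inord 0) != 0) && (dot v^T (center (C i)) != 0).
  have hp : polyfun (fun v : 'rV[F]_4 => dot v^T (center (C i))).
    apply: (@polyfun_ext _ _ (fun v : 'rV[F]_4 => \sum_j v 0 j * center (C i) j 0)).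
      by move=> v; rewrite /dot trmxK mxE.
    by apply: polyfun_sum => j _; apply: polyfunM; [exact: polyfun_coord|exact: polyfun_cst].
  have [j cj] : exists j, center (C i) j 0 != 0.
    apply: contrapT => nj; case/eqP: (center_neq0 (C i)); apply/colP => j; rewrite [RHS]mxE.
    by apply/eqP/negPn/negP => h; apply: nj; exists j.
  have [||v] := polyfun_generic2 (a := delta_mx 0 (inord 0)) (b := delta_mx 0 j)
    (polyfun_coord F (inord 0 : 'I_4)) hp.
  - by rewrite /= mxE !eqxx oner_neq0.
  - rewrite /dot trmxK mxE (bigD1 j) //= big1 ?addr0 => [|k ne].
      by rewrite mxE !eqxx mul1r.
    by rewrite mxE (negbTE ne) andbF mul0r.
  by rewrite mulf_eq0 negb_or; exists v.
pose x : 'cV[F]_3 := delta_mx 0 0.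
pose y := hatH v^T *m hatC (C i) *m x.
have y0 : y != 0.
  (* [y] holds the plane coordinates of the point of the plane that is seen at [x]. Seen again by
     the camera it gives x times - h_0 (h . c), so [y] = 0 would put the center into the plane. *)
  apply: contraNneq hc => y0.
  have /eqP : C i *m (Ymx v^T *m y) = 0 by rewrite y0 !mulmx0.
  have -> : Ymx v^T *m y = Ymx v^T *m hatH v^T *m hatC (C i) *m x by rewrite /y !mulmxA.
  rewrite Ymx_hatH_hatC -scalemxAl -scalemxAr scaler_eq0.
  have -> : C i *m (plane_proj v^T (center (C i)) *m pinvmx (C i) *m x) =
    C i *m plane_proj v^T (center (C i)) *m pinvmx (C i) *m x by rewrite !mulmxA.
  rewrite plane_proj_camera //.
  rewrite /hcoord mxE (negbTE h0) orFb mul_scalar_mx scaler_eq0 oppr_eq0.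
  by case/orP => // /eqP/(congr1 (fun z : 'cV[F]_3 => z 0 0)); rewrite !mxE !eqxx => /eqP; rewrite oner_eq0.
have [al hal] := veval_nonzero_form d y0.
exists (row_mx v al); apply: (@neq0_veval _ _ _ _ x).
by rewrite /Phiv row_mxKl row_mxKr veval_Phi.
Qed.



Definition plane_dom : set ('cV[F]_4 * 'rV[F]_(nmon 3 d)) := [set ha | ha.1 != 0 /\ ha.2 != 0].

Definition Phi_slice (a : 'rV[F]_D) : 'M[F]_(n, nmon 3 d) := Phi C (hvec a, avec a).

Lemma polymap_slice : polymap Phi_slice.
Proof. exact: (polymap_Phi polyfun_hvec polyfun_avec). Qed.

Let k0 : 'I_(nmon 3 d) := Ordinal (etrans (congr1 (fun m => (0 < m)%N) nmon3) (ltn0Sn _)).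

Lemma slice_generic (g : 'rV[F]_(4 + nmon 3 d) -> F) b :
  polyfun g -> g b != 0 -> exists v a, [/\ g v != 0,
    lsubmx v = hcoord (lsubmx v)^T 0 *: (hvec a)^T, hcoord (lsubmx v)^T 0 != 0,
    rsubmx v = (rsubmx v) 0 k0 *: avec a & (rsubmx v) 0 k0 != 0].
Proof.
move=> hg gb.
have hh : polyfun (fun v : 'rV[F]_(4 + nmon 3 d) => hcoord (lsubmx v)^T 0).
  apply: polyfun_ext (polyfun_coord F (lshift (nmon 3 d) (inord 0 : 'I_4))) => v.
  by rewrite /hcoord !mxE.
have ha : polyfun (fun v : 'rV[F]_(4 + nmon 3 d) => (rsubmx v) 0 k0).
  by apply: polyfun_ext (polyfun_coord F (rshift 4 k0)) => v; rewrite mxE.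
have [||w hw] := polyfun_generic2 (a := const_mx 1) (b := const_mx 1) hh ha.
- by rewrite /hcoord !mxE oner_neq0.
- by rewrite !mxE oner_neq0.
have [v] := polyfun_generic2 hg (polyfunM hh ha) gb hw.
rewrite !mulf_eq0 !negb_or => /and3P[gv h0 a0].
have [a [eh ea]] := slice_surj (k0 := k0) erefl h0 a0.
exists v, a; split => //.
by apply: trmx_inj; rewrite linearZ /= trmxK.
Qed.

Lemma PhivE v a : lsubmx v = hcoord (lsubmx v)^T 0 *: (hvec a)^T ->
  rsubmx v = (rsubmx v) 0 k0 *: avec a -> forall i j,
  Phiv v i j = hcoord (lsubmx v)^T 0 ^+ d * rsubmx v 0 k0 * Phi_slice a i j.
Proof. by move=> eh ea i j; rewrite -PhiZ -ea /Phiv [in LHS]eh linearZ /= trmxK. Qed.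

Lemma Phi_slice_row_nonzero i : exists a, row i (Phi_slice a) != 0.
Proof.
have [v /row_neq0[j hj]] := Phi_row_nonzero i.
have [w [a [wj eh h0 ea a0]]] := slice_generic (polymap_Phiv i j) hj.
exists a; apply: (@entry_row_neq0 _ _ _ _ i j); move: wj.
by rewrite (PhivE eh ea) mulf_eq0 negb_or => /andP[].
Qed.

(** A generic pair (h, alpha) is a rescaling of a pair in the slice, and this multiplies all rows of
    the image by one common factor. *)
Lemma zimage_Phiv_vanish p : multihomog p ->
  (forall P, zimage Phi_slice P -> pval p P = 0) -> forall v, pval p (Phiv v) = 0.
Proof.
move=> [e he] vp v; apply/eqP/negPn/negP => pv.
have sl := zimage_vanish polymap_slice Phi_slice_row_nonzero vp.
have [w [a [pw eh h0 ea a0]]] := slice_generic (polymap_pval p polymap_Phiv) pv.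
case/negP: pw; pose c := hcoord (lsubmx w)^T 0 ^+ d * rsubmx w 0 k0.
have -> : Phiv w = \matrix_(i, j) (c * Phi_slice a i j).
  by apply/matrixP => i j; rewrite [RHS]mxE (PhivE eh ea).
by rewrite (mhdeg_scale (fun=> c) _ he) sl mulr0.
Qed.

Lemma plane_curve_mvE : plane_curve_mv d C = zclosure (zimage Phi_slice).
Proof.
have sub : rational_image plane_dom (@Phi F n d C) `<=` @mpoints F n (nmon 3 d).
  by move=> P [ha [_ mP] <-].
rewrite /plane_curve_mv -/plane_dom; apply/seteqP; split.
  apply: zclosure_sub sub => [|Q p [[h al] _ <-] hp vp]; first exact: zimage_mpoints.
  have := zimage_Phiv_vanish hp vp (row_mx h^T al).
  by rewrite /Phiv row_mxKl row_mxKr trmxK.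
apply: zclosure_sub (@zimage_mpoints _ _ _ _ _) => // Q p [mQ [a eQ]] hp; apply.
exists (hvec a, avec a); last by rewrite eQ.
split; last by rewrite /= -[Phi _ _]/(Phi_slice a) -eQ.
split => /=.
  apply/eqP => /(congr1 (fun h : 'cV[F]_4 => h 0 0)); rewrite !mxE /=.
  by apply/eqP; rewrite oner_neq0.
apply/eqP => /(congr1 (fun h : 'rV[F]_(nmon 3 d) => h 0 k0)); rewrite !mxE /=.
by apply/eqP; rewrite oner_neq0.
Qed.

Lemma plane_curve_mv_irreducible : zirreducible (plane_curve_mv d C).
Proof.
rewrite plane_curve_mvE.
exact: zclosure_image_irreducible polymap_slice Phi_slice_row_nonzero.
Qed.

Lemma plane_curve_mv_chain_leq l Z : irred_chain (plane_curve_mv d C) l Z -> (l <= D)%N.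
Proof. by rewrite plane_curve_mvE; apply: irred_chain_leq polymap_slice. Qed.

End PlaneCurves.

(** * A chain of maximal length for plane curves *)

Section PlaneChain.
Local Open Scope ring_scope.
Local Open Scope classical_set_scope.
Variables (F : numFieldType) (n d : nat) (C : 'I_n -> 'M[F]_(3, 4)).
Hypothesis hC : forall i, is_camera (C i).
Hypothesis hd : (2 <= d)%N.
Variables i1 i2 : 'I_n.
Hypothesis c12 : ~ same_point (center (C i1)) (center (C i2)).

Local Notation D := ((d ^ 2 + 3 * d)./2 + 3)%N.
Let k0 : 'I_(nmon 3 d) := Ordinal (etrans (congr1 (fun m => (0 < m)%N) (nmon3 d)) (ltn0Sn _)).
Let c1 := center (C i1).
Let c2 := center (C i2).

(* Composition of the inverse projection from image i1 to the plane with equation h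
   and the projection to image i, up to sign the inverse homography. *)
Definition Gmx (i : 'I_n) (h : 'cV[F]_4) : 'M[F]_3 :=
  C i1 *m plane_proj h (center (C i)) *m pinvmx (C i).

(** The plane curve is described by its image [g] in view i1 in place of alpha: row i1 is then [g]
    up to a scalar, and no coordinate of h is singled out. *)
Definition theta (h : 'cV[F]_4) (g : 'rV[F]_(nmon 3 d)) : 'M[F]_(n, nmon 3 d) :=
  \matrix_i (g *m veronese_mx d (Gmx i h)).

Lemma row_theta h g i : row i (theta h g) = g *m veronese_mx d (Gmx i h).
Proof. by rewrite rowK. Qed.

Lemma polymap_theta k (h : 'rV[F]_k -> 'cV[F]_4) (g : 'rV[F]_k -> 'rV[F]_(nmon 3 d)) :
  (forall i j, polyfun (fun a => h a i j)) -> (forall i j, polyfun (fun a => g a i j)) ->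
  polymap (fun a => theta (h a) (g a)).
Proof.
move=> hh hg i j; apply: (@polyfun_ext _ _ (fun a =>
  (g a *m veronese_mx d (Gmx i (h a))) 0 j)); first by move=> a; rewrite -row_theta mxE.
apply: polyfun_mulmx => //; apply: polyfun_veronese_mx.
apply: polyfun_mulmx => i' j'; last exact: polyfun_cst.
apply: polyfun_mulmx i' j' => i' j'; first exact: polyfun_cst.
pose c := center (C i).
apply: (@polyfun_ext _ _ (fun a => c i' 0 * h a j' 0 -
    (\sum_k h a k 0 * c k 0) * (1%:M : 'M[F]_4) i' j')) => [a|].
  by rewrite plane_proj_entry.
apply: polyfunB; first by apply: polyfunM => //; exact: polyfun_cst.
apply: polyfunM; last exact: polyfun_cst.
by apply: polyfun_sum => k1 _; apply: polyfunM => //; exact: polyfun_cst.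
Qed.

Lemma Phi_theta h g i j :
  Phi C (h, g *m veronese_mx d (C i1 *m Ymx h)) i j = hcoord h 0 ^+ d * theta h g i j.
Proof.
suff er : row i (Phi C (h, g *m veronese_mx d (C i1 *m Ymx h))) =
    hcoord h 0 ^+ d *: row i (theta h g).
  by have := congr1 (fun r : 'rV_(nmon 3 d) => r 0 j) er; rewrite !mxE.
apply: veval_inj => x; rewrite vevalZ veval_Phi row_theta !veval_mulmx.
rewrite -veval_scale; congr (veval _ _).
have -> : C i1 *m Ymx h *m (hatH h *m hatC (C i) *m x) =
    C i1 *m (Ymx h *m hatH h *m hatC (C i)) *m x by rewrite !mulmxA.
by rewrite Ymx_hatH_hatC -scalemxAr -scalemxAl mulmxA.
Qed.

(** For h_0 != 0 this is a value of [Phi] up to scaling, where alpha is [g] pulled back to the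
    plane. An equation that fails at some (h, g) also fails at one with h_0 != 0. *)
Lemma theta_mv h g : mpoints (theta h g) -> plane_curve_mv d C (theta h g).
Proof.
rewrite plane_curve_mvE // zclosureE; last exact: zimage_mpoints.
move=> mP; split => // p hp vp; have /= v0 := zimage_Phiv_vanish hC hp vp.
apply/eqP/negPn/negP => pt.
pose th (v : 'rV[F]_(4 + nmon 3 d)) := theta (lsubmx v)^T (rsubmx v).
have hth : polymap th.
  apply: (polymap_theta (h := fun v : 'rV[F]_(4 + nmon 3 d) => (lsubmx v)^T)
     (g := rsubmx)) => i j.
    by apply: polyfun_ext (polyfun_coord F (lshift _ i)) => v; rewrite !mxE ord1.
  by apply: polyfun_ext (polyfun_coord F (rshift 4 j)) => v; rewrite mxE ord1.
have hh : polyfun (fun v : 'rV[F]_(4 + nmon 3 d) => hcoord (lsubmx v)^T 0).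
  apply: polyfun_ext (polyfun_coord F (lshift (nmon 3 d) (inord 0 : 'I_4))) => v.
  by rewrite /hcoord !mxE.
have [||v] := polyfun_generic2 (a := row_mx h^T g) (b := const_mx 1) (polymap_pval p hth) hh.
- by rewrite /th row_mxKl row_mxKr trmxK.
- by rewrite /hcoord !mxE oner_neq0.
rewrite mulf_eq0 negb_or => /andP[pv h0]; case/negP: pv.
pose hv := (lsubmx v)^T; rewrite -/hv in h0.
have := v0 (row_mx hv^T (rsubmx v *m veronese_mx d (C i1 *m Ymx hv))).
rewrite /Phiv row_mxKl row_mxKr trmxK.
have -> : Phi C (hv, rsubmx v *m veronese_mx d (C i1 *m Ymx hv)) =
    \matrix_(i, j) (hcoord hv 0 ^+ d * th v i j).
  by apply/matrixP => i j; rewrite [RHS]mxE Phi_theta.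
have [e he] := hp; rewrite (mhdeg_scale (fun=> hcoord hv 0 ^+ d) _ he) => /eqP.
rewrite mulf_eq0 => /orP[|//]; rewrite prodf_seq_eq0 => /hasP[i _] /=.
by rewrite expf_eq0 expf_eq0 (negbTE h0) !andbF.
Qed.

Lemma Gmx_self h : Gmx i1 h = (- dot h c1)%:M.
Proof. exact: plane_proj_camera. Qed.

Lemma Gmx_mul i h x : Gmx i h *m x =
  dot h (pinvmx (C i) *m x) *: (C i1 *m center (C i)) -
  dot h (center (C i)) *: (C i1 *m (pinvmx (C i) *m x)).
Proof.
have -> : Gmx i h *m x = C i1 *m (plane_proj h (center (C i)) *m (pinvmx (C i) *m x)).
  by rewrite /Gmx !mulmxA.
by rewrite plane_projE mulmxBr -!scalemxAr.
Qed.

(** The point [w] of the plane seen at x can be mapped to 0 by the camera i1 only if it is a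
    multiple of c1; as c1 is not in the plane, [w] = 0, and camera i recovers x from [w]. *)
Lemma Gmx_inj i h (x : 'cV[F]_3) : dot h c1 != 0 -> dot h (center (C i)) != 0 ->
  Gmx i h *m x = 0 -> x = 0.
Proof.
move=> h1 hi; pose w := plane_proj h (center (C i)) *m (pinvmx (C i) *m x).
have -> : Gmx i h *m x = C i1 *m w by rewrite /Gmx /w !mulmxA.
move=> /(camera_ker (hC i1))[b wb].
have /eqP : dot h w = 0 by rewrite /w plane_projE dotDr dotNr !dotZr mulrC subrr.
rewrite wb dotZr mulf_eq0 (negbTE h1) orbF => /eqP b0.
have : C i *m w = 0 by rewrite wb b0 scale0r mulmx0.
have -> : C i *m w = C i *m plane_proj h (center (C i)) *m pinvmx (C i) *m x.
  by rewrite /w !mulmxA.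
rewrite plane_proj_camera // mul_scalar_mx => /eqP.
by rewrite scaler_eq0 oppr_eq0 (negbTE hi) => /eqP.
Qed.

Lemma Gmx_unit i h : dot h c1 != 0 -> dot h (center (C i)) != 0 -> Gmx i h \in unitmx.
Proof.
move=> h1 hi; rewrite -unitmx_tr -row_free_unit -kermx_eq0.
apply/eqP/row_matrixP => k; rewrite row0; apply: trmx_inj; rewrite trmx0.
apply: (Gmx_inj h1 hi); apply: trmx_inj; rewrite trmx_mul trmxK trmx0.
by apply/sub_kermxP/row_sub.
Qed.

Lemma theta_row_neq0 i h g : dot h c1 != 0 -> dot h (center (C i)) != 0 -> g != 0 ->
  row i (theta h g) != 0.
Proof.
move=> h1 hi /veval_neq0[y hy]; apply: (@neq0_veval _ _ _ _ (invmx (Gmx i h) *m y)).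
by rewrite row_theta veval_mulmx mulmxA mulmxV ?mul1mx //; apply: Gmx_unit.
Qed.

(** The epipole: the second center seen in the first view. *)
Let e := C i1 *m c2.

Lemma epipole_neq0 : e != 0.
Proof.
apply/eqP => /(camera_ker (hC i1))[b eb]; apply: c12.
have b0 : b != 0 by apply: contraNneq (center_neq0 (C i2)) => b0; rewrite -/c2 eb b0 scale0r.
by exists b^-1; rewrite ?invr_eq0 // -/c1 -/c2 eb scalerK.
Qed.

Definition Amx : 'M[F]_3 := C i1 *m pinvmx (C i2).

(** Plane and parallax: apart from the factor h . c2, a change of the plane moves the transferred
    point only along its line to the epipole. *)
Lemma Gmx2_mul h x :
  Gmx i2 h *m x = dot h (pinvmx (C i2) *m x) *: e - dot h c2 *: (Amx *m x).
Proof. by rewrite Gmx_mul /Amx -mulmxA. Qed.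

Lemma Amx_epipole (z : 'cV[F]_3) : exists x b, z = Amx *m x + b *: e.
Proof.
have [b eb] := camera_decomp (pinvmx (C i1) *m z) (hC i2).
exists (C i2 *m (pinvmx (C i1) *m z)), b.
rewrite -[LHS]mul1mx -(camera_pinvmx (hC i1)) -mulmxA {1}eb mulmxDr -scalemxAr.
by rewrite /Amx !mulmxA.
Qed.

Section Coordinates.
Variable Xi : 'M[F]_3.
Hypothesis Xiu : Xi \in unitmx.
Hypothesis Xie : Xi *m e = delta_mx 0 0.

Definition xi (k : nat) (y : 'cV[F]_3) : F := (Xi *m y) (inord k) 0.

Lemma xi_e k : (k < 3)%N -> xi k e = (k == 0%N)%:R.
Proof. by move=> lt; rewrite /xi Xie mxE -val_eqE /= inordK // andbT. Qed.

Lemma xiD k y z : xi k (y + z) = xi k y + xi k z.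
Proof. by rewrite /xi mulmxDr mxE. Qed.

Lemma xiZ k c y : xi k (c *: y) = c * xi k y.
Proof. by rewrite /xi -scalemxAr mxE. Qed.

Lemma isform_xi k m (B : 'M[F]_(3, m)) : isform 1 (fun y => xi k (B *m y)).
Proof.
apply: isform_ext (isform_lin (row (inord k) (Xi *m B))) => y.
by rewrite -row_mul mxE /xi mulmxA.
Qed.

(** [Amx] is surjective modulo the epipole, where xi 1 and xi 2 vanish. *)
Lemma xi_point (k : nat) : (k < 3)%N -> exists x, forall l, (0 < l < 3)%N ->
  xi l (Amx *m x) = (l == k)%:R.
Proof.
move=> k3; have [x [b exb]] := Amx_epipole (invmx Xi *m delta_mx (inord k) 0).
exists x => l /andP[l0 l3].
have : xi l (invmx Xi *m delta_mx (inord k) 0) = (l == k)%:R.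
  rewrite /xi mulmxA mulmxV // mul1mx mxE andbT -val_eqE /= !inordK //.
by rewrite exb xiD xiZ xi_e // eqn0Ngt l0 mulr0 addr0.
Qed.

(* The curve is linear in the coordinate along the epipole, and the coordinates
   xi 1 and xi 2 do not see the plane h: its transforms depend linearly on h. *)
Lemma base_curve : exists g : 'rV[F]_(nmon 3 d),
  g != 0 /\ forall y, veval g y = xi 0 y * xi 1 y ^+ d.-1 + xi 2 y ^+ d.
Proof.
have [|g hg] := @isform_row F d 3 (fun y => xi 0 y * xi 1 y ^+ d.-1 + xi 2 y ^+ d).
  have xi1 k : isform 1 (xi k).
    by apply: isform_ext (isform_xi k 1%:M) => y; rewrite mul1mx.
  apply: isformD; last by have := isformX d (xi1 2%N); rewrite mul1n.
  have := isformM (xi1 0%N) (isformX d.-1 (xi1 1%N)).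
  by rewrite mul1n add1n prednK // ltnW.
exists g; split => //; apply: (@neq0_veval _ _ _ _ (invmx Xi *m delta_mx (inord 2) 0)).
rewrite hg /xi mulmxA mulmxV // mul1mx !mxE -!val_eqE /= !inordK //.
by rewrite mul0r add0r expr1n oner_neq0.
Qed.

Definition Tval (h : 'cV[F]_4) (x : 'cV[F]_3) : F :=
  (dot h (pinvmx (C i2) *m x) - dot h c2 * xi 0 (Amx *m x)) * xi 1 (Amx *m x) ^+ d.-1
  - dot h c2 * xi 2 (Amx *m x) ^+ d.

Lemma veval_base_curve (g : 'rV[F]_(nmon 3 d)) h x :
  (forall y, veval g y = xi 0 y * xi 1 y ^+ d.-1 + xi 2 y ^+ d) ->
  veval (row i2 (theta h g)) x = (- dot h c2) ^+ d.-1 * Tval h x.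
Proof.
move=> hg; rewrite row_theta veval_mulmx hg Gmx2_mul !xiD -scaleNr !xiZ !xi_e //=.
rewrite /Tval mulr1 !mulr0 !add0r !exprMn.
have -> : (- dot h c2) ^+ d = (- dot h c2) ^+ d.-1 * - dot h c2.
  by rewrite -exprSr prednK // ltnW.
by ring.
Qed.

(** Where xi 1 = 0 and xi 2 = 1, only the last term survives, because d - 1 > 0; this gives h . c2 =
    0. Then h also vanishes on the image of [pinvmx (C i2)], since xi 1 is nonzero at generic
    points, and this image and c2 span the space. *)
Lemma Tval_eq0 h : (forall x, Tval h x = 0) -> h = 0.
Proof.
move=> T0.
have [x hx] := xi_point (ltnSn 2).
have hc0 : dot h c2 = 0.
  have := T0 x; rewrite /Tval (hx 1%N) // (hx 2%N) // expr1n expr0n.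
  have -> : (d.-1 == 0)%N = false by case: (d) hd => [|[]].
  rewrite mulr0 sub0r mulr1 => /eqP.
  by rewrite oppr_eq0 => /eqP.
have [y hy] := @xi_point 1 isT.
have p0 z : dot h (pinvmx (C i2) *m z) = 0.
  apply/eqP/negPn/negP => hz.
  pose f (v : 'rV[F]_3) := dot h (pinvmx (C i2) *m v^T).
  pose k (v : 'rV[F]_3) := xi 1 (Amx *m v^T).
  have lin m (u : 'rV[F]_3) (B : 'M[F]_(3, m)) : polyfun (fun v : 'rV[F]_3 => (u *m v^T) 0 0).
    apply: (@polyfun_ext _ _ (fun v : 'rV[F]_3 => \sum_j u 0 j * v 0 j)) => [v|].
      by rewrite mxE; apply: eq_bigr => j _; rewrite mxE.
    by apply: polyfun_sum => j _; apply: polyfunM; [exact: polyfun_cst | exact: polyfun_coord].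
  have hf : polyfun f.
    apply: polyfun_ext (lin 3 (h^T *m pinvmx (C i2)) 0) => v.
    by rewrite /f /dot -mulmxA.
  have hk : polyfun k.
    apply: polyfun_ext (lin 3 (row (inord 1) (Xi *m Amx)) 0) => v.
    by rewrite -row_mul mxE /k /xi !mulmxA.
  have [||v] := polyfun_generic2 (a := z^T) (b := y^T) hf hk.
  - by rewrite /f trmxK.
  - by rewrite /k trmxK hy //= oner_neq0.
  rewrite mulf_eq0 negb_or => /andP[fv kv].
  have := T0 v^T; rewrite /Tval hc0 !mul0r !subr0 => /eqP.
  by rewrite mulf_eq0 expf_eq0 (negbTE fv) (negbTE kv) andbF.
apply: dot_eq0 => q; have [b ->] := camera_decomp q (hC i2).
by rewrite dotDr dotZr p0 -/c2 hc0 mulr0 addr0.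
Qed.

Lemma Tval_matrix : exists T : 'M[F]_(4, nmon 3 d),
  row_free T /\ forall h x, veval (h^T *m T) x = Tval h x.
Proof.
have rowT (j : 'I_4) : exists r : 'rV[F]_(nmon 3 d), forall x, veval r x = Tval (delta_mx j 0) x.
  apply: isform_row; rewrite /Tval.
  have f1 (h p : 'cV[F]_4) : isform 1 (fun x => dot h (pinvmx (C i2) *m x)).
    by apply: isform_ext (isform_lin (h^T *m pinvmx (C i2))) => x; rewrite /dot -mulmxA.
  have fx k := isform_xi k Amx.
  apply: isformB; last by apply: isformZ; have := isformX d (fx 2%N); rewrite mul1n.
  have := isformM (isformB (f1 (delta_mx j 0) 0) (isformZ (dot (delta_mx j 0) c2) (fx 0%N)))
    (isformX d.-1 (fx 1%N)).
  by rewrite mul1n add1n prednK // ltnW.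
have [r hr] := fin_all_exists rowT.
pose T := \matrix_j r j; have hT h x : veval (h^T *m T) x = Tval h x.
  have -> : veval (h^T *m T) x = \sum_j h j 0 * veval (r j) x.
    rewrite mulmx_sum_row /veval mulmx_suml summxE; apply: eq_bigr => j _.
    by rewrite rowK -scalemxAl !mxE.
  rewrite (eq_bigr (fun j => h j 0 * Tval (delta_mx j 0) x)) => [|j _]; last by rewrite hr.
  have dd j p : dot (delta_mx j 0) p = p j 0 by rewrite /dot trmx_delta -rowE mxE.
  have ds p : dot h p = \sum_j h j 0 * p j 0.
    by rewrite /dot mxE; apply: eq_bigr => j _; rewrite mxE.
  rewrite sum4 /Tval !dd !ds !sum4; ring.
exists T; split => //; rewrite -kermx_eq0.
apply/eqP/row_matrixP => k; rewrite row0; apply: trmx_inj; rewrite trmx0.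
apply: Tval_eq0 => x; rewrite -hT trmxK.
by have /sub_kermxP-> := row_sub k (kermx T); rewrite veval0.
Qed.

End Coordinates.

Lemma generic_plane : exists h, forall i, dot h (center (C i)) != 0.
Proof.
have hp i : polyfun (fun v : 'rV[F]_4 => dot v^T (center (C i))).
  apply: (@polyfun_ext _ _ (fun v : 'rV[F]_4 => \sum_j v 0 j * center (C i) j 0)).
    by move=> v; rewrite /dot trmxK mxE.
  by apply: polyfun_sum => j _; apply: polyfunM; [exact: polyfun_coord|exact: polyfun_cst].
have nz i : exists v : 'rV[F]_4, dot v^T (center (C i)) != 0.
  apply: contrapT => nv; case/eqP: (center_neq0 (C i)); apply/colP => j; rewrite [RHS]mxE.
  apply/eqP/negPn/negP => h; apply: nv; exists (delta_mx 0 j).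
  by rewrite /dot trmxK -rowE mxE.
have [v hv] := polyfun_generic (index_enum _) hp nz; exists v^T => i.
by move: hv; rewrite prodf_seq_neq0 => /allP/(_ i); apply; rewrite mem_index_enum.
Qed.

Definition single (k : nat) (t : F) : 'rV[F]_D := \row_(j < D) (if (j : nat) == k then t else 0).

Lemma co_single k t j : (k < D)%N -> co (single k t) j = if j == k then t else 0.
Proof.
move=> kD; have [jD|Dj] := ltnP j D.
  exact: (co_row (fun j => if j == k then t else 0)).
rewrite /co insubF ?ltnNge ?Dj //; case: eqP => // ej.
by rewrite ej leqNgt kD in Dj.
Qed.

Lemma hvec_eq (a b : 'rV[F]_D) :
  (forall j, (j < 3)%N -> co a j = co b j) -> hvec a = hvec b.
Proof.
move=> ab; apply/colP => -[[|j] lt]; rewrite !mxE //=.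
exact: ab.
Qed.

Lemma avec_eq (a b : 'rV[F]_D) :
  (forall j, (3 <= j)%N -> co a j = co b j) -> avec a = avec b.
Proof.
move=> ab; apply/rowP => -[[|j] lt]; rewrite !mxE //=.
by apply: ab; rewrite addn3.
Qed.

Lemma hvec0 : hvec (0 : 'rV[F]_D) = delta_mx 0 0.
Proof. by apply/colP => -[[|j] lt]; rewrite !mxE //= co0. Qed.

Lemma avec0 : avec (0 : 'rV[F]_D) = delta_mx 0 k0.
Proof. by apply/rowP => -[[|j] lt]; rewrite !mxE ?eqxx //= co0. Qed.

Lemma plane_curve_mv_chain : exists Z, irred_chain (plane_curve_mv d C) D Z.
Proof.
have [hs hhs] := generic_plane.
have [Xi Xiu Xie] : exists2 Xi : 'M[F]_3, Xi \in unitmx & Xi *m e = delta_mx 0 0.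
  have eT0 : e^T != 0 by rewrite -trmx0 (inj_eq trmx_inj) epipole_neq0.
  have [Q Qu Qe] := complete_basis (k0 := 0) erefl eT0.
  exists (invmx Q^T); first by rewrite unitmx_inv unitmx_tr.
  by rewrite -[e]trmxK -Qe rowE trmx_mul mulKmx ?unitmx_tr // trmx_delta.
have [g0 [g0n hg0]] := base_curve Xiu.
have [T [Tf hT]] := Tval_matrix Xiu Xie.
have hsT0 : hs^T != 0.
  rewrite -trmx0 (inj_eq trmx_inj); apply: contraNneq (hhs i1) => ->.
  by rewrite /dot trmx0 mul0mx mxE.
have [Qh Qhu Qhe] := complete_basis (k0 := 0) erefl hsT0.
have [Qg Qgu Qge] := complete_basis (k0 := k0) erefl g0n.
(* Affine coordinates with origin at [hs] and [g0]: these are the first rows of [Qh] and [Qg], and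
   [hvec], [avec] have first entry 1. *)
pose hh (a : 'rV[F]_D) := Qh^T *m hvec a; pose gam a := avec a *m Qg.
have hh0 : hh 0 = hs by rewrite /hh hvec0 -trmx_delta -trmx_mul -rowE Qhe trmxK.
have gam0 : gam 0 = g0 by rewrite /gam avec0 -rowE.
pose f a := theta (hh a) (gam a).
have i2f a : (forall j, (3 <= j)%N -> co a j = 0) ->
    row i2 (f a) = (- dot (hh a) c2) ^+ d.-1 *: ((hh a)^T *m T).
  move=> aj; apply: veval_inj => x; rewrite vevalZ hT /f (_ : gam a = g0).
    exact: (veval_base_curve Xie).
  by rewrite -gam0 /gam (@avec_eq a 0) // => j /aj->; rewrite co0.
have i1f a : row i1 (f a) = (- dot (hh a) c1) ^+ d *: gam a.
  apply: veval_inj => x; rewrite row_theta veval_mulmx Gmx_self mul_scalar_mx.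
  by rewrite veval_scale vevalZ.
have pm : polymap f.
  apply: polymap_theta => i j.
    by apply: polyfun_mulmx => i' j'; [exact: polyfun_cst|exact: polyfun_hvec].
  by apply: polyfun_mulmx => i' j'; [exact: polyfun_avec|exact: polyfun_cst].
apply: (chain_of_flag pm).
- by rewrite plane_curve_mvE //; apply/zclosed_closure/zimage_mpoints.
- by move=> a; apply: theta_mv.
- by move=> i; rewrite /f hh0 gam0; apply: theta_row_neq0 => //; apply: hhs.
move=> k kD; have [k3|k3] := ltnP k 3.
  (* As long as [gam a] = [g0], the second image is a multiple of the image of h under [T]. [A]
     undoes [T] and [Qh]; entry k + 1 is then coordinate k, after the constant entry 1. *)
  pose A := pinvmx T *m (invmx Qh^T)^T.
  have val a : (forall j, (3 <= j)%N -> co a j = 0) ->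
      (row i2 (f a) *m A) 0 (inord k.+1) = (- dot (hh a) c2) ^+ d.-1 * co a k.
    move=> aj; rewrite i2f // /A mulmxA -!scalemxAl -[_ *m T *m _]mulmxA mulmxVp //.
    rewrite mulmx1 /hh -trmx_mul mulKmx ?unitmx_tr // mxE; congr (_ * _).
    by rewrite !mxE inordK.
  exists (fun i' => (i' == i2) : nat), (fun P => (row i2 P *m A) 0 (inord k.+1)); split.
  - exact: mhfun_row_lin.
  - move=> a /co_vanish aj; rewrite val ?aj ?mulr0 // => j k3j.
    by apply: aj; rewrite (leq_trans _ k3j) // ltnW.
  (* The factor h . c2 is affine in t and nonzero at t = 0, so it cannot vanish at both 1 and -1. *)
  have [t t0 ht] : exists2 t : F, t != 0 & dot (hh (single k t)) c2 != 0.
    have lin t : dot (hh (single k t)) c2 = dot hs c2 + t * dot (Qh^T *m delta_mx (inord k.+1) 0) c2.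
      rewrite -hh0 -dotZl -dotDl; congr (dot _ _).
      rewrite /hh scalemxAr -mulmxDr; congr (_ *m _); apply/colP => -[[|j] lt].
        by rewrite !mxE /= -val_eqE /= inordK // mulr0 addr0.
      rewrite !mxE /= co0 add0r co_single // -val_eqE /= inordK // eqSS andbT.
      by case: eqP; rewrite ?mulr1 ?mulr0.
    have [e1|] := eqVneq (dot (hh (single k 1)) c2) 0; last by exists 1; rewrite ?oner_neq0.
    exists (-1); first by rewrite oppr_eq0 oner_neq0.
    have -> : dot (hh (single k (-1))) c2 = dot hs c2 *+ 2.
      by rewrite -[LHS]subr0 -[X in _ - X = _]oppr0 -e1 !lin; ring.
    by rewrite mulrn_eq0 /= hhs.
  exists (single k t) => [j kj|]; first by rewrite mxE gtn_eqF.
  rewrite val => [|j k3j]; last first.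
    by rewrite co_single //; case: eqP => // ej; rewrite ej leqNgt k3 in k3j.
  by rewrite co_single // eqxx mulf_neq0 // expf_neq0 // oppr_eq0.
(* Coordinates 0, 1, 2 belong to h and entry 0 of [avec] is the constant 1, hence coordinate k sits
   at entry k - 2. *)
have k1 : (k - 2 < nmon 3 d)%N.
  by rewrite nmon3 ltnS leq_subLR addnC -ltnS -addnS.
pose A := invmx Qg; pose kk := Ordinal k1.
have val a : (row i1 (f a) *m A) 0 kk = (- dot (hh a) c1) ^+ d * co a k.
  rewrite i1f -scalemxAl /gam mulmxK // mxE; congr (_ * _); rewrite mxE /=.
  have -> : (k - 2 = (k - 3).+1)%N by rewrite -subSn // subSS.
  by rewrite subnK.
exists (fun i' => (i' == i1) : nat), (fun P => (row i1 P *m A) 0 kk); split.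
- exact: mhfun_row_lin.
- by move=> a /co_vanish aj; rewrite val aj ?mulr0.
exists (single k 1) => [j kj|]; first by rewrite mxE gtn_eqF.
rewrite val co_single // eqxx mulr1 expf_neq0 // oppr_eq0.
rewrite (_ : hh _ = hs) ?hhs // -hh0 /hh (@hvec_eq _ 0) // => j j3.
by rewrite co0 co_single // ltn_eqF // (leq_trans j3).
Qed.

End PlaneChain.

(** * Chow forms of twisted cubics *)

Section BinaryCubics.
Local Open Scope ring_scope.
Variable F : numFieldType.
Implicit Types (u v : 'rV[F]_4) (W : 'M[F]_4) (L : 'cV[F]_6).

Definition cubval u (s t : F) : F := (u *m std_twisted_cubic s t) 0 0.

Lemma cubvalE u s t : cubval u s t = u 0 (inord 0) * s ^+ 3 +
  u 0 (inord 1) * (s ^+ 2 * t) + u 0 (inord 2) * (s * t ^+ 2) + u 0 (inord 3) * t ^+ 3.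
Proof. by rewrite /cubval mxE sum4 !mxE !inordK //= !expr0 !expr1 !mulr1 !mul1r. Qed.

Definition row4 (a b c d : F) : 'rV[F]_4 := \row_j nth 0 [:: a; b; c; d] j.

Lemma row4E a b c d :
  (row4 a b c d 0 (inord 0) = a) * (row4 a b c d 0 (inord 1) = b) *
  (row4 a b c d 0 (inord 2) = c) * (row4 a b c d 0 (inord 3) = d).
Proof. by do !split; rewrite mxE inordK. Qed.

Lemma row4P u : u = row4 (u 0 (inord 0)) (u 0 (inord 1)) (u 0 (inord 2)) (u 0 (inord 3)).
Proof. by apply/rowP => j; rewrite mxE; case: (ord4 j) => ->; rewrite inordK. Qed.

(** A pair p stands for the linear form p.1 s + p.2 t, with root (p.2 : - p.1). *)
Definition factored (p q r : F * F) : 'rV[F]_4 :=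
  row4 (p.1 * q.1 * r.1) (p.1 * q.1 * r.2 + p.1 * q.2 * r.1 + p.2 * q.1 * r.1)
       (p.1 * q.2 * r.2 + p.2 * q.1 * r.2 + p.2 * q.2 * r.1) (p.2 * q.2 * r.2).

Lemma cubval_factored p q r s t : cubval (factored p q r) s t =
  (p.1 * s + p.2 * t) * (q.1 * s + q.2 * t) * (r.1 * s + r.2 * t).
Proof. rewrite cubvalE; rewrite !row4E; ring. Qed.

Definition wedge u v : 'M[F]_4 := u^T *m v - v^T *m u.

Lemma wedgeE u v i j : wedge u v i j = u 0 i * v 0 j - v 0 i * u 0 j.
Proof. by rewrite !mxE !big_ord1 !mxE. Qed.

(* Determinant of the Bezout matrix of two binary cubics with wedge product W. *)
Definition bez W : F :=
  let w i j := W (inord i) (inord j) in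
  w 0 1 * (w 0 3 + w 1 2) * w 2 3 - w 0 1 * w 1 3 ^+ 2 - w 0 2 ^+ 2 * w 2 3
  + w 0 2 * w 1 3 * w 0 3 *+ 2 - (w 0 3 + w 1 2) * w 0 3 ^+ 2.

Lemma bezZ c W : bez (c *: W) = c ^+ 3 * bez W.
Proof. rewrite /bez !mxE; ring. Qed.

(** The product formula for the resultant. It turns all later statements about [bez] into statements
    about the values of v at the roots of u. *)
Lemma bez_factored p q r v : bez (wedge (factored p q r) v) =
  cubval v p.2 (- p.1) * cubval v q.2 (- q.1) * cubval v r.2 (- r.1).
Proof.
rewrite /bez !wedgeE !cubvalE; rewrite !row4E; ring.
Qed.

Lemma wedgeC u v : wedge v u = - wedge u v.
Proof. by rewrite /wedge opprB. Qed.

Lemma bezN W : bez (- W) = - bez W.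
Proof. by rewrite -scaleN1r bezZ exprS sqrrN expr1n mulr1 mulN1r. Qed.

Lemma wedge_mulmx u v (M : 'M[F]_4) : wedge (u *m M) (v *m M) = M^T *m wedge u v *m M.
Proof. by rewrite /wedge !trmx_mul mulmxBr mulmxBl !mulmxA. Qed.

(* The antisymmetric matrix of the dual Pluecker coordinates of L: for a line L
   which is the intersection of the planes u and v it is a multiple of wedge u v. *)
Definition dualmx L : 'M[F]_4 :=
  let l := hcoord L in
  mx_of_rows 4 4
    [:: [:: 0; l 5; - l 4; l 3];
        [:: - l 5; 0; l 2; - l 1];
        [:: l 4; - l 2; 0; l 0];
        [:: - l 3; l 1; - l 0; 0]].

(** The Pluecker coordinates of the intersection of the planes u and v. *)
Definition dualpl u v : 'cV[F]_6 :=
  let w i j := wedge u v (inord i) (inord j) in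
  \col_k nth 0 [:: w 2 3; - w 1 3; w 1 2; w 0 3; - w 0 2; w 0 1] k.

Lemma matrix4P (A B : 'M[F]_4) :
  (forall i j, (i < 4)%N -> (j < 4)%N -> A (inord i) (inord j) = B (inord i) (inord j)) ->
  A = B.
Proof.
move=> AB; apply/matrixP => k l; rewrite -[k]inord_val -[l]inord_val.
exact: AB.
Qed.

Lemma dualmx_dualpl u v : dualmx (dualpl u v) = wedge u v.
Proof.
have e k : (k < 6)%N -> hcoord (dualpl u v) k = let w i j := wedge u v (inord i) (inord j) in
    nth 0 [:: w 2 3; - w 1 3; w 1 2; w 0 3; - w 0 2; w 0 1] k.
  by move=> lt; rewrite /hcoord mxE inordK.
apply: matrix4P => i j; rewrite mxE => i4 j4; rewrite !inordK // !e //.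
case: i i4 => [|[|[|[|//]]]] _; case: j j4 => [|[|[|[|//]]]] _; rewrite /= !wedgeE; ring.
Qed.

(** The determinant of the four columns, in its Laplace expansion by 2 x 2 minors; [bracket_mulmx]
    is multiplicativity. *)
Definition bracket (p q x y : 'cV[F]_4) : F := (x^T *m dualmx (plucker p q) *m y) 0 0.

Lemma hcoord_plucker (p q : 'cV[F]_4) k : (k < 6)%N -> hcoord (plucker p q) k =
  let w i j := hcoord p i * hcoord q j - hcoord p j * hcoord q i in
  nth 0 [:: w 0%N 1%N; w 0%N 2%N; w 0%N 3%N; w 1%N 2%N; w 1%N 3%N; w 2%N 3%N] k.
Proof. by move=> lt; rewrite /hcoord mxE inordK. Qed.

Lemma bracketE p q x y : bracket p q x y =
  let w (a b : 'cV[F]_4) i j := hcoord a i * hcoord b j - hcoord a j * hcoord b i in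
  w p q 2 3 * w x y 0 1 - w p q 1 3 * w x y 0 2 + w p q 1 2 * w x y 0 3
  + w p q 0 3 * w x y 1 2 - w p q 0 2 * w x y 1 3 + w p q 0 1 * w x y 2 3.
Proof.
rewrite /bracket mxE sum4 ![(_ *m dualmx _) _ _]mxE !sum4 ![dualmx _ _ _]mxE !inordK //=.
by rewrite !hcoord_plucker //= ![x^T _ _]mxE /hcoord; ring.
Qed.

Lemma bracket_mulmx (P : 'M[F]_4) p q x y :
  bracket (P *m p) (P *m q) (P *m x) (P *m y) =
  bracket (col (inord 0) P) (col (inord 1) P) (col (inord 2) P) (col (inord 3) P) *
  bracket p q x y.
Proof.
have h (z : 'cV[F]_4) i : hcoord (P *m z) i = P (inord i) (inord 0) * hcoord z 0 +
    P (inord i) (inord 1) * hcoord z 1 + P (inord i) (inord 2) * hcoord z 2 +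
    P (inord i) (inord 3) * hcoord z 3 by rewrite /hcoord mxE sum4.
have c i j : hcoord (col j P) i = P (inord i) j by rewrite /hcoord mxE.
rewrite !bracketE /= !h !c; ring.
Qed.

End BinaryCubics.

(** * The Chow form of a parametrized twisted cubic *)

Section ChowForm.
Local Open Scope ring_scope.
Variable F : numFieldType.
Implicit Types (M P : 'M[F]_4) (L : 'cV[F]_6) (p q x y : 'cV[F]_4).

(** For the intersection of the planes u and v this is, up to a factor, the resultant of the binary
    cubics that u and v cut out on the curve. The formula is polynomial in M and L and also makes
    sense for singular M. *)
Definition chow M L : F := bez (M^T *m dualmx L *m M).

Definition unit4 (k : nat) : 'cV[F]_4 := delta_mx (inord k) 0.

Definition vol P : F :=
  bracket (col (inord 0) P) (col (inord 1) P) (col (inord 2) P) (col (inord 3) P).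

Lemma hcoord_unit4 k j : (k < 4)%N -> (j < 4)%N -> hcoord (unit4 k) j = (j == k)%:R.
Proof. by move=> k4 j4; rewrite /hcoord mxE andbT -val_eqE /= !inordK. Qed.

Lemma col_unit4 k P : col (inord k) P = P *m unit4 k.
Proof. exact: colE. Qed.

Lemma bracket_basis : bracket (unit4 0) (unit4 1) (unit4 2) (unit4 3) = 1.
Proof. by rewrite bracketE /= !hcoord_unit4 //=; ring. Qed.

Lemma bracket_vol P p q x y :
  bracket (P *m p) (P *m q) (P *m x) (P *m y) = vol P * bracket p q x y.
Proof. exact: bracket_mulmx. Qed.

Lemma vol_unit P : P \in unitmx -> vol P != 0.
Proof.
move=> uP; have := bracket_vol P (invmx P *m unit4 0) (invmx P *m unit4 1)
  (invmx P *m unit4 2) (invmx P *m unit4 3).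
rewrite !mulKVmx // bracket_basis => e; apply: contra_eq_neq e => ->.
by rewrite mul0r oner_neq0.
Qed.

(** The entries of both sides are brackets, so this is multiplicativity of the determinant. *)
Lemma dualmx_conj P x y :
  P^T *m dualmx (plucker (P *m x) (P *m y)) *m P = vol P *: dualmx (plucker x y).
Proof.
have entry (A : 'M[F]_4) k l : A k l = ((delta_mx k 0 : 'cV[F]_4)^T *m A *m (delta_mx l 0 : 'cV[F]_4)) 0 0.
  by rewrite trmx_delta -rowE -colE !mxE.
apply/matrixP => k l; rewrite entry [RHS]mxE [dualmx _ k l]entry.
rewrite -[X in _ * X]/(bracket x y (delta_mx k 0) (delta_mx l 0)) -bracket_vol.
by rewrite /bracket trmx_mul !mulmxA.
Qed.

Lemma chow_mulmx P M x y :
  chow (P *m M) (plucker (P *m x) (P *m y)) = vol P ^+ 3 * chow M (plucker x y).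
Proof.
rewrite /chow -bezZ; congr bez; rewrite trmx_mul.
have -> : M^T *m P^T *m dualmx (plucker (P *m x) (P *m y)) *m (P *m M) =
    M^T *m (P^T *m dualmx (plucker (P *m x) (P *m y)) *m P) *m M by rewrite !mulmxA.
by rewrite dualmx_conj -scalemxAr -scalemxAl.
Qed.

Lemma chow_dualpl M (u v : 'rV[F]_4) : chow M (dualpl u v) = bez (wedge (u *m M) (v *m M)).
Proof. by rewrite /chow dualmx_dualpl wedge_mulmx. Qed.

Lemma plucker_unit4 : plucker (unit4 0) (unit4 1) = dualpl (unit4 2)^T (unit4 3)^T.
Proof.
apply/colP => k; rewrite mxE [RHS]mxE /= !wedgeE ![_^T _ _]mxE.
have e i j : unit4 i (inord j) 0 = hcoord (unit4 i) j by [].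
rewrite !e !hcoord_unit4 //=.
by case: k => -[|[|[|[|[|[|//]]]]]] ? /=; ring.
Qed.

Lemma row_unit4 k M : (unit4 k)^T *m M = row (inord k) M.
Proof. by rewrite rowE /unit4 trmx_delta. Qed.

Lemma chow_adapted P M : P \in unitmx ->
  chow M (plucker (P *m unit4 0) (P *m unit4 1)) = vol P ^+ 3 *
  bez (wedge (row (inord 2) (invmx P *m M)) (row (inord 3) (invmx P *m M))).
Proof.
move=> uP; rewrite -{1}(mulKVmx uP M) chow_mulmx plucker_unit4 chow_dualpl.
by rewrite !row_unit4.
Qed.

Lemma complete_pair p q : \rank (row_mx p q) = 2%N ->
  exists2 P, P \in unitmx & p = P *m unit4 0 /\ q = P *m unit4 1.
Proof.
move=> r2; pose A : 'M[F]_(2, 2 + 2) := (row_mx p q)^T.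
have rA : \rank A = 2%N by rewrite mxrank_tr.
pose Q : 'M[F]_(2 + 2) := block_mx (col_ebase A) 0 0 1%:M *m row_ebase A.
have uQ : Q \in unitmx.
  rewrite unitmx_mul row_ebase_unit andbT unitmxE det_ublock det1 mulr1 -unitmxE.
  exact: col_ebase_unit.
have eA : usubmx Q = A.
  rewrite -[RHS]mulmx_ebase rA -mul_usub_mx block_mxEv col_mxKu; congr (_ *m _).
  have -> : pid_mx 2 = row_mx 1%:M 0 :> 'M[F]_(2, 2 + 2).
    exact: pid_mx_row.
  by rewrite mul_mx_row mulmx1 mulmx0.
exists Q^T; first by rewrite unitmx_tr.
have QE k l : (k < 2)%N -> (Q^T *m unit4 k) l 0 = A (inord k) l.
  move=> k2; rewrite -col_unit4 mxE [Q^T _ _]mxE -eA [RHS]mxE; congr (Q _ _).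
  by apply: val_inj; rewrite /= !inordK // (ltn_trans k2).
split; apply/colP => l; rewrite QE // /A [_^T _ _]mxE.
  have -> : (inord 0 : 'I_2) = lshift 1 (0 : 'I_1) by apply: val_inj; rewrite /= inordK.
  exact: esym (row_mxEl p q l 0).
have -> : (inord 1 : 'I_2) = rshift 1 (0 : 'I_1) by apply: val_inj; rewrite /= inordK.
exact: esym (row_mxEr p q l 0).
Qed.

Lemma bez_unit : bez (wedge (unit4 0)^T (unit4 3)^T) = -1.
Proof.
have e i j : unit4 i (inord j) 0 = hcoord (unit4 i) j by [].
by rewrite /bez !wedgeE ![_^T _ _]mxE !e !hcoord_unit4 //=; ring.
Qed.

Lemma dualmxZ c L : dualmx (c *: L) = c *: dualmx L.
Proof.
apply: matrix4P => i j i4 j4; rewrite !mxE !inordK // /hcoord !mxE.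
case: i i4 => [|[|[|[|//]]]] _; case: j j4 => [|[|[|[|//]]]] _ /=; ring.
Qed.

Lemma dualmxD L L' : dualmx (L + L') = dualmx L + dualmx L'.
Proof.
apply: matrix4P => i j i4 j4; rewrite !mxE !inordK // /hcoord !mxE.
case: i i4 => [|[|[|[|//]]]] _; case: j j4 => [|[|[|[|//]]]] _ /=; ring.
Qed.

Definition upper (A : 'M[F]_4) : 'cV[F]_6 :=
  let w i j := A (inord i) (inord j) in
  \col_k nth 0 [:: w 0 1; w 0 2; w 0 3; w 1 2; w 1 3; w 2 3]%N k.

(** [bez] reads only the six entries above the diagonal, and these are linear in L. It is thus a
    cubic form that can be pulled back to a coefficient row on Pluecker space. *)
Definition bezpoly : {mpoly F[6]} :=
  let w k := 'X_(inord k : 'I_6) in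
  w 0%N * (w 2%N + w 3%N) * w 5%N - w 0%N * w 4%N ^+ 2 - w 1%N ^+ 2 * w 5%N
  + w 1%N * w 4%N * w 2%N *+ 2 - (w 2%N + w 3%N) * w 2%N ^+ 2.

Lemma bezpoly_homog : bezpoly \is 3.-homog.
Proof.
have hw k : ('X_(inord k : 'I_6) : {mpoly F[6]}) \is 1.-homog by rewrite dhomogX /= mdeg1.
have h2 k : ('X_(inord k : 'I_6) : {mpoly F[6]}) ^+ 2 \is 2.-homog by exact: (dhomogMn 2 (hw k)).
have h11 k l : ('X_(inord k : 'I_6) : {mpoly F[6]}) * 'X_(inord l : 'I_6) \is 2.-homog.
  exact: (dhomogM (hw k) (hw l)).
have hD k l : ('X_(inord k : 'I_6) : {mpoly F[6]}) + 'X_(inord l : 'I_6) \is 1.-homog.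
  exact: rpredD (hw k) (hw l).
rewrite /bezpoly; apply: rpredB; last exact: (dhomogM (hD _ _) (h2 _)).
apply: rpredD; last by apply: rpredMn; exact: (dhomogM (h11 _ _) (hw _)).
apply: rpredB; last exact: (dhomogM (h2 _) (hw _)).
apply: rpredB; last exact: (dhomogM (hw _) (h2 _)).
exact: (dhomogM (dhomogM (hw _) (hD _ _)) (hw _)).
Qed.

Lemma bezpoly_upper A : bezpoly.@[fun j => upper A j 0] = bez A.
Proof.
have uE k : (k < 6)%N -> upper A (inord k) 0 = let w i j := A (inord i) (inord j) in
    nth 0 [:: w 0 1; w 0 2; w 0 3; w 1 2; w 1 3; w 2 3]%N k by move=> ?; rewrite mxE inordK.
by rewrite /bezpoly /bez !(mevalD, mevalN, mevalM, rmorphXn, rmorphMn) /= !mevalXU !uE.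
Qed.

Definition Wmx M : 'M[F]_6 :=
  \matrix_(k, l) upper (M^T *m dualmx (delta_mx l 0) *m M) k 0.

Lemma Wmx_mul M L : Wmx M *m L = upper (M^T *m dualmx L *m M).
Proof.
have uD A B : upper (A + B) = upper A + upper B.
  by apply/colP => k; rewrite !mxE; case: k => -[|[|[|[|[|[|//]]]]]] ?.
have uZ c A : upper (c *: A) = c *: upper A.
  by apply/colP => k; rewrite !mxE; case: k => -[|[|[|[|[|[|//]]]]]] ?.
pose g L := upper (M^T *m dualmx L *m M).
have gD : {morph g : x y / x + y} by move=> x y; rewrite /g dualmxD mulmxDr mulmxDl uD.
have gZ c K : g (c *: K) = c *: g K by rewrite /g dualmxZ -scalemxAr -scalemxAl uZ.
have g0 : g 0 = 0 by rewrite -[X in g X](scale0r 0) gZ scale0r.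
rewrite -/(g L) {2}(matrix_sum_delta L) (big_morph g gD g0).
apply/colP => k; rewrite mxE summxE; apply: eq_bigr => l _.
by rewrite big_ord1 gZ !mxE mulrC.
Qed.

Definition chowrow M : 'rV[F]_(nmon 6 3) := coefrow 3 bezpoly *m veronese_mx 3 (Wmx M).

Lemma veval_chowrow M L : veval (chowrow M) L = chow M L.
Proof. by rewrite veval_mulmx veval_coefrow ?bezpoly_homog // Wmx_mul bezpoly_upper. Qed.

Lemma polyfun_chowrow k (M : 'rV[F]_k -> 'M[F]_4) :
  (forall i j, polyfun (fun a => M a i j)) -> forall i j, polyfun (fun a => chowrow (M a) i j).
Proof.
move=> hM; apply: polyfun_mulmx => [i j|]; first exact: polyfun_cst.
apply: polyfun_veronese_mx => i j.
have hW i' j' : polyfun (fun a => ((M a)^T *m dualmx (delta_mx j 0) *m M a) i' j').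
  apply: polyfun_mulmx => // i1 j1; apply: polyfun_mulmx => i2 j2; last exact: polyfun_cst.
  by apply: polyfun_ext (hM j2 i2) => a; rewrite mxE.
apply: (@polyfun_ext _ _ (fun a => upper ((M a)^T *m dualmx (delta_mx j 0) *m M a) i 0)).
  by move=> a; rewrite [RHS]mxE.
apply: (polyfun_ext (fun a => esym (mxE _ _ _ _))).
by case: i => -[|[|[|[|[|[|//]]]]]] ? /=; apply: hW.
Qed.

End ChowForm.

(** * Lines as intersections of two planes *)

Section DualLines.
Local Open Scope ring_scope.
Variable F : numFieldType.
Implicit Types (L : 'cV[F]_6) (u v : 'rV[F]_4) (p q : 'cV[F]_4) (P : 'M[F]_4).

Lemma dualmx_inj : injective (@dualmx F).
Proof.
move=> L L' e; apply/colP => k.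
have e' i j : dualmx L (inord i) (inord j) = dualmx L' (inord i) (inord j) by rewrite e.
have := (e' 0 1, e' 0 2, e' 0 3, e' 1 2, e' 1 3, e' 2 3)%N.
rewrite !mxE !inordK //= => -[[[[[e5 /oppr_inj e4] e3] e2] /oppr_inj e1] e0].
rewrite -[k]inord_val.
by case: k => -[|[|[|[|[|[|//]]]]]] ?.
Qed.

Lemma dualplZl c u v : dualpl (c *: u) v = c *: dualpl u v.
Proof.
apply: dualmx_inj; rewrite dualmxZ !dualmx_dualpl /wedge linearZ /= -!scalemxAl -scalemxAr.
by rewrite scalerBr.
Qed.

Lemma dualplDl u u' v : dualpl (u + u') v = dualpl u v + dualpl u' v.
Proof.
apply: dualmx_inj; rewrite dualmxD !dualmx_dualpl /wedge linearD /= !mulmxDl mulmxDr.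
by rewrite opprD addrACA.
Qed.

Lemma dualplC u v : dualpl v u = - dualpl u v.
Proof. by apply: dualmx_inj; rewrite -scaleN1r dualmxZ scaleN1r !dualmx_dualpl wedgeC. Qed.

Lemma plucker_adapted P : P \in unitmx -> plucker (P *m unit4 F 0) (P *m unit4 F 1) =
  vol P *: dualpl ((unit4 F 2)^T *m invmx P) ((unit4 F 3)^T *m invmx P).
Proof.
move=> uP; apply: dualmx_inj; rewrite dualmxZ dualmx_dualpl wedge_mulmx.
rewrite -(dualmx_dualpl (unit4 F 2)^T) -plucker_unit4.
have := dualmx_conj P (unit4 F 0) (unit4 F 1).
move/(congr1 (fun A => (invmx P)^T *m A *m invmx P)).
rewrite -scalemxAr -scalemxAl => <-; rewrite -!mulmxA mulmxV // mulmx1 mulmxA.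
by rewrite -trmx_mul mulmxV // trmx1 mul1mx.
Qed.

Lemma rank_adapted P : P \in unitmx -> \rank (row_mx (P *m unit4 F 0) (P *m unit4 F 1)) = 2%N.
Proof.
move=> uP; rewrite -mul_mx_row -mxrank_tr trmx_mul mxrankMfree; last first.
  by rewrite row_free_unit unitmx_tr.
apply/eqP; rewrite -/(row_free _); apply/row_freeP; exists (row_mx (unit4 F 0) (unit4 F 1)).
have ne : (inord 0 == inord 1 :> 'I_4) = false by rewrite -val_eqE /= !inordK.
rewrite tr_row_mx mul_col_row /unit4 !trmx_delta !mul_delta_mx_cond !eqxx ne eq_sym ne.
by rewrite !mulr1n mulr0n scalar_mx_block; congr block_mx; apply/matrixP => i j;
  rewrite !ord1 !mxE.
Qed.

Lemma wedge_rank u v : wedge u v != 0 -> \rank (row_mx u^T v^T) = 2%N.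
Proof.
move=> w0; rewrite -mxrank_tr tr_row_mx !trmxK; apply/eqP; rewrite -/(row_free _).
rewrite -kermx_eq0; apply: contraNT w0 => /rowV0Pn[w /sub_kermxP].
pose a := lsubmx w 0 0; pose b := rsubmx w 0 0.
have ew : w = row_mx a%:M b%:M by rewrite -!mx11_scalar hsubmxK.
rewrite ew mul_row_col !mul_scalar_mx => e wn.
have [a0|a0] := eqVneq a 0.
  have b0 : b != 0 by apply: contraNneq wn => b0; rewrite a0 b0 !raddf0 row_mx0.
  move/eqP: e; rewrite a0 scale0r add0r scaler_eq0 (negbTE b0) /= => /eqP->.
  by rewrite /wedge trmx0 mulmx0 mul0mx subrr.
have -> : u = (- a^-1 * b) *: v.
  apply: (scalerI a0); rewrite scalerA mulrA mulrN mulfV // mulN1r scaleNr.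
  by apply/eqP; rewrite -addr_eq0 e.
by rewrite /wedge linearZ /= -scalemxAl -scalemxAr subrr.
Qed.

Lemma dualpl_line u v : wedge u v != 0 -> exists2 P, P \in unitmx &
  u = (unit4 F 2)^T *m invmx P /\ v = (unit4 F 3)^T *m invmx P.
Proof.
move=> /wedge_rank/complete_pair[P uP [eu ev]].
(* [S] exchanges the first two basis vectors with the last two. *)
pose S : 'M[F]_4 := \matrix_(i, j) ((i : nat) == ((j + 2) %% 4)%N)%:R.
have SS : S *m S = 1%:M.
  apply: matrix4P => i j i4 j4; rewrite !mxE sum4 !mxE -val_eqE /= !inordK //.
  by case: i i4 => [|[|[|[|//]]]] _; case: j j4 => [|[|[|[|//]]]] _ /=; ring.
have uS : S \in unitmx by case/mulmx1_unit: SS.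
have Se k l : (k < 4)%N -> (l < 4)%N -> k = ((l + 2) %% 4)%N -> S *m unit4 F l = unit4 F k.
  move=> k4 l4 e; rewrite -col_unit4; apply/colP => i; rewrite !mxE andbT -val_eqE /= !inordK //.
  by rewrite e.
exists (invmx (P *m S)^T); first by rewrite unitmx_inv unitmx_tr unitmx_mul uP.
by rewrite invmxK -!trmx_mul -!mulmxA (Se 0%N 2%N) // (Se 1%N 3%N) // -eu -ev !trmxK.
Qed.

(** Every line is an intersection of two planes, and dependent p, q give the zero vector. Identities
    on Pluecker vectors can therefore be proved for pairs of binary cubics. *)
Lemma plucker_dualpl p q : exists u v, plucker p q = dualpl u v.
Proof.
have [r2|r2] := eqVneq (\rank (row_mx p q)) 2%N.
  have [P uP [-> ->]] := complete_pair r2.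
  by do 2!eexists; rewrite plucker_adapted // -dualplZl; reflexivity.
exists 0, 0; have -> : dualpl 0 0 = 0 :> 'cV[F]_6.
  by rewrite -{1}(scale0r (0 : 'rV_4)) dualplZl scale0r.
have w0 : wedge p^T q^T = 0.
  by apply/eqP; apply: contraNT r2 => /wedge_rank; rewrite !trmxK => ->.
have w i j : hcoord p i * hcoord q j - hcoord p j * hcoord q i = 0.
  have := congr1 (fun A : 'M_4 => A (inord i) (inord j)) w0; rewrite wedgeE !mxE => <-.
  by rewrite /hcoord [p (inord j) 0 * _]mulrC.
apply/colP => k; rewrite !mxE !w.
by case: k => -[|[|[|[|[|[|//]]]]]] ?.
Qed.

End DualLines.

(** * Roots of binary cubics over an algebraically closed field *)

Section CubicRoots.
Local Open Scope ring_scope.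
Variable F : numClosedFieldType.
Implicit Types (u v : 'rV[F]_4) (p q r : F * F).

Lemma quadratic_factor (a b c : F) : exists p q,
  [/\ a = p.1 * q.1, b = p.1 * q.2 + p.2 * q.1 & c = p.2 * q.2].
Proof.
(* A vanishing leading coefficient means a root at infinity, with linear factor t. *)
have [->|a0] := eqVneq a 0; first by exists (0, 1), (b, c); split => /=; ring.
have [z hz] := @solve_monicpoly F 2 (nth 0 [:: - c / a; - b / a]) isT.
exists (1, - z), (a, b + a * z); split => /=; try by ring.
move: hz; rewrite !big_ord_recl big_ord0 /= => hz.
have : a * z ^+ 2 = - c - b * z by rewrite hz; field.
move=> e; have -> : c = - (a * z ^+ 2) - b * z by rewrite e; ring.
by ring.
Qed.

Lemma cubic_factor u : exists p q r, u = factored p q r.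
Proof.
rewrite [u]row4P; move: (u 0 (inord 0)) (u 0 (inord 1)) (u 0 (inord 2)) (u 0 (inord 3)).
move=> a b c e.
have fact p q r : a = p.1 * q.1 * r.1 -> b = p.1 * q.1 * r.2 + p.1 * q.2 * r.1 + p.2 * q.1 * r.1 ->
    c = p.1 * q.2 * r.2 + p.2 * q.1 * r.2 + p.2 * q.2 * r.1 -> e = p.2 * q.2 * r.2 ->
    row4 a b c e = factored p q r by move=> -> -> -> ->.
have [a0|a0] := eqVneq a 0.
  have [q [r [eb ec ee]]] := quadratic_factor b c e.
  by exists (0, 1), q, r; apply: fact; rewrite /= ?a0 ?eb ?ec ?ee; ring.
have [z hz] := @solve_monicpoly F 3 (nth 0 [:: - e / a; - c / a; - b / a]) isT.
have [q [r [eb ec ee]]] := quadratic_factor a (b + a * z) (c + b * z + a * z ^+ 2).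
have root : a * z ^+ 3 = - e - c * z - b * z ^+ 2.
  by move: hz; rewrite !big_ord_recl big_ord0 /= => ->; rewrite /bump /=; field.
exists (1, - z), q, r; apply: fact => /=.
- by rewrite eb; ring.
- have -> : b = (b + a * z) - z * a by ring.
  by rewrite ec eb; ring.
- have -> : c = (c + b * z + a * z ^+ 2) - z * (b + a * z) by ring.
  by rewrite ee ec; ring.
rewrite -mulrA -ee.
have -> : e = - (a * z ^+ 3) - c * z - b * z ^+ 2 by rewrite root; ring.
by ring.
Qed.

Lemma cubval_scale v k s t : cubval v (k * s) (k * t) = k ^+ 3 * cubval v s t.
Proof. by rewrite !cubvalE; ring. Qed.

Lemma linear_root p s t : (s, t) != (0, 0) -> p.1 * s + p.2 * t = 0 ->
  exists k, p.2 = k * s /\ - p.1 = k * t.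
Proof.
case: p => a b /= st0 e; have [s0|s0] := eqVneq s 0.
  have t0 : t != 0 by move: st0; rewrite s0 xpair_eqE eqxx.
  exists (- a / t); rewrite divfK // s0 mulr0; split => //.
  by move/eqP: e; rewrite s0 mulr0 add0r mulf_eq0 (negbTE t0) orbF => /eqP.
exists (b / s); rewrite divfK //; split => //.
apply: (mulIf s0); rewrite mulrAC divfK // mulNr; apply/eqP.
by rewrite eq_sym -addr_eq0 addrC e.
Qed.

Lemma cubic_root v : exists s t, (s, t) != (0, 0) /\ cubval v s t = 0.
Proof.
have [p [q [r ->]]] := cubic_factor v.
have [->|p0] := eqVneq p (0, 0).
  by exists 1, 0; rewrite xpair_eqE oner_eq0 cubval_factored /=; split => //; ring.
exists p.2, (- p.1); rewrite cubval_factored; split; last by ring.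
by case: p p0 => a b /=; rewrite !xpair_eqE oppr_eq0 andbC.
Qed.

(** Once u is factored, the resultant is the product of the values of v at the roots of u. If a
    factor is the zero form, then u = 0 and any root of v is a common root. *)
Lemma bez_eq0 u v : bez (wedge u v) = 0 <->
  exists s t, [/\ (s, t) != (0, 0), cubval u s t = 0 & cubval v s t = 0].
Proof.
have [p [q [r eu]]] := cubic_factor u; rewrite {}eu bez_factored; split.
  have root w : cubval v w.2 (- w.1) = 0 -> cubval (factored p q r) w.2 (- w.1) = 0 ->
      (w = (0, 0) -> factored p q r = 0) ->
      exists s t, [/\ (s, t) != (0, 0), cubval (factored p q r) s t = 0 & cubval v s t = 0].
    move=> vw uw w0; have [/w0 u0|wn] := eqVneq w (0, 0).
      have [s [t [st0 vst]]] := cubic_root v.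
      by exists s, t; rewrite u0 /cubval mul0mx mxE.
    exists w.2, (- w.1); split => //.
    by case: w wn {vw uw w0} => a b /=; rewrite !xpair_eqE oppr_eq0 andbC.
  have f0 : row4 0 0 0 0 = 0 :> 'rV[F]_4.
    by apply/rowP => j; rewrite !mxE; case: j => -[|[|[|[|]]]].
  move/eqP; rewrite !mulf_eq0 -orbA => /or3P[] /eqP h.
  - apply: (root p) => // [|->]; first by rewrite cubval_factored; ring.
    by rewrite /factored /= -f0; congr row4; ring.
  - apply: (root q) => // [|->]; first by rewrite cubval_factored; ring.
    by rewrite /factored /= -f0; congr row4; ring.
  - apply: (root r) => // [|->]; first by rewrite cubval_factored; ring.
    by rewrite /factored /= -f0; congr row4; ring.
move=> [s [t [st0 us vs]]].
have vanish w : w.1 * s + w.2 * t = 0 -> cubval v w.2 (- w.1) = 0.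
  by case/(linear_root st0) => k [-> ->]; rewrite cubval_scale vs mulr0.
move/eqP: us; rewrite cubval_factored !mulf_eq0 -orbA => /or3P[] /eqP/vanish ->; ring.
Qed.

End CubicRoots.

(** * Uniqueness of the Chow form of a twisted cubic *)

Section ChowUniqueness.
Local Open Scope ring_scope.
Variable F : numClosedFieldType.
Implicit Types (u v : 'rV[F]_4) (p q r : F * F) (M P : 'M[F]_4).

Lemma adapted_span P (x : 'cV[F]_4) : P \in unitmx ->
  (exists a b, x = a *: (P *m unit4 F 0) + b *: (P *m unit4 F 1)) <->
  ((unit4 F 2)^T *m invmx P *m x) 0 0 = 0 /\ ((unit4 F 3)^T *m invmx P *m x) 0 0 = 0.
Proof.
move=> uP; have coordE k (y : 'cV[F]_4) : ((unit4 F k)^T *m y) 0 0 = hcoord y k.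
  by rewrite /unit4 trmx_delta -rowE mxE.
rewrite -!mulmxA !coordE; split.
  move=> [a [b ->]]; rewrite !scalemxAr -mulmxDr mulKmx //.
  by rewrite /hcoord !mxE -!val_eqE /= !inordK //=; split; ring.
move=> [h2 h3]; exists (hcoord (invmx P *m x) 0), (hcoord (invmx P *m x) 1).
rewrite !scalemxAr -mulmxDr -{1}[x](mulKVmx uP); congr (_ *m _).
move: (invmx P *m x) h2 h3 => y h2 h3; apply/colP => k; rewrite !mxE -!val_eqE /= !inordK //.
case: (ord4 k) => ->; rewrite inordK //= -/(hcoord _ _) ?h2 ?h3; ring.
Qed.

(** Two planes through the line restrict to binary cubics on the curve; the line meets the curve
    exactly if these have a common root, that is, if their resultant vanishes. *)
Lemma chow_is_chow_form M (b : 'rV[F]_(nmon 6 3)) : M \in unitmx ->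
  (forall L, veval b L = chow M L) -> is_chow_form (twisted_cubic M) b.
Proof.
move=> uM hb; split.
  (* The planes that cut out s^3 and t^3 on the curve. *)
  apply: (@neq0_veval _ _ _ _ (dualpl ((unit4 F 0)^T *m invmx M) ((unit4 F 3)^T *m invmx M))).
  by rewrite hb chow_dualpl !mulmxKV // bez_unit oppr_eq0 oner_neq0.
move=> p q /complete_pair[P uP [-> ->]].
have -> : (b *m veronese 3 (plucker (P *m unit4 F 0) (P *m unit4 F 1)) = 0) <->
    (bez (wedge (row (inord 2) (invmx P *m M)) (row (inord 3) (invmx P *m M))) = 0).
  have e : veval b (plucker (P *m unit4 F 0) (P *m unit4 F 1)) = vol P ^+ 3 *
      bez (wedge (row (inord 2) (invmx P *m M)) (row (inord 3) (invmx P *m M))).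
    by rewrite hb chow_adapted.
  split=> [b0|z0]; last by rewrite [LHS]mx11_scalar -/(veval _ _) e z0 mulr0 raddf0.
  move/eqP: e; rewrite /veval b0 mxE eq_sym mulf_eq0 expf_eq0 (negbTE (vol_unit uP)).
  by move/eqP.
have cub k s t : cubval (row (inord k) (invmx P *m M)) s t =
    ((unit4 F k)^T *m invmx P *m (M *m std_twisted_cubic s t)) 0 0.
  by rewrite /cubval -row_unit4 !mulmxA.
rewrite bez_eq0; split.
  move=> [s [t [st0 h2 h3]]]; exists (M *m std_twisted_cubic s t); first by exists s, t.
  by apply/adapted_span => //; rewrite -!cub.
move=> [_ [s [t [st0 ->]]] /(adapted_span _ uP)]; rewrite -!cub => -[h2 h3].
by exists s, t.
Qed.

Lemma polyfunMn k (f : 'rV[F]_k -> F) e : polyfun f -> polyfun (fun a => f a *+ e).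
Proof.
move=> hf; apply: (@polyfun_ext _ _ (fun a => e%:R * f a)) => [a|]; first by rewrite mulr_natl.
by apply: polyfunM => //; exact: polyfun_cst.
Qed.

Lemma veval_line (b : 'rV[F]_(nmon 6 3)) L1 L2 : exists w0 w1 w2 w3, forall x y,
  veval b (x *: L1 + y *: L2) =
  w0 * x ^+ 3 + w1 * (x ^+ 2 * y) + w2 * (x * y ^+ 2) + w3 * y ^+ 3.
Proof.
have prodE (s : seq 'I_6) : size s = 3%N -> exists w0 w1 w2 w3, forall x y,
    \prod_(i <- s) (x *: L1 + y *: L2) i 0 =
    w0 * x ^+ 3 + w1 * (x ^+ 2 * y) + w2 * (x * y ^+ 2) + w3 * y ^+ 3.
  case: s => [|i [|j [|k [|//]]]] // _.
  exists (L1 i 0 * L1 j 0 * L1 k 0), (L1 i 0 * L1 j 0 * L2 k 0 + L1 i 0 * L2 j 0 * L1 k 0 +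
     L2 i 0 * L1 j 0 * L1 k 0), (L1 i 0 * L2 j 0 * L2 k 0 + L2 i 0 * L1 j 0 * L2 k 0 +
     L2 i 0 * L2 j 0 * L1 k 0), (L2 i 0 * L2 j 0 * L2 k 0) => x y.
  by rewrite !big_cons big_nil !mxE; ring.
suff [w0 [w1 [w2 [w3 h]]]] : exists w0 w1 w2 w3, forall x y,
    \sum_(k <- index_enum _) b 0 k * \prod_(i <- monomial k) (x *: L1 + y *: L2) i 0 =
    w0 * x ^+ 3 + w1 * (x ^+ 2 * y) + w2 * (x * y ^+ 2) + w3 * y ^+ 3.
  by exists w0, w1, w2, w3 => x y; rewrite vevalE h.
elim: (index_enum _) => [|k r [w0 [w1 [w2 [w3 h]]]]].
  by exists 0, 0, 0, 0 => x y; rewrite big_nil; ring.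
have [z0 [z1 [z2 [z3 hz]]]] := prodE (monomial k) (size_tuple _).
exists (b 0 k * z0 + w0), (b 0 k * z1 + w1), (b 0 k * z2 + w2), (b 0 k * z3 + w3) => x y.
by rewrite big_cons h hz; ring.
Qed.

Definition det2 p q : F := p.1 * q.2 - p.2 * q.1.

Lemma det2_neq0 p q : det2 p q != 0 -> p != (0, 0).
Proof. by apply: contraNneq => ->; rewrite /det2 !mul0r subrr. Qed.

Lemma det2C p q : det2 q p = - det2 p q.
Proof. by rewrite /det2; ring. Qed.

Definition distinct_roots v : Prop := exists p q r,
  [/\ v = factored p q r, det2 p q != 0, det2 p r != 0 & det2 q r != 0].

Lemma factored_root p q r : cubval (factored p q r) p.2 (- p.1) = 0.
Proof. by rewrite cubval_factored; ring. Qed.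

Lemma factoredC p q r : factored p q r = factored q p r.
Proof. by congr row4; ring. Qed.

Lemma factoredAC p q r : factored p q r = factored p r q.
Proof. by congr row4; ring. Qed.

Lemma factored_lin (x y : F) p p' q r :
  factored (x * p.1 + y * p'.1, x * p.2 + y * p'.2) q r =
  x *: factored p q r + y *: factored p' q r.
Proof.
by apply/rowP => j; rewrite !mxE; case: j => -[|[|[|[|//]]]] ? /=; ring.
Qed.

Lemma polyfun_veval k d N (a : 'rV[F]_(nmon N d)) (L : 'rV[F]_k -> 'cV[F]_N) :
  (forall i, polyfun (fun x => L x i 0)) -> polyfun (fun x => veval a (L x)).
Proof.
move=> hL; apply: (polyfun_ext (fun x => esym (vevalE _ _))).
apply: polyfun_sum => l _; apply: polyfunM; first exact: polyfun_cst.
by apply: polyfun_prod => i _.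
Qed.

Lemma polyfun_bez k (W : 'rV[F]_k -> 'M[F]_4) :
  (forall i j, polyfun (fun x => W x i j)) -> polyfun (fun x => bez (W x)).
Proof.
move=> hW; rewrite /bez.
by repeat first [exact: hW | apply: polyfunB | apply: polyfunD | apply: polyfunM
  | apply: polyfunX | apply: polyfunMn].
Qed.

(** Cubics are parametrized by their linear factors because distinctness of the roots is then the
    nonvanishing of a polynomial in the parameters. *)
Definition cubic_of_roots D (a : 'rV[F]_D) : 'rV[F]_4 :=
  factored (co a 0, co a 1) (co a 2, co a 3) (co a 4, co a 5).

Definition disc_roots D (a : 'rV[F]_D) : F :=
  det2 (co a 0, co a 1) (co a 2, co a 3) * det2 (co a 0, co a 1) (co a 4, co a 5) *
  det2 (co a 2, co a 3) (co a 4, co a 5).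

Lemma polyfun_disc_roots D : polyfun (@disc_roots D).
Proof.
have h j : polyfun (fun a : 'rV[F]_D => co a j) := polyfun_co F D j.
by rewrite /disc_roots /det2 /=; repeat first [exact: h | apply: polyfunB | apply: polyfunM].
Qed.

Lemma polyfun_row4 k (f0 f1 f2 f3 : 'rV[F]_k -> F) :
  polyfun f0 -> polyfun f1 -> polyfun f2 -> polyfun f3 ->
  forall i j, polyfun (fun a => row4 (f0 a) (f1 a) (f2 a) (f3 a) i j).
Proof.
move=> h0 h1 h2 h3 i j.
apply: (@polyfun_ext _ _ (fun a => nth 0 [:: f0 a; f1 a; f2 a; f3 a] j)) => [a|].
  by rewrite mxE.
by case: (ord4 j) => ->; rewrite inordK.
Qed.

Lemma polyfun_cubic_of_roots D i j : polyfun (fun a : 'rV[F]_D => cubic_of_roots a i j).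
Proof.
have h k : polyfun (fun a : 'rV[F]_D => co a k) := polyfun_co F D k.
by apply: polyfun_row4; rewrite /=; repeat first [exact: h | apply: polyfunD | apply: polyfunM].
Qed.

Lemma disc_roots_distinct D (a : 'rV[F]_D) :
  disc_roots a != 0 -> distinct_roots (cubic_of_roots a).
Proof.
rewrite /disc_roots !mulf_eq0 !negb_or -andbA => /and3P[d1 d2 d3].
by do 3!eexists; split; [reflexivity | | |].
Qed.

Lemma cubic_of_rootsP u : exists a : 'rV[F]_6, u = cubic_of_roots a.
Proof.
have [p [q [r ->]]] := cubic_factor u.
exists (\row_(i < 6) nth 0 [:: p.1; p.2; q.1; q.2; r.1; r.2] i).
by rewrite /cubic_of_roots !co_row //=; case: p q r => ? ? [? ?] [? ?].
Qed.

Section Fixed.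
Variables (M : 'M[F]_4) (b : 'rV[F]_(nmon 6 3)).
Hypothesis uM : M \in unitmx.
Hypothesis hb : is_chow_form (twisted_cubic M) b.

(** Planes are identified with the binary cubics that they cut out on the curve: [u *m invmx M] is
    the plane belonging to u. *)
Let K u v := veval b (dualpl (u *m invmx M) (v *m invmx M)).

(** At a common root the intersection of the two planes contains a point of the curve. If the planes
    do not intersect in a line, their dual coordinates are zero. *)
Lemma chow_common_root u v s t :
  (s, t) != (0, 0) -> cubval u s t = 0 -> cubval v s t = 0 -> K u v = 0.
Proof.
rewrite /K => st0 us vs; have [w0|w0] := eqVneq (wedge (u *m invmx M) (v *m invmx M)) 0.
  have -> : dualpl (u *m invmx M) (v *m invmx M) = 0 *: 0.
    by apply: dualmx_inj; rewrite dualmx_dualpl w0 dualmxZ scale0r.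
  by rewrite veval_scale expr0n mul0r.
have [P uP [eu ev]] := dualpl_line w0.
have := plucker_adapted uP; rewrite -eu -ev => ep.
have : veval b (plucker (P *m unit4 F 0) (P *m unit4 F 1)) = 0.
  have [_ /(_ _ _ (rank_adapted uP))[_ h]] := hb.
  rewrite /veval h ?mxE //; exists (M *m std_twisted_cubic s t); first by exists s, t.
  apply/adapted_span => //; rewrite -eu -ev !mulmxA !mulmxKV //.
rewrite ep veval_scale => /eqP; rewrite mulf_eq0 expf_eq0 (negbTE (vol_unit uP)).
by move/eqP.
Qed.

Lemma chowC u v : K v u = - K u v.
Proof.
rewrite /K dualplC -scaleN1r veval_scale; ring.
Qed.

(* K (factored p q r) v is a cubic form in p that vanishes at the roots of v. *)
Lemma chow_root_factor v q r : distinct_roots v ->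
  exists k, forall p, K (factored p q r) v = k * cubval v p.2 (- p.1).
Proof.
move=> [b1 [b2 [b3 [ev d12 d13 d23]]]].
pose L p := dualpl (factored p q r *m invmx M) (v *m invmx M).
have [w0 [w1 [w2 [w3 hw]]]] := veval_line b (L b1) (L b2).
(* Cramer coordinates of p with respect to the roots b1 and b2 of v. *)
pose X p := det2 p b2 / det2 b1 b2; pose Y p := det2 b1 p / det2 b1 b2.
have pE p : p = (X p * b1.1 + Y p * b2.1, X p * b1.2 + Y p * b2.2).
  by case: p => p1 p2; rewrite /X /Y /det2 /=; congr (_, _); field.
have KE p : K (factored p q r) v = w0 * X p ^+ 3 + w1 * (X p ^+ 2 * Y p) +
    w2 * (X p * Y p ^+ 2) + w3 * Y p ^+ 3.
  rewrite -hw /K; congr veval; rewrite -!dualplZl -dualplDl !scalemxAl -mulmxDl.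
  by rewrite -factored_lin -pE.
have van p q' r' : v = factored p q' r' -> p != (0, 0) -> K (factored p q r) v = 0.
  move=> e p0; apply: (@chow_common_root _ _ p.2 (- p.1)).
  - by case: p p0 {e} => p1 p2 /=; rewrite !xpair_eqE oppr_eq0 andbC.
  - exact: factored_root.
  - by rewrite e factored_root.
have ev2 : v = factored b2 b1 b3 by rewrite factoredC.
have ev3 : v = factored b3 b1 b2 by rewrite factoredC factoredAC.
(* Vanishing at b1 and b2 kills the extreme coefficients, vanishing at b3 fixes the ratio of the
   other two. *)
have w00 : w0 = 0.
  have := van _ _ _ ev (det2_neq0 d12); rewrite KE => <-.
  by rewrite /X /Y /det2; field.
have w30 : w3 = 0.
  have := van _ _ _ ev2 (det2_neq0 d23); rewrite KE => <-.
  by rewrite /X /Y /det2; field.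
have d3 : b3 != (0, 0) by apply: (@det2_neq0 _ b1); rewrite det2C oppr_eq0.
have d32 : det2 b3 b2 != 0 by rewrite det2C oppr_eq0.
have w12 : w1 = - w2 * det2 b1 b3 / det2 b3 b2.
  have := van _ _ _ ev3 d3; rewrite KE w00 w30 => e.
  have : (w1 * det2 b3 b2 + w2 * det2 b1 b3) * (det2 b3 b2 * det2 b1 b3) = 0.
    by rewrite -[RHS](mulr0 (det2 b1 b2 ^+ 3)) -e /X /Y; field.
  move/eqP; rewrite mulf_eq0 [in X in _ || X]mulf_eq0 (negbTE d32) (negbTE d13) /= orbF.
  by rewrite addr_eq0 => /eqP e'; rewrite mulNr -e' mulfK.
exists (- w2 / (det2 b3 b2 * det2 b1 b2 ^+ 2)) => p.
rewrite KE w00 w30 w12 ev cubval_factored /X /Y.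
move: d12 d32; rewrite /det2 => d12 d32; field.
by rewrite d12 d32.
Qed.

(** As a function of each single linear factor of u, [K] is proportional to the value of v at its
    root. So the factors of u can be replaced by those of u0 one at a time. *)
Lemma chow_exchange u u0 v : distinct_roots v ->
  K u v * bez (wedge u0 v) = K u0 v * bez (wedge u v).
Proof.
move=> dv; have [p [q [r ->]]] := cubic_factor u; have [p0 [q0 [r0 ->]]] := cubic_factor u0.
rewrite !bez_factored; pose g w := cubval v w.2 (- w.1); rewrite -/(g p) -/(g q) -/(g r) -/(g p0).
rewrite -/(g q0) -/(g r0).
have ex w w' q' r' : K (factored w q' r') v * g w' = K (factored w' q' r') v * g w.
  by have [k hk] := chow_root_factor q' r' dv; rewrite !hk -/(g _) -/(g _); ring.
have -> : K (factored p q r) v * (g p0 * g q0 * g r0) =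
  (K (factored p q r) v * g p0) * g q0 * g r0 by ring.
rewrite ex factoredC.
have -> : K (factored q p0 r) v * g p * g q0 * g r0 =
  (K (factored q p0 r) v * g q0) * g p * g r0 by ring.
rewrite ex factoredC factoredAC factoredC.
have -> : K (factored r p0 q0) v * g q * g p * g r0 =
  (K (factored r p0 q0) v * g r0) * g p * g q by ring.
by rewrite ex factoredC factoredAC; ring.
Qed.

(* K u v and the resultant of u and v have the same zeros; chow_exchange shows
   that their ratio does not depend on u and, by antisymmetry, not on v. *)
Lemma chow_unique_cubics : exists l, forall u v, K u v = l * bez (wedge u v).
Proof.
(* [u0] = s t (s + t) and [v0] = (s + 2t)(s + 3t)(s - t) have six different roots in total; their
   resultant is 24. *)
pose a0 : 'rV[F]_6 := \row_(i < 6) nth 0 [:: 1; 0; 0; 1; 1; 1] i.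
pose v0 := factored (1, 2%:R) (1, 3%:R) (1, -1) : 'rV[F]_4.
pose u0 := cubic_of_roots a0.
have nz k : (k.+1)%:R != 0 :> F by rewrite pnatr_eq0.
have u0v0 : bez (wedge u0 v0) != 0.
  rewrite /u0 /cubic_of_roots /a0 !co_row //= bez_factored !cubval_factored /=.
  by rewrite (_ : _ * _ = 24%:R) ?nz //; ring.
have da0 : disc_roots a0 != 0.
  rewrite /disc_roots /a0 !co_row // /det2 /=.
  by rewrite (_ : _ * _ = -1) ?oppr_eq0 ?oner_neq0 //; ring.
have dv0 : distinct_roots v0.
  exists (1, 2%:R), (1, 3%:R), (1, -1); split => //.
  - by rewrite /det2 /= (_ : _ - _ = 1%:R) ?nz //; ring.
  - by rewrite /det2 /= (_ : _ - _ = - 3%:R) ?oppr_eq0 ?nz //; ring.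
  - by rewrite /det2 /= (_ : _ - _ = - 4%:R) ?oppr_eq0 ?nz //; ring.
pose l := K u0 v0 / bez (wedge u0 v0); exists l => u v.
have Kv0 w : K w v0 = l * bez (wedge w v0).
  by apply: (mulIf u0v0); rewrite (chow_exchange w u0 dv0) /l; field.
(* A cubic u with distinct roots is admissible in [chow_exchange] after swapping the arguments. The
   general case follows since the difference of both sides is a polynomial in the linear factors of
   u. *)
have [a ->] := cubic_of_rootsP u; apply/eqP; rewrite -subr_eq0; apply/negPn/negP => na.
pose f (a : 'rV[F]_6) := K (cubic_of_roots a) v - l * bez (wedge (cubic_of_roots a) v).
pose g (a : 'rV[F]_6) := disc_roots a * bez (wedge (cubic_of_roots a) v0).
have hw w (h : 'rV[F]_6 -> 'rV[F]_4) : (forall i j, polyfun (fun a => h a i j)) ->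
    forall i j, polyfun (fun a => wedge (h a) w i j).
  move=> hh i j; apply: (polyfun_ext (fun a => esym (wedgeE _ _ _ _))).
  by apply: polyfunB; apply: polyfunM => //; exact: polyfun_cst.
have hf : polyfun f.
  apply: polyfunB; last first.
    apply: polyfunM; first exact: polyfun_cst.
    by apply: polyfun_bez; apply: hw => i j; exact: polyfun_cubic_of_roots.
  apply: (polyfun_veval b (L := fun a => dualpl (cubic_of_roots a *m invmx M) (v *m invmx M))).
  have hwM := hw (v *m invmx M) (fun a => cubic_of_roots a *m invmx M)
    (polyfun_mulmx (@polyfun_cubic_of_roots 6) (fun i j => polyfun_cst _ (invmx M i j))).
  move=> i; apply: (polyfun_ext (fun a => esym (mxE _ _ _ _))).
  by case: i => -[|[|[|[|[|[|//]]]]]] ? /=; do ?apply: polyfunN; exact: hwM.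
have hg : polyfun g.
  apply: polyfunM; first exact: polyfun_disc_roots.
  by apply: polyfun_bez; apply: hw => i j; exact: polyfun_cubic_of_roots.
have [|c] := polyfun_generic2 hf hg na (_ : g a0 != 0); first by rewrite mulf_neq0.
rewrite mulf_eq0 [g c == 0]mulf_eq0 !negb_or => /and3P[fc dc bc].
case/negP: fc; rewrite subr_eq0; apply/eqP/(mulIf bc).
have := chow_exchange v v0 (disc_roots_distinct dc).
rewrite !(chowC (cubic_of_roots c)) !(wedgeC (cubic_of_roots c)) !bezN !mulrNN => ->.
by rewrite Kv0; ring.
Qed.

Lemma chow_unique : exists l, forall p q : 'cV[F]_4,
  veval b (plucker p q) = l * chow M (plucker p q).
Proof.
have [l hl] := chow_unique_cubics; exists l => p q.
have [u [v ->]] := plucker_dualpl p q; rewrite chow_dualpl -hl /K.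
by rewrite !mulmxK.
Qed.

End Fixed.
End ChowUniqueness.

(** * Images of twisted cubics *)

Section TwistedCubics.
Local Open Scope ring_scope.
Local Open Scope classical_set_scope.
Variables (F : numClosedFieldType) (n : nat) (C : 'I_n -> 'M[F]_(3, 4)).
Hypothesis hC : forall i, is_camera (C i).

Lemma pluckerDl (p q c : 'cV[F]_4) : plucker (p + q) c = plucker p c + plucker q c.
Proof. by rewrite -!Emx_mulmx mulmxDr. Qed.

Lemma pluckerZl k (p c : 'cV[F]_4) : plucker (k *: p) c = k *: plucker p c.
Proof. by rewrite -!Emx_mulmx -scalemxAr. Qed.

Lemma plucker_self (c : 'cV[F]_4) : plucker c c = 0.
Proof.
apply/colP => k; rewrite !mxE; case: k => -[|[|[|[|[|[|//]]]]]] ? /=; ring.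
Qed.

Lemma hatC_mul i (x : 'cV[F]_3) :
  hatC (C i) *m x = plucker (pinvmx (C i) *m x) (center (C i)).
Proof. by rewrite -Emx_mulmx /hatC -mulmxA. Qed.

Lemma hatC_plucker i (q : 'cV[F]_4) :
  hatC (C i) *m (C i *m q) = plucker q (center (C i)).
Proof.
have [a {2}->] := camera_decomp q (hC i).
by rewrite hatC_mul pluckerDl pluckerZl plucker_self scaler0 addr0.
Qed.

Definition tw (M : 'M[F]_4) : 'M[F]_(n, nmon 3 3) := Psi C (chowrow M).

Lemma veval_Psi (b : 'rV[F]_(nmon 6 3)) i x :
  veval (row i (Psi C b)) x = veval b (hatC (C i) *m x).
Proof. by rewrite /Psi rowK veval_mulmx. Qed.

Lemma veval_tw M i x : veval (row i (tw M)) x = chow M (hatC (C i) *m x).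
Proof. by rewrite veval_Psi veval_chowrow. Qed.

Lemma veval_tw_proj M i q : veval (row i (tw M)) (C i *m q) = chow M (plucker q (center (C i))).
Proof. by rewrite veval_tw hatC_plucker. Qed.

(** The images evaluate the form only at the lines through the centers, which are Pluecker vectors;
    the factor is the same in all views. *)
Lemma Psi_scale k (b b' : 'rV[F]_(nmon 6 3)) :
  (forall p q : 'cV[F]_4, veval b (plucker p q) = k * veval b' (plucker p q)) ->
  Psi C b = \matrix_(i, j) (k * Psi C b' i j).
Proof.
move=> h; apply/row_matrixP => i; apply: veval_inj => x.
have -> : row i (\matrix_(i, j) (k * Psi C b' i j)) = k *: row i (Psi C b').
  by apply/rowP => j; rewrite !mxE.
by rewrite vevalZ !veval_Psi hatC_mul h.
Qed.

Lemma tw_scale k M N : (forall p q : 'cV[F]_4, chow M (plucker p q) = k * chow N (plucker p q)) ->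
  tw M = \matrix_(i, j) (k * tw N i j).
Proof. by move=> h; apply: Psi_scale => p q; rewrite !veval_chowrow. Qed.

Lemma polymap_tw k (M : 'rV[F]_k -> 'M[F]_4) :
  (forall i j, polyfun (fun a => M a i j)) -> polymap (fun a => tw (M a)).
Proof.
move=> hM i j; apply: (@polyfun_ext _ _ (fun a =>
  (chowrow (M a) *m veronese_mx 3 (hatC (C i))) 0 j)) => [a|]; first by rewrite [RHS]mxE.
by apply: polyfun_mulmx => i' j'; [exact: polyfun_chowrow | exact: polyfun_cst].
Qed.

Definition twf (v : 'rV[F]_(4 * 4)) := tw (vec_mx v).

Lemma polymap_twf : polymap twf.
Proof.
apply: polymap_tw => i j; apply: polyfun_ext (polyfun_coord F (mxvec_index i j)) => v.
by rewrite mxE.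
Qed.

Lemma tw_row_nonzero i : exists M, row i (tw M) != 0.
Proof.
have cT0 : (center (C i))^T != 0 by rewrite -trmx0 (inj_eq trmx_inj) center_neq0.
have [Q Qu Qc] := complete_basis (inordK (isT : (0 < 4)%N)) cT0.
(* A matrix of rank two is enough: it parametrizes a line disjoint from the test line, whose two
   planes cut out s^3 and t^3. *)
pose N : 'M[F]_4 := delta_mx (inord 2) (inord 0) + delta_mx (inord 3) (inord 3).
exists (Q^T *m N); apply: (@neq0_veval _ _ _ _ (C i *m (Q^T *m unit4 F 1))).
have ec : center (C i) = Q^T *m unit4 F 0.
  by rewrite -[center _]trmxK -Qc rowE trmx_mul trmx_delta.
rewrite veval_tw_proj ec chow_mulmx mulf_neq0 ?expf_neq0 ?vol_unit ?unitmx_tr //.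
have -> : plucker (unit4 F 1) (unit4 F 0) = dualpl (unit4 F 3)^T (unit4 F 2)^T.
  rewrite dualplC -plucker_unit4; apply/colP => k; rewrite !mxE.
  by case: k => -[|[|[|[|[|[|//]]]]]] ? /=; ring.
have ne k l : (k < 4)%N -> (l < 4)%N -> (inord k == inord l :> 'I_4) = (k == l).
  by move=> k4 l4; rewrite -val_eqE /= !inordK.
have r2 : (unit4 F 2)^T *m N = (unit4 F 0)^T.
  by rewrite /unit4 /N !trmx_delta mulmxDr !mul_delta_mx_cond !ne //= mulr0n addr0.
have r3 : (unit4 F 3)^T *m N = (unit4 F 3)^T.
  by rewrite /unit4 /N !trmx_delta mulmxDr !mul_delta_mx_cond !ne //= mulr0n add0r.
by rewrite chow_dualpl r2 r3 wedgeC bezN bez_unit opprK oner_neq0.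
Qed.

Lemma twf_row_nonzero i : exists v, row i (twf v) != 0.
Proof. by have [M hM] := tw_row_nonzero i; exists (mxvec M); rewrite /twf mxvecK. Qed.

(** Under a linear map from a single projective space the multidegree is replaced by its sum. *)
Lemma mhfun_linear_comp m N N' e (p : {mpoly F[m * N]}) (f : 'M[F]_(1, N') -> 'M[F]_(m, N)) :
  (forall i j, mhfun (fun=> 1%N) (fun b => f b i j)) -> mhdeg e p ->
  mhfun (fun=> (\sum_i e i)%N) (fun b => pval p (f b)).
Proof.
move=> hf hp.
apply: (@mhfun_ext _ _ _ _ (fun b => \sum_(mm <- msupp p | mm \in msupp p)
    p@_mm * \prod_k mxvec (f b) 0 k ^+ mm k)) => [b|].
  by rewrite /pval mevalE -big_seq.
apply: mhfun_sum => mm mp; apply: mhfunZ.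
have hk k : mhfun (fun=> (mm k * 1)%N) (fun b => mxvec (f b) 0 k ^+ mm k).
  apply: mhfunX; case/mxvec_indexP: k => i j.
  by apply: mhfun_ext (hf i j) => b; rewrite mxvecE.
apply: mhfun_deg (mhfun_prod (index_enum _) hk) => i0.
rewrite (reindex _ (curry_mxvec_bij _ _)) /=.
transitivity (\sum_i \sum_j mm (mxvec_index i j))%N.
  rewrite pair_bigA /=; apply: eq_bigr => -[i j] _ /=; exact: muln1.
by apply: eq_bigr => i _; apply: hp.
Qed.

Let A : set 'rV[F]_(nmon 6 3) :=
  [set b | exists2 M : 'M[F]_4, M \in unitmx & is_chow_form (twisted_cubic M) b].

Lemma A_mpoints : A `<=` @mpoints F 1 (nmon 6 3).
Proof.
move=> b [M uM [b0 _]] i; rewrite ord1; apply: contra_neq b0 => e.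
by rewrite -[b](row_id 0) e.
Qed.

Lemma A_Psi b : A b -> exists k v, Psi C b = \matrix_(i, j) (k * twf v i j).
Proof.
move=> [M uM hb]; have [k hk] := chow_unique uM hb.
exists k, (mxvec M); rewrite /twf mxvecK; apply: Psi_scale => p q.
by rewrite hk veval_chowrow.
Qed.

Lemma mhfun_Psi i j : mhfun (fun=> 1%N) (fun b : 'rV[F]_(nmon 6 3) => Psi C b i j).
Proof.
apply: mhfun_deg (mhfun_ext _ (mhfun_row_lin 0 (veronese_mx 3 (hatC (C i))) j)) => [k|b].
  by rewrite ord1 eqxx.
by rewrite [RHS]mxE row_id.
Qed.

(** Here b is only a limit of Chow forms, and some Chow forms may have images with zero rows. The
    pulled back equation is multiplied by one entry per row that is nonzero at b: the product
    vanishes on all Chow forms, hence at b. *)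
Lemma Ch_tw_vanish p : multihomog p -> (forall P, zimage twf P -> pval p P = 0) ->
  forall b, Ch_tw b -> mpoints (Psi C b) -> pval p (Psi C b) = 0.
Proof.
move=> [e he] vp b; rewrite /Ch_tw -/A zclosureE; last exact: A_mpoints.
move=> [_ vb] mb; have [J hJ] := mpoints_entries mb.
have hp : mhfun _ (fun b => pval p (Psi C b)) := mhfun_linear_comp mhfun_Psi he.
have [q hq eq] := mhfunM hp (mhfun_prod (index_enum 'I_n) (fun i => mhfun_Psi i (J i))).
have := vb q (mhdeg_multihomog hq); rewrite -eq => h; apply/eqP.
have : pval p (Psi C b) * \prod_i Psi C b i (J i) = 0.
  apply: h => b' Ab'; rewrite -eq; apply/eqP; rewrite mulf_eq0 -implyNb; apply/implyP.
  apply: contraNT; rewrite prodf_seq_neq0 => /allP nz.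
  have [k [v ev]] := A_Psi Ab'.
  have tnz i : twf v i (J i) != 0.
    have := nz i (mem_index_enum _); rewrite ev mxE mulf_eq0 negb_or.
    by case/andP.
  rewrite ev (mhdeg_scale (fun=> k) _ he) vp ?mulr0 //; split; last by exists v.
  by move=> i; apply: entry_row_neq0 (tnz i).
move/eqP; rewrite mulf_eq0 => /orP[//|]; rewrite prodf_seq_eq0 => /hasP[i _] /=.
by rewrite (negbTE (hJ i)).
Qed.

Lemma polyfun_det k m (M : 'rV[F]_k -> 'M[F]_m) :
  (forall i j, polyfun (fun a => M a i j)) -> polyfun (fun a => \det (M a)).
Proof.
move=> hM; rewrite /determinant; apply: polyfun_sum => s _.
by apply: polyfunM; [exact: polyfun_cst | apply: polyfun_prod].
Qed.

(** The parametrization also runs through singular matrices, but an equation that fails at one of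
    them fails at an invertible one, too. *)
Lemma twisted_cubic_mvE : twisted_cubic_mv C = zclosure (zimage twf).
Proof.
have sub : rational_image (@Ch_tw F) (Psi C) `<=` @mpoints F n (nmon 3 3).
  by move=> P [b [_ mP] <-].
rewrite /twisted_cubic_mv; apply/seteqP; split.
  apply: zclosure_sub sub => [|Q p [b [Cb mb] <-] hp vp]; first exact: zimage_mpoints.
  exact: Ch_tw_vanish.
apply: zclosure_sub (@zimage_mpoints _ _ _ _ _) => // Q p [mQ [v eQ]] hp vp.
apply/eqP/negPn/negP; rewrite eQ => pv; rewrite eQ in mQ.
have hdet : polyfun (fun v : 'rV[F]_(4 * 4) => \det (vec_mx v : 'M[F]_4)).
  apply: polyfun_det => i j; apply: polyfun_ext (polyfun_coord F (mxvec_index i j)) => w.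
  by rewrite mxE.
have [|c hc] := polyfun_generic2 (b := mxvec 1%:M) (polymap_pval p polymap_twf) hdet pv.
  by rewrite mxvecK det1 oner_neq0.
have [w mw] := polymap_generic polymap_twf twf_row_nonzero
  (polyfunM (polymap_pval p polymap_twf) hdet) hc.
rewrite mulf_eq0 negb_or => /andP[pw dw]; case/eqP: pw; apply: vp.
exists (chowrow (vec_mx w)) => //; split; last exact: mw.
apply: sub_zclosure; exists (vec_mx w); first by rewrite unitmxE unitfE.
apply: chow_is_chow_form; last exact: veval_chowrow.
by rewrite unitmxE unitfE.
Qed.

Lemma twisted_cubic_mv_irreducible : zirreducible (twisted_cubic_mv C).
Proof.
rewrite twisted_cubic_mvE.
exact: zclosure_image_irreducible polymap_twf twf_row_nonzero.
Qed.

End TwistedCubics.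

(** * Substitutions of the curve parameters *)

Section Substitution.
Local Open Scope ring_scope.
Variable F : numClosedFieldType.
Implicit Types (u v : 'rV[F]_4) (p q r : F * F) (M : 'M[F]_4).

(* Action on binary cubics of the substitution s := a s + b t, t := c s + d t. *)
Definition sym3 (a b c d : F) : 'M[F]_4 :=
  mx_of_rows 4 4
    [:: [:: a ^+ 3; a ^+ 2 * b *+ 3; a * b ^+ 2 *+ 3; b ^+ 3];
        [:: a ^+ 2 * c; a ^+ 2 * d + a * b * c *+ 2; a * b * d *+ 2 + b ^+ 2 * c; b ^+ 2 * d];
        [:: a * c ^+ 2; a * c * d *+ 2 + b * c ^+ 2; a * d ^+ 2 + b * c * d *+ 2; b * d ^+ 2];
        [:: c ^+ 3; c ^+ 2 * d *+ 3; c * d ^+ 2 *+ 3; d ^+ 3]].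

Lemma sym3_entry u a b c d : u *m sym3 a b c d =
  row4 (u 0 (inord 0) * a ^+ 3 + u 0 (inord 1) * (a ^+ 2 * c) + u 0 (inord 2) * (a * c ^+ 2)
         + u 0 (inord 3) * c ^+ 3)
    (u 0 (inord 0) * (a ^+ 2 * b *+ 3) + u 0 (inord 1) * (a ^+ 2 * d + a * b * c *+ 2)
       + u 0 (inord 2) * (a * c * d *+ 2 + b * c ^+ 2) + u 0 (inord 3) * (c ^+ 2 * d *+ 3))
    (u 0 (inord 0) * (a * b ^+ 2 *+ 3) + u 0 (inord 1) * (a * b * d *+ 2 + b ^+ 2 * c)
       + u 0 (inord 2) * (a * d ^+ 2 + b * c * d *+ 2) + u 0 (inord 3) * (c * d ^+ 2 *+ 3))
    (u 0 (inord 0) * b ^+ 3 + u 0 (inord 1) * (b ^+ 2 * d) + u 0 (inord 2) * (b * d ^+ 2)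
         + u 0 (inord 3) * d ^+ 3).
Proof.
apply/rowP => j; rewrite [LHS]mxE sum4 !mxE.
by case: (ord4 j) => ->; rewrite !inordK.
Qed.

Lemma cubval_sym3 u a b c d s t :
  cubval (u *m sym3 a b c d) s t = cubval u (a * s + b * t) (c * s + d * t).
Proof. by rewrite sym3_entry !cubvalE !row4E; ring. Qed.

Lemma factored_sym3 p q r a b c d :
  let f w : F * F := (w.1 * a + w.2 * c, w.1 * b + w.2 * d) in
  factored p q r *m sym3 a b c d = factored (f p) (f q) (f r).
Proof. by rewrite sym3_entry !row4E /factored /=; congr row4; ring. Qed.

(** By the product formula the resultant consists of three values of v, and each contributes the
    third power of the determinant. *)
Lemma bez_sym3 u v a b c d :
  bez (wedge (u *m sym3 a b c d) (v *m sym3 a b c d)) = (a * d - b * c) ^+ 9 * bez (wedge u v).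
Proof.
have [p [q [r ->]]] := cubic_factor u; rewrite factored_sym3 !bez_factored !cubval_sym3 /=.
have e w : cubval v (a * (w.1 * b + w.2 * d) + b * - (w.1 * a + w.2 * c))
    (c * (w.1 * b + w.2 * d) + d * - (w.1 * a + w.2 * c)) =
    (a * d - b * c) ^+ 3 * cubval v w.2 (- w.1).
  by rewrite -cubval_scale; congr cubval; ring.
by rewrite !e; ring.
Qed.

Lemma chow_sym3 M a b c d (p q : 'cV[F]_4) :
  chow (M *m sym3 a b c d) (plucker p q) = (a * d - b * c) ^+ 9 * chow M (plucker p q).
Proof.
by have [u [v ->]] := plucker_dualpl p q; rewrite !chow_dualpl !mulmxA bez_sym3.
Qed.

Lemma chowZ k M (p q : 'cV[F]_4) : chow (k *: M) (plucker p q) = k ^+ 6 * chow M (plucker p q).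
Proof.
have [u [v ->]] := plucker_dualpl p q; rewrite !chow_dualpl -!scalemxAr.
have -> : wedge (k *: (u *m M)) (k *: (v *m M)) = k ^+ 2 *: wedge (u *m M) (v *m M).
  by apply/matrixP => i j; rewrite [RHS]mxE !wedgeE !mxE; ring.
by rewrite bezZ -exprM.
Qed.

(* Three points of the projective line can be moved to 0, infinity and 1. *)
Lemma normalize_cubic u : distinct_roots u -> exists a b c d k,
  [/\ a * d - b * c != 0, k != 0 & u *m sym3 a b c d = k *: row4 0 1 (-1) 0].
Proof.
move=> [p [q [r [-> dpq dpr dqr]]]].
have drq : det2 r q != 0 by rewrite det2C oppr_eq0.
(* By Cramer, r = x p + y q. The substitution chosen below turns p, q, r into s / x, - t / y and s -
   t. *)
pose D := det2 p q; pose x := det2 r q / D; pose y := det2 p r / D.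
have D0 : D != 0 := dpq.
have x0 : x != 0 by rewrite mulf_neq0 ?invr_neq0.
have y0 : y != 0 by rewrite mulf_neq0 ?invr_neq0.
exists (q.2 / x / D), (p.2 / y / D), (- q.1 / x / D), (- p.1 / y / D), (- (x * y)^-1); split.
- have -> : q.2 / x / D * (- p.1 / y / D) - p.2 / y / D * (- q.1 / x / D) =
      - ((p.1 * q.2 - p.2 * q.1) * (x * y * D ^+ 2)^-1).
    by field; rewrite x0 y0 dpq.
  by rewrite oppr_eq0 mulf_neq0 // invr_neq0 // mulf_neq0 ?expf_neq0 // mulf_neq0.
- by rewrite oppr_eq0 invr_neq0 // mulf_neq0.
rewrite factored_sym3 /=.
have ep : (p.1 * (q.2 / x / D) + p.2 * (- q.1 / x / D),
           p.1 * (p.2 / y / D) + p.2 * (- p.1 / y / D)) = (x^-1, 0).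
  congr (_, _); last by ring.
  transitivity ((p.1 * q.2 - p.2 * q.1) / D * x^-1); first by ring.
  by rewrite (mulfV D0 : (p.1 * q.2 - p.2 * q.1) / D = 1) mul1r.
have eq : (q.1 * (q.2 / x / D) + q.2 * (- q.1 / x / D),
           q.1 * (p.2 / y / D) + q.2 * (- p.1 / y / D)) = (0, - y^-1).
  congr (_, _); first by ring.
  transitivity (- ((p.1 * q.2 - p.2 * q.1) / D * y^-1)); first by ring.
  by rewrite (mulfV D0 : (p.1 * q.2 - p.2 * q.1) / D = 1) mul1r.
have er : (r.1 * (q.2 / x / D) + r.2 * (- q.1 / x / D),
           r.1 * (p.2 / y / D) + r.2 * (- p.1 / y / D)) = (1, - 1).
  congr (_, _).
    transitivity ((r.1 * q.2 - r.2 * q.1) / D * x^-1); first by ring.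
    exact: mulfV x0.
  transitivity (- ((p.1 * r.2 - p.2 * r.1) / D * y^-1)); first by ring.
  by rewrite (mulfV y0 : (p.1 * r.2 - p.2 * r.1) / D * y^-1 = 1).
rewrite ep eq er; apply/rowP => j; rewrite !mxE /=.
by case: (ord4 j) => ->; rewrite inordK //=; field; rewrite x0 y0.
Qed.

End Substitution.

(** * Twelve parameters for twisted cubics *)

Section TwistedSlice.
Local Open Scope ring_scope.
Local Open Scope classical_set_scope.
Variables (F : numClosedFieldType) (n : nat) (C : 'I_n -> 'M[F]_(3, 4)).
Hypothesis hC : forall i, is_camera (C i).

Definition mx_top (D o : nat) (u : 'rV[F]_4) (a : 'rV[F]_D) : 'M[F]_4 :=
  \matrix_(i, j) (if nat_of_ord i is k.+1 then co a (o + k * 4 + j) else u 0 j).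

Lemma mx_top_surj D o (u : 'rV[F]_4) (M : 'M[F]_4) (g : nat -> F) : (o + 12 <= D)%N ->
  row (inord 0) M = u ->
  M = mx_top o u (\row_(j < D) (if (o <= j)%N then
    M (inord ((j - o) %/ 4).+1) (inord ((j - o) %% 4)) else g j)).
Proof.
move=> oD <-; apply/matrixP => i j; rewrite [RHS]mxE.
case ei: (nat_of_ord i) => [|k]; first by rewrite mxE; congr (M _ _); apply: val_inj; rewrite /= inordK.
have k3 : (k < 3)%N by rewrite -ltnS -ei ltn_ord.
have lt : (o + k * 4 + j < D)%N.
  apply: leq_trans oD; rewrite -addnA ltn_add2l.
  apply: (@leq_trans (k.+1 * 4)%N); first by rewrite mulSn addnC ltn_add2r.
  by rewrite (leq_mul2r 4 k.+1 3).
pose f j := if (o <= j)%N then M (inord ((j - o) %/ 4).+1) (inord ((j - o) %% 4)) else g j.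
rewrite -[co _ _]/(co (\row_(j < D) f j) _) co_row // /f -addnA leq_addr addKn.
rewrite divnMDl // divn_small // addn0 modnMDl modn_small // inord_val; congr (M _ _).
by apply: val_inj; rewrite /= inordK // -ei ltn_ord.
Qed.

Lemma polyfun_mx_top k o (u : 'rV[F]_k -> 'rV[F]_4) :
  (forall i j, polyfun (fun a => u a i j)) ->
  forall i j, polyfun (fun a => mx_top o (u a) a i j).
Proof.
move=> hu i j; apply: (polyfun_ext (fun a => esym (mxE _ _ _ _))).
by case: (nat_of_ord i) => [|l]; [exact: hu | exact: polyfun_co].
Qed.

(* The twelve parameters left when the substitutions of s and t and the scaling
   are used to make the first coordinate of the parametrization s t (s - t). *)
Definition tw_slice (a : 'rV[F]_12) : 'M[F]_(n, nmon 3 3) :=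
  tw C (mx_top 0 (row4 0 1 (-1) 0) a).

Lemma polymap_tw_slice : polymap tw_slice.
Proof. by apply: polymap_tw; apply: polyfun_mx_top => i j; exact: polyfun_cst. Qed.

Lemma tw_slice_orbit M : distinct_roots (row (inord 0) M) ->
  exists a k, k != 0 /\ tw_slice a = \matrix_(i, j) (k * tw C M i j).
Proof.
move=> /normalize_cubic[a [b [c [d [k [det0 k0 eu]]]]]].
pose N := k^-1 *: (M *m sym3 a b c d).
have rN : row (inord 0) N = row4 0 1 (-1) 0.
  by rewrite /N linearZ /= row_mul eu scalerA mulVf // scale1r.
have := @mx_top_surj 12 0 _ N (fun=> 0) isT rN; set a' := (\row_(j < 12) _) => eN.
exists a', (k^-1 ^+ 6 * (a * d - b * c) ^+ 9); split.
  by rewrite mulf_neq0 // expf_neq0 // invr_neq0.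
apply: tw_scale => p q; rewrite -eN.
by rewrite /N chowZ chow_sym3 mulrA.
Qed.

(** The normalization needs distinct roots of the first row. To make this a polynomial condition,
    the first row is given by its linear factors: 18 = 6 + 12 parameters, which reach every matrix
    because binary cubics factor. *)
Lemma tw_slice_vanish p : multihomog p -> (forall P, zimage tw_slice P -> pval p P = 0) ->
  forall M, mpoints (tw C M) -> pval p (tw C M) = 0.
Proof.
move=> [e he] vp M mM; apply/eqP/negPn/negP => pM.
pose h (a : 'rV[F]_18) := mx_top 6 (cubic_of_roots a) a.
have hh : polymap (fun a => tw C (h a)).
  apply: polymap_tw; apply: polyfun_mx_top; exact: polyfun_cubic_of_roots.
have [b hb] : exists b, M = h b.
  have [r er] := cubic_of_rootsP (row (inord 0) M).
  have eM := @mx_top_surj 18 6 (cubic_of_roots r) M (fun j => co r j) isT er.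
  move: eM; set a := (\row_(j < 18) _) => eM; exists a; rewrite {1}eM /h; congr (mx_top _ _ _).
  pose f j := if (6 <= j)%N then M (inord ((j - 6) %/ 4).+1) (inord ((j - 6) %% 4)) else co r j.
  by rewrite -[a]/(\row_(j < 18) f j) /cubic_of_roots !co_row.
rewrite {M}hb in mM pM.
pose a0 : 'rV[F]_18 := \row_(i < 18) nth 0 [:: 1; 0; 0; 1; 1; 1] i.
have da0 : disc_roots a0 != 0.
  rewrite /disc_roots /a0 !co_row // /det2 /=.
  by rewrite (_ : _ * _ = -1) ?oppr_eq0 ?oner_neq0 //; ring.
have hpd := polyfunM (polymap_pval p hh) (@polyfun_disc_roots F 18).
have [c hc] := polyfun_generic2 (polymap_pval p hh) (@polyfun_disc_roots F 18) pM da0.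
have nz i : exists a, row i (tw C (h a)) != 0 by exists b; apply: mM.
have [a ma] := polymap_generic hh nz hpd hc.
rewrite mulf_eq0 negb_or => /andP[pa da]; case/negP: pa.
have ra : row (inord 0) (h a) = cubic_of_roots a.
  by apply/rowP => j; rewrite [LHS]mxE mxE inordK.
have [|a' [k [k0 ea]]] := @tw_slice_orbit (h a).
  by rewrite ra; apply: disc_roots_distinct.
have : pval p (tw_slice a') = 0.
  apply: vp; split; last by exists a'.
  move=> i; have [j hj] := row_neq0 (ma i); apply: (@entry_row_neq0 _ _ _ _ i j).
  by rewrite ea mxE mulf_neq0.
rewrite ea (mhdeg_scale (fun=> k) _ he) => /eqP; rewrite mulf_eq0 => /orP[|//].
by rewrite prodf_seq_eq0 => /hasP[i _]; rewrite /= expf_eq0 (negbTE k0) andbF.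
Qed.

Lemma twisted_cubic_mv_slice : twisted_cubic_mv C = zclosure (zimage tw_slice).
Proof.
rewrite twisted_cubic_mvE //; apply/seteqP; split.
  apply: zclosure_sub; try exact: zimage_mpoints.
  by move=> Q p [mQ [v eQ]] hp vp; rewrite eQ in mQ *; apply: tw_slice_vanish mQ.
apply: zclosure_sub; try exact: zimage_mpoints.
move=> Q p [mQ [a eQ]] hp; apply; split => //.
by exists (mxvec (mx_top 0 (row4 0 1 (-1) 0) a)); rewrite eQ /twf mxvecK.
Qed.

Lemma twisted_cubic_mv_chain_leq l Z : irred_chain (twisted_cubic_mv C) l Z -> (l <= 12)%N.
Proof. by rewrite twisted_cubic_mv_slice; apply: irred_chain_leq polymap_tw_slice. Qed.

End TwistedSlice.

(** * A chain of length twelve for twisted cubics *)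

Section TwistedChain.
Local Open Scope ring_scope.
Local Open Scope classical_set_scope.
Variable F : numClosedFieldType.
Implicit Types (f : 'rV[F]_4).

Definition rows4 f0 f1 f2 f3 : 'M[F]_4 := \matrix_(i, j) (nth 0 [:: f0; f1; f2; f3] i) 0 j.

Definition cols4 (p q r s : 'cV[F]_4) : 'M[F]_4 := (rows4 p^T q^T r^T s^T)^T.

Lemma cols4_unit4 p q r s :
  (cols4 p q r s *m unit4 F 0 = p) * (cols4 p q r s *m unit4 F 1 = q) *
  (cols4 p q r s *m unit4 F 2 = r) * (cols4 p q r s *m unit4 F 3 = s).
Proof. by do !split; rewrite -col_unit4; apply/colP => i; rewrite !mxE inordK //= mxE. Qed.

Lemma vol_cols4 p q r s : vol (cols4 p q r s) = bracket p q r s.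
Proof. by rewrite /vol !col_unit4 !cols4_unit4. Qed.

(** For lines through a coordinate point, three of the six coefficients vanish and only three rows
    of the matrix remain, as for a projection. *)
Lemma dual_rows4 f0 f1 f2 f3 L :
  (rows4 f0 f1 f2 f3)^T *m dualmx L *m rows4 f0 f1 f2 f3 =
  hcoord L 5 *: wedge f0 f1 - hcoord L 4 *: wedge f0 f2 + hcoord L 3 *: wedge f0 f3
  + hcoord L 2 *: wedge f1 f2 - hcoord L 1 *: wedge f1 f3 + hcoord L 0 *: wedge f2 f3.
Proof.
have RE i j : (i < 4)%N -> rows4 f0 f1 f2 f3 (inord i) j = (nth 0 [:: f0; f1; f2; f3] i) 0 j.
  by move=> lt; rewrite mxE inordK.
have DE i j : (i < 4)%N -> (j < 4)%N -> dualmx L (inord i) (inord j) =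
    nth 0 (nth [::] [:: [:: 0; hcoord L 5; - hcoord L 4; hcoord L 3];
        [:: - hcoord L 5; 0; hcoord L 2; - hcoord L 1];
        [:: hcoord L 4; - hcoord L 2; 0; hcoord L 0];
        [:: - hcoord L 3; hcoord L 1; - hcoord L 0; 0]] i) j.
  by move=> i4 j4; rewrite mxE !inordK.
apply/matrixP => k l; rewrite mxE sum4 ![(_ *m dualmx L) _ _]mxE !sum4.
rewrite ![(rows4 _ _ _ _)^T _ _]mxE !RE // !DE //=.
have ZE (c : F) f f' : (c *: wedge f f') k l = c * (f 0 k * f' 0 l - f' 0 k * f 0 l).
  by rewrite mxE wedgeE.
have AE (A B : 'M[F]_4) : (A + B) k l = A k l + B k l by rewrite mxE.
have NE (A : 'M[F]_4) : (- A) k l = - A k l by rewrite mxE.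
by rewrite !(AE, NE, ZE); ring.
Qed.

(** The implicit equation of the plane curve (f0 : f1 : f): up to a factor, the matrix is the wedge
    of the cubics cut out by two lines through y, and their resultant vanishes if the curve passes
    through y. *)
Definition planecubic f0 f1 f (y0 y1 y2 : F) : F :=
  bez (y2 *: wedge f0 f1 - y1 *: wedge f0 f + y0 *: wedge f1 f).

Definition col4 (a b c d : F) : 'cV[F]_4 := (row4 a b c d)^T.

Lemma hcoord_col4 a b c d k : (k < 4)%N -> hcoord (col4 a b c d) k = nth 0 [:: a; b; c; d] k.
Proof. by move=> lt; rewrite /hcoord /col4 mxE mxE inordK. Qed.

Lemma chow_rows4_3 f0 f1 f2 f3 y0 y1 y2 :
  chow (rows4 f0 f1 f2 f3) (plucker (col4 y0 y1 y2 0) (unit4 F 3)) = planecubic f0 f1 f2 y0 y1 y2.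
Proof.
rewrite /chow dual_rows4 !hcoord_plucker //= !hcoord_col4 // !hcoord_unit4 //=.
rewrite /planecubic; congr bez; apply/matrixP => k l; rewrite !mxE; ring.
Qed.

Lemma chow_rows4_2 f0 f1 f2 f3 y0 y1 y2 :
  chow (rows4 f0 f1 f2 f3) (plucker (col4 y0 y1 0 y2) (unit4 F 2)) = - planecubic f0 f1 f3 y0 y1 y2.
Proof.
rewrite /chow dual_rows4 !hcoord_plucker //= !hcoord_col4 // !hcoord_unit4 //=.
rewrite /planecubic -bezN; congr bez; apply/matrixP => k l; rewrite !mxE; ring.
Qed.

Lemma planecubic_row4 a0 a1 a2 a3 b0 b1 b2 b3 c0 c1 c2 c3 y0 y1 y2 :
  planecubic (row4 a0 a1 a2 a3) (row4 b0 b1 b2 b3) (row4 c0 c1 c2 c3) y0 y1 y2 =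
  let a := nth 0 [:: a0; a1; a2; a3] in let b := nth 0 [:: b0; b1; b2; b3] in
  let c := nth 0 [:: c0; c1; c2; c3] in
  let w i j := y2 * (a i * b j - b i * a j) - y1 * (a i * c j - c i * a j)
    + y0 * (b i * c j - c i * b j) in
  w 0%N 1%N * (w 0%N 3%N + w 1%N 2%N) * w 2%N 3%N - w 0%N 1%N * w 1%N 3%N ^+ 2
  - w 0%N 2%N ^+ 2 * w 2%N 3%N + w 0%N 2%N * w 1%N 3%N * w 0%N 3%N *+ 2
  - (w 0%N 3%N + w 1%N 2%N) * w 0%N 3%N ^+ 2.
Proof.
have WE i j : (i < 4)%N -> (j < 4)%N -> (y2 *: wedge (row4 a0 a1 a2 a3) (row4 b0 b1 b2 b3)
    - y1 *: wedge (row4 a0 a1 a2 a3) (row4 c0 c1 c2 c3)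
    + y0 *: wedge (row4 b0 b1 b2 b3) (row4 c0 c1 c2 c3)) (inord i) (inord j) =
    let a := nth 0 [:: a0; a1; a2; a3] in let b := nth 0 [:: b0; b1; b2; b3] in
    let c := nth 0 [:: c0; c1; c2; c3] in
    y2 * (a i * b j - b i * a j) - y1 * (a i * c j - c i * a j) + y0 * (b i * c j - c i * b j).
  move=> i4 j4; rewrite [LHS]mxE [X in X + _ = _]mxE [X in _ + X + _ = _]mxE.
  by rewrite ![(_ *: wedge _ _) _ _]mxE !wedgeE ![row4 _ _ _ _ _ _]mxE !inordK.
by rewrite /planecubic /bez !WE.
Qed.

Lemma wedge_eq0_same_point (p q : 'cV[F]_4) :
  p != 0 -> q != 0 -> wedge q^T p^T = 0 -> same_point p q.
Proof.
move=> p0 q0 w0; have [j qj] : exists j, q j 0 != 0.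
  apply: contrapT => nj; case/eqP: q0; apply/colP => j; rewrite mxE.
  by apply/eqP/negPn/negP => h; apply: nj; exists j.
have e : p = (p j 0 / q j 0) *: q.
  apply/colP => i; rewrite mxE; apply: (mulIf qj).
  have := congr1 (fun A : 'M[F]_4 => A i j) w0.
  rewrite wedgeE !mxE => /eqP; rewrite subr_eq0 => /eqP h.
  by rewrite -h mulrAC divfK // mulrC.
exists (p j 0 / q j 0) => //; apply: contraNneq p0 => k0.
by rewrite e k0 scale0r.
Qed.

Variables (n : nat) (C : 'I_n -> 'M[F]_(3, 4)).
Hypothesis hC : forall i, is_camera (C i).
Variables i1 i2 : 'I_n.
Hypothesis c12 : ~ same_point (center (C i1)) (center (C i2)).

Let c1 := center (C i1).
Let c2 := center (C i2).

(* Rows of a 12-parameter family of (possibly degenerate) twisted cubics. For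
   a_10 = a_11 = 0 they are sQ, tQ, f2, f3 with a binary quadric Q, and the first
   two images then have the equations y2 Q(y0, y1) = f2(y0, y1) and
   y2 Q(y0, y1) = f3(y0, y1); for a_11 = 0 the first two rows still have the
   common root s + a_9 t = 0. *)
Definition fam0 (a : 'rV[F]_12) : 'rV[F]_4 :=
  row4 (co a 8 + co a 10) (1 + co a 8 * co a 9 + co a 10 * co a 9) (co a 9) (co a 11).
Definition fam1 (a : 'rV[F]_12) : 'rV[F]_4 := row4 0 (co a 8) (1 + co a 8 * co a 9) (co a 9).
Definition fam2 (a : 'rV[F]_12) : 'rV[F]_4 := row4 (1 + co a 0) (co a 1) (co a 2) (1 + co a 3).
Definition fam3 tau (a : 'rV[F]_12) : 'rV[F]_4 :=
  row4 (tau + co a 4) (co a 5) (co a 6) (- tau + co a 7).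

(** Here Q = (s + a_9 t)(a_8 s + t), so a_8 and a_9 move the roots of Q away from s t. The term with
    a_10 is s^2 (s + a_9 t), which removes the common root a_8 s + t = 0 of the first two rows; the
    term with a_11 is t^3 and removes the other one. At the start f2 = s^3 + t^3 and f3 = tau (s^3 -
    t^3). *)
Definition family tau a : 'M[F]_4 := rows4 (fam0 a) (fam1 a) (fam2 a) (fam3 tau a).

Lemma polyfun_rows4 k (g0 g1 g2 g3 : 'rV[F]_k -> 'rV[F]_4) :
  (forall i j, polyfun (fun a => g0 a i j)) -> (forall i j, polyfun (fun a => g1 a i j)) ->
  (forall i j, polyfun (fun a => g2 a i j)) -> (forall i j, polyfun (fun a => g3 a i j)) ->
  forall i j, polyfun (fun a => rows4 (g0 a) (g1 a) (g2 a) (g3 a) i j).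
Proof.
move=> h0 h1 h2 h3 i j; apply: (polyfun_ext (fun a => esym (mxE _ _ _ _))).
by case: (ord4 i) => ->; rewrite inordK //=.
Qed.

Lemma polymap_family k (P : 'rV[F]_k -> 'M[F]_4) (tau : 'rV[F]_k -> F) (a : 'rV[F]_k -> 'rV[F]_12) :
  (forall i j, polyfun (fun w => P w i j)) -> polyfun tau ->
  (forall j, polyfun (fun w => co (a w) j)) ->
  polymap (fun w => tw C (P w *m family (tau w) (a w))).
Proof.
move=> hP ht ha; apply: polymap_tw; apply: polyfun_mulmx => // i j.
by apply: polyfun_rows4; apply: polyfun_row4;
  repeat first [exact: polyfun_cst | exact: ha | exact: ht
    | apply: polyfunD | apply: polyfunN | apply: polyfunM].
Qed.

Lemma center_basis : exists2 P : 'M[F]_4, P \in unitmx & c2 = P *m unit4 F 0 /\ c1 = P *m unit4 F 1.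
Proof.
have w0 : wedge c2^T c1^T != 0.
  apply/negP => /eqP w0; apply: c12.
  exact: wedge_eq0_same_point (center_neq0 _) (center_neq0 _) w0.
by have [P uP] := complete_pair (wedge_rank w0); rewrite !trmxK; exists P.
Qed.

(** With c2 and c1 as the last two basis vectors, view i1 forgets the fourth coordinate and view i2
    the third. The other two basis vectors and [tau] remain free, which makes 4 + 4 + 1
    parameters. *)
Let Pw (w : 'rV[F]_9) : 'M[F]_4 :=
  cols4 (col4 (co w 0) (co w 1) (co w 2) (co w 3)) (col4 (co w 4) (co w 5) (co w 6) (co w 7)) c2 c1.

Lemma Pw_surj u v t : exists w, Pw w = cols4 u v c2 c1 /\ co w 8 = t.
Proof.
pose g := nth 0 [:: hcoord u 0; hcoord u 1; hcoord u 2; hcoord u 3;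
  hcoord v 0; hcoord v 1; hcoord v 2; hcoord v 3; t].
exists (\row_(j < 9) g j); rewrite /Pw !co_row //=; split => //.
by congr cols4; apply/colP => k; rewrite !mxE; case: (ord4 k) => ->; rewrite inordK.
Qed.

Let base (w : 'rV[F]_9) := tw C (Pw w *m family (co w 8) 0).

Lemma family0 tau : family tau 0 =
  rows4 (row4 0 1 0 0) (row4 0 0 1 0) (row4 1 0 0 1) (row4 tau 0 0 (- tau)).
Proof. by rewrite /family /fam0 /fam1 /fam2 /fam3 !co0; congr rows4; congr row4; ring. Qed.

(** The starting curve meets the line through c1 and c2 in (0 : 0 : 1 : tau) and (0 : 0 : 1 : -
    tau). The value vanishes for just these two positions of a center on that line, which is why
    [tau] is kept as a parameter. *)
Lemma chow_family_line tau g d :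
  chow (family tau 0) (plucker (unit4 F 0) (col4 0 0 g d)) =
  - ((g * tau - d) ^+ 2 * (g * tau + d)).
Proof.
rewrite family0 /chow dual_rows4 !hcoord_plucker //= !hcoord_col4 // !hcoord_unit4 //=.
set W := (X in bez X).
have WE i j : (i < 4)%N -> (j < 4)%N -> W (inord i) (inord j) =
    let f := nth 0 [:: 0; 0; 1; 0] in
    let r := nth 0 [:: d - g * tau; 0; 0; d + g * tau] in
    f i * r j - r i * f j.
  move=> i4 j4; rewrite /W.
  have ZE (c : F) f f' k l : (c *: wedge f f') k l = c * (f 0 k * f' 0 l - f' 0 k * f 0 l).
    by rewrite mxE wedgeE.
  have AE (A B : 'M[F]_4) k l : (A + B) k l = A k l + B k l by rewrite mxE.
  have NE (A : 'M[F]_4) k l : (- A) k l = - A k l by rewrite mxE.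
  rewrite !(AE, NE, ZE) ![row4 _ _ _ _ _ _]mxE !inordK //.
  by case: i i4 => [|[|[|[|//]]]] _; case: j j4 => [|[|[|[|//]]]] _ /=; ring.
by rewrite /bez !WE //=; ring.
Qed.

Lemma chow_family_point tau :
  chow (family tau 0) (plucker (unit4 F 1) (unit4 F 0)) = (- (2%:R * tau)) ^+ 3.
Proof.
rewrite family0 /chow dual_rows4 !hcoord_plucker //= !hcoord_unit4 //=.
set W := (X in bez X).
have WE i j : (i < 4)%N -> (j < 4)%N -> W (inord i) (inord j) =
    let f := nth 0 [:: 1; 0; 0; 1] in
    let r := nth 0 [:: tau; 0; 0; - tau] in
    r i * f j - f i * r j.
  move=> i4 j4; rewrite /W.
  have ZE (c : F) f f' k l : (c *: wedge f f') k l = c * (f 0 k * f' 0 l - f' 0 k * f 0 l).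
    by rewrite mxE wedgeE.
  have AE (A B : 'M[F]_4) k l : (A + B) k l = A k l + B k l by rewrite mxE.
  have NE (A : 'M[F]_4) k l : (- A) k l = - A k l by rewrite mxE.
  rewrite !(AE, NE, ZE) ![row4 _ _ _ _ _ _]mxE !inordK //.
  by case: i i4 => [|[|[|[|//]]]] _; case: j j4 => [|[|[|[|//]]]] _ /=; ring.
by rewrite /bez !WE //=; ring.
Qed.

Lemma tw_family_neq0 (P : 'M[F]_4) tau i (p q : 'cV[F]_4) : vol P != 0 ->
  center (C i) = P *m q -> chow (family tau 0) (plucker p q) != 0 ->
  row i (tw C (P *m family tau 0)) != 0.
Proof.
move=> vP ec h; apply: (@neq0_veval _ _ _ _ (C i *m (P *m p))).
by rewrite veval_tw_proj // ec chow_mulmx mulf_neq0 // expf_neq0.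
Qed.

Lemma base_neq0 i u v tau (p q : 'cV[F]_4) : bracket u v c2 c1 != 0 ->
  center (C i) = cols4 u v c2 c1 *m q -> chow (family tau 0) (plucker p q) != 0 ->
  exists w, row i (base w) != 0.
Proof.
move=> b0 ec h; have [w [Pe te]] := Pw_surj u v tau; exists w; rewrite /base Pe te.
by apply: tw_family_neq0 ec h; rewrite vol_cols4.
Qed.

Lemma base_row_nonzero i : exists w, row i (base w) != 0.
Proof.
have [P uP [e2 e1]] := center_basis.
have vP := vol_unit uP.
have [x cx] : exists x, center (C i) = P *m x.
  by exists (invmx P *m center (C i)); rewrite mulKVmx.
(* A center off the line through c1 and c2 is itself taken as the first basis vector. *)
have point v : bracket (center (C i)) v c2 c1 != 0 -> exists w, row i (base w) != 0.
  move=> b0; apply: (base_neq0 (tau := 1) (p := unit4 F 1) (q := unit4 F 0) b0).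
    by rewrite cols4_unit4.
  by rewrite chow_family_point expf_neq0 // oppr_eq0 mulr1 pnatr_eq0.
have [a0|a0] := eqVneq (hcoord x 2) 0; last first.
  apply: (point (P *m unit4 F 3)); rewrite e1 e2 cx bracket_vol mulf_neq0 //.
  rewrite bracketE /= !hcoord_unit4 //=; apply: contra_neq a0 => <-; ring.
have [b0|b0] := eqVneq (hcoord x 3) 0; last first.
  apply: (point (P *m unit4 F 2)); rewrite e1 e2 cx bracket_vol mulf_neq0 //.
  rewrite bracketE /= !hcoord_unit4 //= -oppr_eq0; apply: contra_neq b0 => <-; ring.
have ex : x = hcoord x 0 *: unit4 F 0 + hcoord x 1 *: unit4 F 1.
  apply/colP => k; rewrite !mxE.
  by case: (ord4 k) => ->; rewrite -[x _ _]/(hcoord x _) -!val_eqE /= !inordK //= ?a0 ?b0; ring.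
have buv : bracket (P *m unit4 F 2) (P *m unit4 F 3) c2 c1 != 0.
  rewrite e1 e2 bracket_vol mulf_neq0 // bracketE /= !hcoord_unit4 //=.
  by rewrite (_ : _ + _ = 1) ?oner_neq0 //; ring.
have line tau : (hcoord x 0 * tau - hcoord x 1) * (hcoord x 0 * tau + hcoord x 1) != 0 ->
    exists w, row i (base w) != 0.
  rewrite mulf_eq0 negb_or => /andP[h1 h2].
  apply: (base_neq0 (tau := tau) (p := unit4 F 0)
    (q := col4 0 0 (hcoord x 0) (hcoord x 1)) buv); last first.
    by rewrite chow_family_line oppr_eq0 mulf_neq0 // expf_neq0.
  rewrite cx [in LHS]ex.
  have -> : col4 0 0 (hcoord x 0) (hcoord x 1) =
      hcoord x 0 *: unit4 F 2 + hcoord x 1 *: unit4 F 3.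
    apply/colP => k; rewrite !mxE.
    by case: (ord4 k) => ->; rewrite -!val_eqE /= !inordK //=; ring.
  by rewrite !mulmxDr -!scalemxAr !cols4_unit4 e1 e2.
(* For a center on the line, tau = 1 fails only if the squares of its two coordinates agree; then
   tau = 2 gives three times this square. *)
have [h|] := eqVneq ((hcoord x 0 * 1 - hcoord x 1) * (hcoord x 0 * 1 + hcoord x 1)) 0; last first.
  exact: line.
apply: (line 2%:R); rewrite (_ : _ * _ = 3%:R * hcoord x 0 ^+ 2); last first.
  by rewrite -[LHS]subr0 -h; ring.
rewrite mulf_neq0 ?pnatr_eq0 // expf_neq0 //.
apply/eqP => g0; have d0 : hcoord x 1 = 0.
  apply/eqP; rewrite -sqrf_eq0 -oppr_eq0; apply/eqP; rewrite -[RHS]h g0; ring.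
case/eqP: (center_neq0 (C i)).
by rewrite cx ex g0 d0 !scale0r addr0 mulmx0.
Qed.

Lemma base_generic : exists w, [/\ mpoints (base w), vol (Pw w) != 0 & co w 8 != 0].
Proof.
have [P uP [e2 e1]] := center_basis.
have buv : bracket (P *m unit4 F 2) (P *m unit4 F 3) c2 c1 != 0.
  rewrite e1 e2 bracket_vol mulf_neq0 ?vol_unit // bracketE /= !hcoord_unit4 //=.
  by rewrite (_ : _ + _ = 1) ?oner_neq0 //; ring.
have [w0 [Pe te]] := Pw_surj (P *m unit4 F 2) (P *m unit4 F 3) 1.
have hco j : polyfun (fun w : 'rV[F]_9 => co w j) := polyfun_co F 9 j.
have hP k l : polyfun (fun w => Pw w k l).
  apply: (@polyfun_ext _ _ (fun w => rows4 (col4 (co w 0) (co w 1) (co w 2) (co w 3))^T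
     (col4 (co w 4) (co w 5) (co w 6) (co w 7))^T c2^T c1^T l k)) => [w|].
    by rewrite /Pw /cols4 [RHS]mxE.
  apply: polyfun_rows4 => i j; try exact: polyfun_cst.
    apply: polyfun_ext (polyfun_row4 (hco 0%N) (hco 1%N) (hco 2%N) (hco 3%N) i j) => w.
    by rewrite /col4 trmxK.
  apply: polyfun_ext (polyfun_row4 (hco 4%N) (hco 5%N) (hco 6%N) (hco 7%N) i j) => w.
  by rewrite /col4 trmxK.
have hbase : polymap base.
  by apply: polymap_family => // j; exact: polyfun_cst.
have hg : polyfun (fun w => vol (Pw w) * co w 8).
  apply: polyfunM => //; apply: (polyfun_ext (fun w => esym (bracketE _ _ _ _))) => /=.
  have hc k l : polyfun (fun w => hcoord (col k (Pw w)) l).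
    by apply: (polyfun_ext _ (hP (inord l) k)) => w; rewrite /hcoord [RHS]mxE.
  by repeat first [exact: hc | apply: polyfunB | apply: polyfunD | apply: polyfunM].
have [|w mw] := polymap_generic hbase base_row_nonzero hg (b := w0).
  by rewrite Pe te mulr1 vol_cols4.
by rewrite mulf_eq0 negb_or => /andP[vw tw]; exists w.
Qed.

Lemma tw_mv M : mpoints (tw C M) -> twisted_cubic_mv C (tw C M).
Proof.
move=> mM; rewrite twisted_cubic_mvE //; apply: sub_zclosure; split=> //.
by exists (mxvec M); rewrite /twf mxvecK.
Qed.

Ltac solve0 := let a := fresh "a" in let z := fresh "z" in
  move=> a z; rewrite !big_cons big_nil /= /fam0 /fam1 /fam2 /fam3 !planecubic_row4 /=;
  repeat match goal with |- context [co a ?j] => rewrite (z j isT) end; ring.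

Ltac solve1 := rewrite !big_cons big_nil /= /fam0 /fam1 /fam2 /fam3 !planecubic_row4 /= !co_row //=; ring.

Lemma twisted_cubic_mv_chain : exists Z, irred_chain (twisted_cubic_mv C) 12 Z.
Proof.
have [w [mw vw tau0]] := base_generic.
set P := Pw w in vw; set tau := co w 8 in tau0.
pose f a := tw C (P *m family tau a).
(* [s] lists weights and points: the weighted sum of the values of an image equation isolates the
   information on one coordinate. [b] lists the initial coordinates of the witness, and [v] is the
   sum attained there. *)
have sep (i : 'I_n) (k : nat) (x : F -> F -> F -> 'cV[F]_4) (kap : F) (g : 'rV[F]_12 -> F -> F -> F -> F)
    (s : seq (F * (F * F * F))) (b : seq F) v : kap != 0 ->
    (forall a y0 y1 y2, veval (row i (f a)) (C i *m (P *m x y0 y1 y2)) = kap * g a y0 y1 y2) ->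
    size b = k.+1 ->
    (forall a, (forall j, (k <= j)%N -> co a j = 0) ->
      \sum_(c <- s) c.1 * g a c.2.1.1 c.2.1.2 c.2.2 = 0) ->
    \sum_(c <- s) c.1 * g (\row_(j < 12) nth 0 b j) c.2.1.1 c.2.1.2 c.2.2 = v -> v != 0 ->
    exists e g, [/\ mhfun e g,
      forall a : 'rV_12, (forall j : 'I_12, (k <= j)%N -> a 0 j = 0) -> g (f a) = 0 &
      exists2 a : 'rV_12, (forall j : 'I_12, (k < j)%N -> a 0 j = 0) & g (f a) != 0].
  move=> kap0 val sb van ev v0.
  pose h (M : 'M[F]_(n, nmon 3 3)) := \sum_(c <- s) c.1 * veval (row i M) (C i *m (P *m x c.2.1.1 c.2.1.2 c.2.2)).
  have hE a : h (f a) = kap * \sum_(c <- s) c.1 * g a c.2.1.1 c.2.1.2 c.2.2.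
    by rewrite /h mulr_sumr; apply: eq_bigr => c _; rewrite val mulrCA.
  exists (fun i' => (i' == i) : nat), h; split.
  - by apply: mhfun_sum => c _; apply: mhfunZ; exact: mhfun_veval.
  - by move=> a /co_vanish aj; rewrite hE van ?mulr0.
  exists (\row_(j < 12) nth 0 b j) => [j kj|]; first by rewrite mxE nth_default ?sb.
  by rewrite hE ev mulf_neq0.
have val1 a y0 y1 y2 : veval (row i1 (f a)) (C i1 *m (P *m col4 y0 y1 y2 0)) =
    vol P ^+ 3 * planecubic (fam0 a) (fam1 a) (fam2 a) y0 y1 y2.
  rewrite veval_tw_proj // -/c1 -[c1](cols4_unit4 (col4 (co w 0) (co w 1) (co w 2) (co w 3))
    (col4 (co w 4) (co w 5) (co w 6) (co w 7)) c2 c1).2 -/(Pw w) -/P.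
  by rewrite chow_mulmx chow_rows4_3.
have val2 a y0 y1 y2 : veval (row i2 (f a)) (C i2 *m (P *m col4 y0 y1 0 y2)) =
    - vol P ^+ 3 * planecubic (fam0 a) (fam1 a) (fam3 tau a) y0 y1 y2.
  rewrite veval_tw_proj // -/c2 -[c2](cols4_unit4 (col4 (co w 0) (co w 1) (co w 2) (co w 3))
    (col4 (co w 4) (co w 5) (co w 6) (co w 7)) c2 c1).1.2 -/(Pw w) -/P.
  by rewrite chow_mulmx chow_rows4_2 mulrN mulNr.
have sep1 k s b v := sep i1 k _ _ _ s b v (expf_neq0 3 vw) val1.
have nv : - vol P ^+ 3 != 0 by rewrite oppr_eq0 expf_neq0.
have sep2 k s b v := sep i2 k _ _ _ s b v nv val2.
apply: (@chain_of_flag _ _ _ _ f).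
- apply: polymap_family => [i j||j]; [exact: polyfun_cst | exact: polyfun_cst | exact: polyfun_co].
- by rewrite twisted_cubic_mvE //; apply/zclosed_closure/zimage_mpoints.
- by move=> a; exact: tw_mv.
- exact: mw.
have n2 (j : nat) : (j.+1%:R : F) != 0 by rewrite pnatr_eq0.
case=> [|[|[|[|[|[|[|[|[|[|[|[|//]]]]]]]]]]]] _.
(* For the first four coordinates the equation is y0 y1 y2 - f2(y0, y1) up to sign and the resultant
   of s t and f2. The coefficients of y0^3 and y1^3 are compared with that of y0 y1 y2, so that this
   factor does not matter; those of y0^2 y1 and y0 y1^2 are isolated directly. *)
- by apply: (sep1 _ [:: (1, (1, 0, 0)); (1, (1, 1, 1)); (-1, (1, 1, 0))] [:: 1] (- 2%:R)) => //;
    [solve0 | solve1 | rewrite oppr_eq0].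
- by apply: (sep1 _ [:: (1, (1, 1, 0)); (-1, (1, -1, 0)); (- 2%:R, (0, 1, 0))] [:: 0; 1] (- 2%:R)) => //;
    [solve0 | solve1 | rewrite oppr_eq0].
- by apply: (sep1 _ [:: (1, (1, 1, 0)); (1, (1, -1, 0)); (- 2%:R, (1, 0, 0))] [:: 0; 0; 1] (- 2%:R)) => //;
    [solve0 | solve1 | rewrite oppr_eq0].
- by apply: (sep1 _ [:: (1, (0, 1, 0)); (1, (1, 1, 1)); (-1, (1, 1, 0))] [:: 0; 0; 0; 1] (- 2%:R)) => //;
    [solve0 | solve1 | rewrite oppr_eq0].
(* The same in the second view, where the comparison involves tau and - tau; tau != 0 keeps s t and
   f3 without common root. *)
- by apply: (sep2 _ [:: (1, (1, 0, 0)); (tau, (1, 1, 1)); (- tau, (1, 1, 0))] [:: 0; 0; 0; 0; tau]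
    (2%:R * tau ^+ 3)) => //; [solve0 | solve1 | rewrite mulf_neq0 // expf_neq0].
- by apply: (sep2 _ [:: (1, (1, 1, 0)); (-1, (1, -1, 0)); (- 2%:R, (0, 1, 0))] [:: 0; 0; 0; 0; 0; 1]
    (2%:R * tau ^+ 2)) => //; [solve0 | solve1 | rewrite mulf_neq0 // expf_neq0].
- by apply: (sep2 _ [:: (1, (1, 1, 0)); (1, (1, -1, 0)); (- 2%:R, (1, 0, 0))] [:: 0; 0; 0; 0; 0; 0; 1]
    (2%:R * tau ^+ 2)) => //; [solve0 | solve1 | rewrite mulf_neq0 // expf_neq0].
- by apply: (sep2 _ [:: (1, (0, 1, 0)); (- tau, (1, 1, 1)); (tau, (1, 1, 0))]
    [:: 0; 0; 0; 0; 0; 0; 0; - tau] (- (2%:R * tau ^+ 3))) => //;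
    [solve0 | solve1 | rewrite oppr_eq0 mulf_neq0 // expf_neq0].
(* The coefficient of y0^2 y2, essentially a_8. The witness uses 2 since for a_8 = 1 the forms Q and
   s^3 + t^3 share the root s + t = 0 and the equation is identically zero. *)
- by apply: (sep1 _ [:: (1, (1, 0, 1)); (-1, (1, 0, 0))] [:: 0; 0; 0; 0; 0; 0; 0; 0; 2%:R]
    (- 14%:R)) => //; [solve0 | solve1 | rewrite oppr_eq0].
- by apply: (sep1 _ [:: (1, (0, 1, 1)); (-1, (0, 1, 0))] [:: 0; 0; 0; 0; 0; 0; 0; 0; 0; 2%:R]
    (- 14%:R)) => //; [solve0 | solve1 | rewrite oppr_eq0].
(* The coefficient of y0 y2^2, which is zero as long as the epipole (0 : 0 : 1) is a double
   point. *)
- by apply: (sep1 _ [:: (1, (1, 0, 1)); (1, (1, 0, -1)); (- 2%:R, (1, 0, 0))]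
    [:: 0; 0; 0; 0; 0; 0; 0; 0; 0; 0; 1] (- 2%:R)) => //; [solve0 | solve1 | rewrite oppr_eq0].
(* The value at the epipole, zero as long as the first two rows have a common root. The witness also
   has a_10 = 1, as otherwise t = 0 would be such a root. *)
by apply: (sep1 _ [:: (1, (0, 0, 1))] [:: 0; 0; 0; 0; 0; 0; 0; 0; 0; 0; 1; 1] 1) => //;
  [solve0 | solve1 | rewrite oner_neq0].
Qed.

End TwistedChain.

Local Open Scope ring_scope.

Theorem proposition2p1 (R : realType) (d n : nat) (hd : (2 <= d)%N)
    (C : 'I_n -> 'M[R[i]]_(3, 4)) (hC : forall i, is_camera (C i)) :
  [/\ zirreducible (plane_curve_mv d C),
      zirreducible (twisted_cubic_mv C) &
      (exists i j, ~ same_point (center (C i)) (center (C j))) ->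
      zdim (plane_curve_mv d C) ((d ^ 2 + 3 * d)./2 + 3)%N /\
      zdim (twisted_cubic_mv C) 12%N].
Proof.
split=> [||[i1 [i2 c12]]].
- exact: plane_curve_mv_irreducible.
- exact: twisted_cubic_mv_irreducible.
split; split.
- exact: (@plane_curve_mv_chain R[i] n d C hC hd i1 i2 c12).
- by move=> l Z; apply: plane_curve_mv_chain_leq.
- exact: (@twisted_cubic_mv_chain R[i] n C hC i1 i2 c12).
- by move=> l Z; apply: twisted_cubic_mv_chain_leq.
Qed.
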